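(* Let $\chi\in\hat{\mathfrak h}^*$ be real valued such that $\chi(h_{\alpha_i})<-2$ for $i=1,\dots,l+1$, and let $$c(\chi,w)=q^{\ell(w)(1-g)}\prod_{a\in\hat\Delta_{W,+}\cap w^{-1}\hat\Delta_{W,-}}\frac{\zeta_F(-(\chi+\rho)(h_a))}{\zeta_F(-(\chi+\rho)(h_a)+1)}\qquad(w\in\hat W).$$ Let $m=(m_\nu)_{\nu\in\mathcal V}$ be a tuple of integers, zero for almost all $\nu$, and assume that $\sum_\nu(\log q_\nu)\,m_\nu>0$. Then the infinite series $$\sum_{w\in\hat W}(h\eta^{mD})^{w(\chi+\rho)-\rho}\,c(\chi,w)$$ converges absolutely and uniformly for $h$ varying in any compact set of $\hat H_{\mathbb A}$.
   Context: Affine Lie algebra. Let $\mathfrak g$ be a simple real Lie algebra with Cartan subalgebra $\mathfrak h$, root system $\Delta=\Delta_+\sqcup\Delta_-$, simple roots $\alpha_1,\dots,\alpha_l$, highest root $\alpha_0$, and a Chevalley basis $\{h_{\alpha_1},\dots,h_{\alpha_l}\}\cup\{E_\alpha\}_{\alpha\in\Delta}$; $(\cdot,\cdot)$ is the Killing form normalized by $(h_{\alpha_0},h_{\alpha_0})=2$. Put $\hat{\mathfrak g}^{e}=(\mathbb R[t,t^{-1}]\otimes\mathfrak g)\oplus\mathbb Rc\oplus\mathbb RD$ (standard bracket, $c$ central, $D$ acts as $t\frac{d}{dt}$), $\hat{\mathfrak h}^{e}=\mathfrak h\oplus\mathbb Rc\oplus\mathbb RD$, $\hat{\mathfrak h}=\mathfrak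 h\oplus\mathbb Rc$. Roots in $\Delta$ are extended by $0$ on $c,D$; $\delta$ vanishes on $\hat{\mathfrak h}$ with $\delta(D)=1$; $\alpha_{l+1}=\delta-\alpha_0$. Real roots: $\hat\Delta_W=\{\alpha+n\delta:\alpha\in\Delta,n\in\mathbb Z\}$; positive ones $\hat\Delta_{W,+}=\{\alpha+n\delta:\alpha\in\Delta_+,n\ge0\}\cup\{\alpha+n\delta:\alpha\in\Delta_-,n>0\}$, $\hat\Delta_{W,-}=-\hat\Delta_{W,+}$. Simple coroots: $h_{\alpha_1},\dots,h_{\alpha_l}$, $h_{\alpha_{l+1}}=-h_{\alpha_0}+\frac{2}{(\alpha_0,\alpha_0)}c$. The affine Weyl group $\hat W\subset\mathrm{Aut}(\hat{\mathfrak h}^e)$ is generated by $w_i(x)=x-\alpha_i(x)h_{\alpha_i}$, $1\le i\le l+1$, with length $\ell$; it acts on duals by $(w\mu)(x)=\mu(w^{-1}x)$; for $a=w\alpha_i$ the coroot is $h_a=wh_{\alpha_i}$. Elements of $\hat{\mathfrak h}^*$ are extended to $\hat{\mathfrak h}^e$ by $0$ on $D$; $\rho\in\hat{\mathfrak h}^*$ is given by $\rho(h_{\alpha_i})=1$ for all $i=1,\dots,l+1$. Function field. $F$ is a global function field of genus $g$ with constant field $\mathbb F_q$, $\mathcal V$ its set of places; for $\nu\in\mathcal V$: completion $F_\nu$, ring of integers $\mathcal O_\nu$, uniformizer $\pi_\nu$, residue cardinality $q_\nu$, $|\pi_\nu|_\nu=q_\nu^{-1}$. $\mathbb A$ is the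 adele ring, $|\cdot|$ the idelic norm; $\zeta_F(s)=\prod_\nu(1-q_\nu^{-s})^{-1}$ for $\mathrm{Re}(s)>1$. Torus. Fix $\lambda\in(\hat{\mathfrak h}^e)^*$ with $\lambda(h_{\alpha_i})\in\mathbb Z_{\ge0}$ for $i=1,\dots,l+1$, not all zero; let $V^\lambda$ be the irreducible highest weight $\hat{\mathfrak g}^e$-module, $V^\lambda_{\mathbb Z}$ its Chevalley form (a $\mathbb Z$-form stable under $\xi_a^n/n!$ for $a=\alpha+j\delta\in\hat\Delta_W$, $\xi_a=t^j\otimes E_\alpha$), $V^\lambda_{F_\nu}=F_\nu\otimes V^\lambda_{\mathbb Z}$. On $V^\lambda_{F_\nu}$: $\chi_a(s)=\sum_{n\ge0}s^n\xi_a^n/n!$, $w_a(s)=\chi_a(s)\chi_{-a}(-s^{-1})\chi_a(s)$, $h_a(s)=w_a(s)w_a(1)^{-1}$, $\chi_\alpha(\sigma)=\prod_{i\ge i_0}\chi_{\alpha+i\delta}(s_i)$ for $\sigma=\sum_{i\ge i_0} s_iX^i$; $\hat H_\nu=\langle h_{\alpha_i}(s):1\le i\le l+1,s\in F_\nu^\times\rangle$, $\hat K_\nu=\langle\chi_\alpha(\sigma):\alpha\in\Delta,\sigma\in\mathcal O_\nu((X))\rangle$. $\hat H_{\mathbb A}$ is the restricted direct product of the $\hat H_\nu$ with respect to $\hat H_\nu\cap\hat K_\nu$; the map $\vartheta:(\mathbb A^\times)^{l+1}\to\hat H_{\mathbb A}$, $(s_i)\mapsto\prod_ih_{\alpha_i}(s_i)$,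 is a surjective homomorphism and $\hat H_{\mathbb A}$ carries the quotient topology. $\eta^{mD}=\prod_\nu\eta_\nu^{m_\nu D}$, where $\eta_\nu^{m_\nu D}$ acts on the weight space of weight $\mu$ in $V^\lambda_{F_\nu}$ as $\pi_\nu^{m_\nu\mu(D)}$. For $\mu\in(\hat{\mathfrak h}^e)^*$ and $h=\prod_ih_{\alpha_i}(s_i)$: $(h\eta^{mD})^\mu=\prod_i|s_i|^{\mu(h_{\alpha_i})}\prod_\nu|\pi_\nu|_\nu^{m_\nu\mu(D)}$ (well defined). *)

(* Defs.v *)
From HB Require Import structures.
From mathcomp Require Import all_boot all_order all_algebra all_field.
From mathcomp Require Import finmap.
From mathcomp Require Import all_classical all_reals all_analysis.
From mathcomp Require summability.

Set Implicit Arguments.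
Unset Strict Implicit.
Unset Printing Implicit Defensive.

Import Order.TTheory GRing.Theory Num.Theory.
Import numFieldNormedType.Exports.

Local Open Scope classical_set_scope.
Local Open Scope ring_scope.

Definition inverse (T : choiceType) (f : T -> T) : T -> T :=
  xget (id : T -> T) [set f' | cancel f f' /\ cancel f' f].

Inductive generated (T : Type) (S : set (T -> T)) : (T -> T) -> Prop :=
| generated_mem f : S f -> generated S f
| generated_id : generated S id
| generated_comp f f' : generated S f -> generated S f' ->
    generated S (f \o f')
| generated_inv f f' : generated S f -> cancel f f' -> cancel f' f ->
    generated S f'.

Section LieAlgebra.
Variables (R : realType) (g : vectType R) (br : g -> g -> g).

Definition is_lie_bracket : Prop :=
  [/\ forall x, linear (br x),
      forall y, linear (br^~ y),
      forall x, br x x = 0 &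
      forall x y z, br x (br y z) + br y (br z x) + br z (br x y) = 0].

Definition is_simple_lie : Prop :=
  (exists x y, br x y != 0) /\
  forall U : {vspace g}, (forall x u, u \in U -> br x u \in U) ->
    U = 0%VS \/ U = fullv.

(** [br x_1 (br x_2 (.. (br x_n y)))] spans the lower central series. *)
Definition is_cartan_subalgebra (h : {vspace g}) : Prop :=
  [/\ {in h &, forall x y, br x y \in h},
      exists n, forall (s : seq g) y, size s = n -> all (mem h) s -> y \in h ->
        foldr br y s = 0 &
      forall x, {in h, forall y, br x y \in h} -> x \in h].

Definition killing (x y : g) : R :=
  \sum_i coord (vbasis (fullv : {vspace g})) i
    (br x (br y (vbasis (fullv : {vspace g}))`_i)).

Definition is_root (h : {vspace g}) (a : 'Hom(subvs_of h, R^o)) : Prop :=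
  a != 0 /\
  exists2 x : g, x != 0 & forall H : subvs_of h, br (vsval H) x = a H *: x.

End LieAlgebra.

Record chevalleyAlgebra (R : realType) := ChevalleyAlgebra {
  lieT :> vectType R;
  lbr : lieT -> lieT -> lieT;
  cartan : {vspace lieT};
  rank : nat;
  Delta : seq 'Hom(subvs_of cartan, R^o);
  simpleroot : 'I_rank -> 'Hom(subvs_of cartan, R^o);
  highroot : 'Hom(subvs_of cartan, R^o);
  coroot : 'Hom(subvs_of cartan, R^o) -> subvs_of cartan;
  rootvec : 'Hom(subvs_of cartan, R^o) -> lieT;
  lbrP : is_lie_bracket lbr;
  lie_simple : is_simple_lie lbr;
  cartanP : is_cartan_subalgebra lbr cartan;
  DeltaP : forall a, a \in Delta <-> is_root lbr a;
  Delta_uniq : uniq Delta;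
  simpleroot_Delta : forall i, simpleroot i \in Delta;
  simpleroot_basis : basis_of fullv [seq simpleroot i | i <- enum 'I_rank];
  Delta_sign : forall a, a \in Delta -> exists n : 'I_rank -> nat,
    a = \sum_i simpleroot i *+ n i \/ a = - \sum_i simpleroot i *+ n i;
  highroot_Delta : highroot \in Delta;
  highrootP : forall b, b \in Delta -> exists n : 'I_rank -> nat,
    highroot - b = \sum_i simpleroot i *+ n i;
  coroot2 : forall a, a \in Delta -> a (coroot a) = 2;
  rootvec_opp : forall a, a \in Delta ->
    lbr (rootvec a) (rootvec (- a)) = vsval (coroot a);
  rootvec_weight : forall a (H : subvs_of cartan), a \in Delta ->
    lbr (vsval H) (rootvec a) = a H *: rootvec a;
  rootvec_add : forall a b, a \in Delta -> b \in Delta -> a + b \in Delta ->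
    exists r : nat, [/\ b - a *+ r \in Delta,
      (forall n, (r < n)%N -> b - a *+ n \notin Delta) &
      lbr (rootvec a) (rootvec b) = r.+1%:R *: rootvec (a + b) \/
      lbr (rootvec a) (rootvec b) = - (r.+1%:R *: rootvec (a + b))];
  cartan_basis : basis_of cartan
    [seq vsval (coroot (simpleroot i)) | i <- enum 'I_rank];
  chevalley_basis : basis_of fullv
    ([seq vsval (coroot (simpleroot i)) | i <- enum 'I_rank] ++
     [seq rootvec a | a <- Delta])
}.

Section Finite.
Variables (R : realType) (L : chevalleyAlgebra R).

Definition hfin := subvs_of (cartan L).
Definition dual_hfin := 'Hom(subvs_of (cartan L), R^o).

Definition posroot (a : dual_hfin) : Prop :=
  a \in Delta L /\
  exists n : 'I_(rank L) -> nat, a = \sum_i simpleroot i *+ n i.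

Definition negroot (a : dual_hfin) : Prop := posroot (- a).

(** The multiple of the Killing form such that the coroot of the highest root
    has square length [2]. *)
Definition form (x y : L) : R :=
  2 * killing (@lbr _ L) x y
  / killing (@lbr _ L) (vsval (coroot (highroot L)))
                       (vsval (coroot (highroot L))).

(** The form on the dual of the Cartan subalgebra, by transport of [form]. *)
Definition form_repr (a : dual_hfin) : subvs_of (cartan L) :=
  xget 0 [set u : subvs_of (cartan L) | forall H : subvs_of (cartan L),
    form (vsval u) (vsval H) = a H].

Definition dual_form (a b : dual_hfin) : R :=
  form (vsval (form_repr a)) (vsval (form_repr b)).

End Finite.

(** [R[t, t^-1] (x) g] as the space of finitely supported [x : int -> g],
    where [x] stands for [\sum_n t^n (x) x n]. *)
Section Loop.
Variables (R : realType) (g : lmodType R).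

Definition finsupp_pred : {pred int -> g} :=
  fun f => `[< finite_set [set n | f n != 0] >].

Record loop := Loop { loop_fun :> int -> g; loopP : loop_fun \in finsupp_pred }.

Lemma finsupp_closed : submod_closed finsupp_pred.
Proof.
split=> [|a f f' /asboolP ff /asboolP ff'].
  apply/asboolP; suff -> : [set n | (0 : int -> g) n != 0] = set0 by [].
  by apply/seteqP; split=> n //=; rewrite eqxx.
apply/asboolP; apply: (@sub_finite_set _ _
  ([set n | f n != 0] `|` [set n | f' n != 0])); last by rewrite finite_setU.
move=> n /= fn; have [fn0|] := eqVneq (f n) 0; last by left.
by right; apply: contraNneq fn => f'n0; rewrite !fctE fn0 f'n0 scaler0 addr0.
Qed.

HB.instance Definition _ :=
  GRing.isSubmodClosed.Build R (int -> g) finsupp_pred finsupp_closed.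
HB.instance Definition _ := [isSub for loop_fun].
HB.instance Definition _ := [Choice of loop by <:].
HB.instance Definition _ := [SubChoice_isSubLmodule of loop by <:].

Lemma monomial_subproof (n : int) (x : g) :
  (fun m => if m == n then x else 0) \in finsupp_pred.
Proof.
apply/asboolP; apply: (@sub_finite_set _ _ [set n]); last exact: finite_set1.
by move=> m /=; have [->|_] := eqVneq m n; rewrite ?eqxx.
Qed.

Definition monomial (n : int) (x : g) : loop := Loop (monomial_subproof n x).

End Loop.

Section Affine.
Variables (R : realType) (L : chevalleyAlgebra R).

(** [(x, a, b)] stands for [x + a c + b D]. *)
Definition affine : lmodType R := (loop L * R^o * R^o)%type.

Definition aff_br_fun (x y : affine) (n : int) : L :=
  \sum_(i \in [set: int]) lbr (x.1.1 i) (y.1.1 (n - i))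
  + (x.2 * n%:~R) *: y.1.1 n - (y.2 * n%:~R) *: x.1.1 n.

Lemma aff_br_subproof (x y : affine) : aff_br_fun x y \in @finsupp_pred R L.
Proof.
have [linr linl _ _] := lbrP L.
have br0 v : lbr (0 : L) v = 0.
  by have := linl v (-1) 0 0; rewrite scaler0 addr0 scaleN1r addNr.
have b0r v : lbr v (0 : L) = 0.
  by have := linr v (-1) 0 0; rewrite scaler0 addr0 scaleN1r addNr.
have /asboolP fx := loopP x.1.1; have /asboolP fy := loopP y.1.1.
set sx := [set n | _] in fx; set sy := [set n | _] in fy.
apply/asboolP; apply: (@sub_finite_set _ _
  ([set i + j | i in sx & j in sy] `|` (sx `|` sy))); last first.
  by rewrite !finite_setU; split=> //; exact: finite_image2.
move=> n /=; apply: contra_neqP => /not_orP[nxy /not_orP[]].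
move=> /negP; rewrite negbK => /eqP xn /negP; rewrite negbK => /eqP yn.
rewrite /aff_br_fun xn yn !scaler0 addr0 subr0 fsbig1 // => i _.
have [->|xi] := eqVneq (x.1.1 i) 0; first by rewrite br0.
have [->|yi] := eqVneq (y.1.1 (n - i)) 0; first by rewrite b0r.
by exfalso; apply: nxy; exists i => //; exists (n - i) => //; rewrite addrC subrK.
Qed.

Definition aff_br (x y : affine) : affine :=
  (Loop (aff_br_subproof x y),
   \sum_(i \in [set: int]) i%:~R * form (x.1.1 i) (y.1.1 (- i)), 0).

End Affine.

Section AffineWeyl.
Variables (R : realType) (L : chevalleyAlgebra R).

Definition hhat : vectType R := (subvs_of (cartan L) * R^o)%type.
Definition hext : vectType R := (hhat * R^o)%type.
Definition dual_hhat := 'Hom(hhat, R^o).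
Definition dual_hext := 'Hom(hext, R^o).

Definition hext_D : hext := (0, 0, 1).

Definition ext_hhat (mu : dual_hhat) : dual_hext :=
  linfun (fun x : hext => mu x.1).
Definition ext_root (a : dual_hfin L) : dual_hext :=
  linfun (fun x : hext => a x.1.1).
Definition delta : dual_hext := linfun (fun x : hext => x.2).

Definition realroot (a : dual_hfin L) (n : int) : dual_hext :=
  ext_root a + delta *~ n.

Definition DeltaW_pos : set dual_hext := [set b | exists a n,
  (posroot a /\ 0 <= n \/ negroot a /\ 0 < n) /\ b = realroot a n].
Definition DeltaW_neg : set dual_hext := [set b | DeltaW_pos (- b)].

(** The index [ord_max] stands for [l + 1]. The pair [(a, n)] encodes the real
    root [a + n delta]. *)
Definition aff_simple_idx (i : 'I_(rank L).+1) : dual_hfin L * int :=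
  if unlift ord_max i is Some j then (simpleroot j, 0) else (- highroot L, 1).
Definition aff_simpleroot (i : 'I_(rank L).+1) : dual_hext :=
  realroot (aff_simple_idx i).1 (aff_simple_idx i).2.
Definition aff_simplecoroot (i : 'I_(rank L).+1) : hext :=
  if unlift ord_max i is Some j then (coroot (simpleroot j), 0, 0)
  else (- coroot (highroot L),
        2 / dual_form (highroot L) (highroot L) : R, 0).
Definition hhat_simplecoroot (i : 'I_(rank L).+1) : hhat :=
  (aff_simplecoroot i).1.

Definition aff_reflection (i : 'I_(rank L).+1) : 'End(hext) :=
  linfun (fun x : hext => x - aff_simpleroot i x *: aff_simplecoroot i).
Definition weyl_word (s : seq 'I_(rank L).+1) : 'End(hext) :=
  foldr (fun i w => (aff_reflection i \o w)%VF) \1%VF s.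
(** Words in the generators suffice, the reflections being involutions. *)
Definition affW : set 'End(hext) := range weyl_word.
Definition weyl_length (w : 'End(hext)) : nat :=
  get [set n : nat | (exists2 s, size s = n & weyl_word s = w) /\
                     forall s, weyl_word s = w -> (n <= size s)%N].
Definition weyl_act (w : 'End(hext)) (mu : dual_hext) : dual_hext :=
  (mu \o w^-1)%VF.

Definition aff_coroot (b : dual_hext) : hext :=
  xget 0 [set x : hext | exists w i, [/\ affW w,
    b = weyl_act w (aff_simpleroot i) & x = w (aff_simplecoroot i)]].

End AffineWeyl.
Arguments DeltaW_pos {R} L _.
Arguments DeltaW_neg {R} L _.
Arguments affW {R} L _.
Arguments aff_simplecoroot {R} L i.
Arguments hhat_simplecoroot {R} L i.

Section Module.
Variables (R : realType) (L : chevalleyAlgebra R).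

Definition aff_cartan (H : hext L) : affine L :=
  (monomial 0 (vsval H.1.1), H.1.2, H.2).
Definition xi (a : dual_hfin L) (n : int) : affine L :=
  (monomial n (rootvec a), 0, 0).

Record hwModule (lam : dual_hext L) := HwModule {
  hwV :> lmodType R;
  hwact : affine L -> hwV -> hwV;
  hwact_linr : forall x, linear (hwact x);
  hwact_linl : forall v, linear (hwact^~ v);
  hwact_br : forall x y v,
    hwact (aff_br x y) v = hwact x (hwact y v) - hwact y (hwact x v);
  hwact_irr : forall U : set hwV, U 0 ->
    (forall (a : R) u v, U u -> U v -> U (a *: u + v)) ->
    (forall x v, U v -> U (hwact x v)) ->
    U = [set 0] \/ U = setT;
  hwvec : hwV;
  hwvec_neq0 : hwvec != 0;
  hwvec_weight : forall H, hwact (aff_cartan H) hwvec = lam H *: hwvec;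
  hwvec_simple : forall a, posroot a -> hwact (xi a 0) hwvec = 0;
  hwvec_pos : forall (n : int) (x : L), 0 < n ->
    hwact (monomial n x, 0, 0) hwvec = 0
}.

Variables (lam : dual_hext L) (V : hwModule lam).

Definition divpow (a : dual_hfin L) (j : int) (n : nat) (v : V) : V :=
  n`!%:R^-1 *: iter n (hwact (xi a j)) v.

Definition weight_vector (mu : dual_hext L) (v : V) : Prop :=
  forall H, hwact (aff_cartan H) v = mu H *: v.

(** [M] is the Z-span of an R-basis of [V]. *)
Definition is_Zform (M : set V) : Prop :=
  exists (I : choiceType) (b : I -> V), [/\
    forall v, exists2 c : I -> R, finite_set [set i | c i != 0] &
      v = \sum_(i \in [set: I]) c i *: b i,
    forall c : I -> R, finite_set [set i | c i != 0] ->
      \sum_(i \in [set: I]) c i *: b i = 0 -> forall i, c i = 0 &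
    forall v, M v <-> exists2 c : I -> int, finite_set [set i | c i != 0] &
      v = \sum_(i \in [set: I]) (c i)%:~R *: b i].

Record chevalleyForm := ChevalleyForm {
  cform :> set V;
  cform_Z : is_Zform cform;
  cform_divpow : forall a j n v, a \in Delta L -> cform v ->
    cform (divpow a j n v);
  (* [cform] is the direct sum of its intersections with the weight spaces. *)
  cform_graded : forall v, cform v -> exists s : seq V,
    (forall u, u \in s -> cform u /\ exists mu, weight_vector mu u) /\
    v = \sum_(u <- s) u
}.

End Module.

(** Extension of scalars along [Z -> K], by its universal property. *)
Record base_change (V : zmodType) (M : set V) (K : fieldType) := BaseChange {
  bc_mod :> lmodType K;
  bc_map : V -> bc_mod;
  bc_mapD : forall u v, M u -> M v -> bc_map (u + v) = bc_map u + bc_map v;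
  bc_univ : forall (U : lmodType K) (f : V -> U),
    (forall u v, M u -> M v -> f (u + v) = f u + f v) ->
    exists! T : bc_mod -> U,
      linear T /\ forall u, M u -> T (bc_map u) = f u
}.

Section Valuation.
Variable K : fieldType.
Implicit Types (v : K -> int).

(** Normalized discrete valuations; the value at [0] is a mere convention, and
    [val_ge] handles [0] as an element of infinite valuation. *)
Record is_valuation v : Prop := IsValuation {
  val0 : v 0 = 0;
  valM : forall x y, x != 0 -> y != 0 -> v (x * y) = v x + v y;
  valD : forall x y, x != 0 -> y != 0 -> x + y != 0 ->
    Order.min (v x) (v y) <= v (x + y);
  val_normalized : exists2 x, x != 0 & v x = 1
}.

Definition val_ge v (n : int) (x : K) : bool := (x == 0) || (n <= v x).

(** The [r i] represent the residue classes. *)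
Definition residue_card v : nat :=
  get [set n : nat | exists r : 'I_n -> K, (forall i, val_ge v 0 (r i)) /\
    forall x, val_ge v 0 x -> exists! i, val_ge v 1 (x - r i)].

Definition val_open v (U : set K) : Prop :=
  forall x, U x -> exists n, forall y, val_ge v n (y - x) -> U y.

Definition val_complete v : Prop :=
  forall u : nat -> K,
    (forall n, exists N, forall i j, (N <= i)%N -> (N <= j)%N ->
       val_ge v n (u i - u j)) ->
    exists l, forall n, exists N, forall i, (N <= i)%N -> val_ge v n (u i - l).

End Valuation.

Record place (F : fieldType) := Place {
  place_val :> F -> int;
  place_valP : is_valuation place_val
}.
HB.instance Definition _ (F : fieldType) := gen_eqMixin (place F).
HB.instance Definition _ (F : fieldType) := gen_choiceMixin (place F).

Record completion (F : fieldType) (nu : place F) := Completion {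
  cplT :> fieldType;
  cpl_emb : {rmorphism F -> cplT};
  cpl_val : cplT -> int;
  cpl_valP : is_valuation cpl_val;
  cpl_val_emb : forall x, cpl_val (cpl_emb x) = nu x;
  cpl_dense : forall y n, exists x, val_ge cpl_val n (y - cpl_emb x);
  cpl_complete : val_complete cpl_val
}.

Section FunctionField.
Variables (k : finFieldType) (F : fieldExtType {fraction {poly k}}).

Definition const_emb (c : k) : F := (tofrac c%:P)%:A.

Definition is_constant_field : Prop :=
  forall x : F, (exists2 p : {poly k}, p != 0 & root (map_poly const_emb p) x) ->
    exists c, x = const_emb c.

(** The dimension over [k] of the image of [S] in [F / Z]. *)
Definition is_kdim (S Z : set F) (n : nat) : Prop :=
  exists b : 'I_n -> F, (forall i, S (b i)) /\
    forall x, S x -> exists! c : {ffun 'I_n -> k},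
      Z (x - \sum_i const_emb (c i) * b i).

Definition kdim (S Z : set F) : nat := get (is_kdim S Z).

(** The place and its completion have the same residue field. *)
Definition place_deg (nu : place F) : nat :=
  kdim [set x | val_ge nu 0 x] [set x | val_ge nu 1 x].

Definition div_deg (D : place F -> int) : int :=
  \sum_(nu \in [set: place F]) D nu * (place_deg nu)%:Z.

Definition riemann_roch_space (D : place F -> int) : set F :=
  [set x | forall nu : place F, val_ge nu (- D nu) x].

(** Riemann's theorem: the genus is the maximum of [deg D - l(D) + 1]. *)
Definition is_genus (g : nat) : Prop :=
  let defect D := div_deg D - (kdim (riemann_roch_space D) [set 0])%:Z + 1 in
  (forall D, finite_set [set nu | D nu != 0] -> defect D <= g%:Z) /\
  exists2 D, finite_set [set nu | D nu != 0] & defect D = g%:Z.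

Definition zeta (R : realType) (s : R) : R :=
  lim ((fun A : {fset place F} =>
          \prod_(nu <- A) (1 - (residue_card nu)%:R `^ (- s))^-1 : R)
       @ summability.totally).

End FunctionField.

Section Ideles.
Variables (F : fieldType) (Fc : forall nu : place F, completion nu).

Record idele := Idele {
  idele_fun :> forall nu, Fc nu;
  idele_neq0 : forall nu, idele_fun nu != 0;
  idele_fin : finite_set [set nu | cpl_val (idele_fun nu) != 0]
}.
HB.instance Definition _ := gen_eqMixin idele.
HB.instance Definition _ := gen_choiceMixin idele.

Definition int_units (nu : place F) : set (Fc nu) :=
  [set x | x != 0 /\ cpl_val x = 0].

(** An open subset of the units of [Fc nu] is the trace of an open subset of
    [Fc nu], so the boxes below generate the restricted product topology. *)
Definition idele_box : set (set idele) :=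
  [set B | exists U : forall nu, set (Fc nu),
    [/\ forall nu, val_open (@cpl_val _ _ (Fc nu)) (U nu),
        finite_set [set nu | U nu <> int_units (nu := nu)] &
        B = [set s : idele | forall nu, U nu (s nu)]]].
HB.instance Definition _ := isSubBaseTopological.Build idele idele_box id.

Definition idele_norm (R : realType) (s : idele) : R :=
  \big[*%R/1]_(nu \in [set: place F])
    (((residue_card nu)%:R : R) ^ (- cpl_val (s nu))).

End Ideles.

Section Torus.
Variables (R : realType) (L : chevalleyAlgebra R) (lam : dual_hext L).
Variables (V : hwModule lam) (M : chevalleyForm V).
Variables (F : fieldType) (Fc : forall nu : place F, completion nu).
Variable W : forall nu : place F, base_change M (Fc nu).

Section Local.
Variable nu : place F.

(** The [Fc nu]-linear extension of an operator that stabilizes [M]. *)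
Definition bc_op (T : V -> V) : W nu -> W nu :=
  xget (id : W nu -> W nu) [set T' | linear T' /\
    forall u, cform M u -> T' (bc_map (W nu) u) = bc_map (W nu) (T u)].

Definition chi_op (a : dual_hfin L) (j : int) (s : Fc nu) (v : W nu) : W nu :=
  \sum_(n \in [set: nat]) s ^+ n *: bc_op (@divpow _ _ _ V a j n) v.

Definition w_op (a : dual_hfin L) (j : int) (s : Fc nu) : W nu -> W nu :=
  chi_op a j s \o chi_op (- a) (- j) (- s^-1) \o chi_op a j s.

Definition h_op (a : dual_hfin L) (j : int) (s : Fc nu) : W nu -> W nu :=
  w_op a j s \o inverse (w_op a j 1).

(** [T] is [chi_a(sigma)] for [sigma = \sum_(n >= 0) s n * X^(i0 + n)]. *)
Definition is_chi_loop (a : dual_hfin L) (i0 : int) (s : nat -> Fc nu)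
    (T : W nu -> W nu) : Prop :=
  forall v, exists N, forall n, (N <= n)%N ->
    T v = foldr (fun i f => chi_op a (i0 + i%:Z) (s i) \o f) id (iota 0 n) v.

Definition h_simple (i : 'I_(rank L).+1) : Fc nu -> W nu -> W nu :=
  h_op (aff_simple_idx i).1 (aff_simple_idx i).2.

Definition Hgroup : (W nu -> W nu) -> Prop :=
  generated [set f | exists i s, s != 0 /\ f = h_simple i s].

Definition Kgroup : (W nu -> W nu) -> Prop :=
  generated [set f | exists a i0 (s : nat -> Fc nu), [/\ a \in Delta L,
    forall i, val_ge (@cpl_val _ _ (Fc nu)) 0 (s i) & is_chi_loop a i0 s f]].

End Local.

Record adelic_torus := AdelicTorus {
  torus_fun :> forall nu, W nu -> W nu;
  torus_H : forall nu, Hgroup (@torus_fun nu);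
  torus_K : finite_set [set nu | ~ Kgroup (@torus_fun nu)]
}.
HB.instance Definition _ := gen_eqMixin adelic_torus.
HB.instance Definition _ := gen_choiceMixin adelic_torus.

Definition theta_fun (s : 'I_(rank L).+1 -> idele Fc) (nu : place F) :
    W nu -> W nu :=
  foldr (fun i f => h_simple i (s i nu) \o f) id (enum 'I_(rank L).+1).

Definition is_theta (s : 'I_(rank L).+1 -> idele Fc) (h : adelic_torus) : Prop :=
  torus_fun h = theta_fun s.

(** Quotient topology: the sets whose preimage under theta is open, where
    the powers of the idele group carry the product topology. *)
Definition torus_open : set (set adelic_torus) :=
  [set U | open [set s : {ptws 'I_(rank L).+1 -> idele Fc} |
                  exists2 h, U h & is_theta s h]].
HB.instance Definition _ := isSubBaseTopological.Build adelic_torus torus_open id.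

(** [(h eta^{mD})^mu], computed on an arbitrary preimage of [h] under theta. *)
Definition torus_char (m : place F -> int) (mu : dual_hext L)
    (h : adelic_torus) : R :=
  xget 0 [set x : R | exists2 s, is_theta s h &
    x = \prod_i (idele_norm R (s i) `^ mu (aff_simplecoroot L i))
        * \big[*%R/1]_(nu \in [set: place F])
            (((residue_card nu)%:R^-1 : R) `^ ((m nu)%:~R * mu (hext_D L)))].

End Torus.

Definition c_coef (R : realType) (L : chevalleyAlgebra R) (k : finFieldType)
    (F : fieldExtType {fraction {poly k}}) (g : nat) (chi rho : dual_hhat L)
    (w : 'End(hext L)) : R :=
  (#|k|%:R : R) ^ ((weyl_length w)%:Z * (1 - g%:Z))
  * \big[*%R/1]_(a \in DeltaW_pos L `&` [set a | DeltaW_neg L (weyl_act w a)])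
      (zeta F (- (chi + rho) (aff_coroot a).1)
       / zeta F (- (chi + rho) (aff_coroot a).1 + 1)).

(* Main.v *)
Require Import Defs.
From HB Require Import structures.
From mathcomp Require Import all_boot all_order all_algebra all_field.
From mathcomp Require Import finmap.
From mathcomp Require Import all_classical all_reals all_analysis.
From mathcomp Require summability.
From mathcomp Require Import ring lra zify.

Set Implicit Arguments.
Unset Strict Implicit.
Unset Printing Implicit Defensive.

Import Order.TTheory GRing.Theory Num.Theory.
Import numFieldNormedType.Exports.

Local Open Scope classical_set_scope.
Local Open Scope ring_scope.

(** Let [psi = chi + rho]. Its value on [c], a positive combination of the simple coroots, is
    negative, and [w^-1 D = H - |H|^2 / 2 c + D] with [H] in the finite Cartan subalgebra.
    Hence [psi (w^-1 D)] grows quadratically in [H], whereas the length of [w], the number of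
    inversions of [w] and the values [psi (w^-1 h_i)] grow at most linearly. The quotient
    [zeta s / zeta (s + 1)] stays bounded along the finitely many arithmetic progressions
    formed by the values at coroots; so [c(chi, w)] is at most exponential in [H] while the
    factor at [D] decays like [exp (- k |H|^2)] because [sum m_nu log q_nu > 0]. This beats
    any power [r^l(w)], and there are at most [(l + 1)^n] elements of length [n].

    Uniformity on compact sets: the valuations of the coordinates of [h] are determined by
    [h], as one sees on weight vectors of [V], so the valuation classes are an open partition
    of the torus and a compact set meets only finitely many of them. *)

(** Several objects of the statement are selected by choice: the operators of the base change, the
    inverse in [h_op], the preimage in [torus_char], the affine coroots. Each is controlled through
    its specification or its default value, and for the torus this means computing on vectors.
    Dominance of [lam] makes the simple root vectors locally nilpotent on [V]; the Tits lift exp(e)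
    exp(-f) exp(e) then yields both the integrality of the weights and the action of [h_op] on a
    weight vector by a power of its parameter. The same sl2 lemmas, applied to the adjoint
    representation, supply the root system properties that the record of a Chevalley basis does not
    list. Because [lam] does not vanish on all simple coroots, the center acts by a positive scalar,
    whence the faithfulness needed to read off valuations. As integers may vanish in a completion,
    weights are separated over the reals on the integral form, and only the result is transported.
    In the estimates a factor r^l(w) with r = 1 / (2 (l + 1)) is split off, which turns the count of
    words into a geometric series of ratio 1/2. *)

Lemma fsbig_nat_lt (V : nmodType) (F : nat -> V) N :
  (forall n, (N <= n)%N -> F n = 0) ->
  \sum_(n \in [set: nat]) F n = \sum_(n < N) F n.
Proof.
move=> F0; rewrite fsbig_ord; apply/esym/fsbig_widen => //= n [_ /=].
by move/negP; rewrite -leqNgt => /F0.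
Qed.

(** Cauchy product: the hypothesis kills all terms from the antidiagonal of index N on, so the
    square and the triangle carry the same sum. *)
Lemma triangular_sum (V : nmodType) (F : nat -> nat -> V) N :
  (forall i j, (N <= i + j)%N -> F i j = 0) ->
  \sum_(i < N) \sum_(j < N) F i j = \sum_(k < N) \sum_(i < k.+1) F i (k - i)%N.
Proof.
move=> F0.
transitivity (\sum_(i < N) \sum_(k < N | (i <= k)%N) F i (k - i)%N).
  apply: eq_bigr => i _.
  rewrite -(big_mkord (fun k => (i <= k)%N) (fun k => F i (k - i)%N)).
  rewrite -(big_mkord xpredT (F i)).
  rewrite (@big_cat_nat _ _ _ (N - i)) ?leq_subr//=.
  rewrite [X in _ + X]big_nat_cond [X in _ + X]big1 ?addr0; last first.
    by move=> j; rewrite andbT => /andP[lej _]; apply: F0; rewrite -leq_subLR.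
  rewrite [RHS](@big_cat_nat _ _ _ i) ?(ltnW (ltn_ord i))//=.
  rewrite [X in X + _]big_nat_cond [X in X + _]big1 ?add0r; last first.
    by move=> j /andP[/andP[_ ltj] lej]; rewrite ltnNge lej in ltj.
  transitivity (\sum_(0 + i <= k < N | (i <= k)%N) F i (k - i)%N); last by rewrite add0n.
  rewrite big_addn big_mkcond [RHS]big_mkcond /=.
  by apply: eq_bigr => j _; rewrite leq_addl addnK.
rewrite (exchange_big_dep xpredT) //=; apply: eq_bigr => k _.
rewrite (big_ord_widen_cond N xpredT (fun i => F i (k - i)%N)) ?ltn_ord//.
Qed.

(** * Locally nilpotent operators and sl2-triples *)

Section EigenSeparation.
Variables (K : fieldType) (V : lmodType K) (h : {linear V -> V}).

(** The product of the [h - x], [x] in [l], isolates one eigencomponent of a sum. *)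
Definition eigen_op (l : seq K) v := foldr (fun x v => h v - x *: v) v l.

Lemma eigen_opE l v x : h v = x *: v -> eigen_op l v = (\prod_(y <- l) (x - y)) *: v.
Proof.
move=> hv; elim: l => [|y l IH] /=; first by rewrite big_nil scale1r.
by rewrite big_cons IH linearZ /= hv !scalerA -scalerBl [X in X - _]mulrC mulrBl.
Qed.

Lemma eigen_op0 l v x : h v = x *: v -> x \in l -> eigen_op l v = 0.
Proof.
move=> hv xl; rewrite (eigen_opE _ hv).
suff -> : \prod_(y <- l) (x - y) = 0 by rewrite scale0r.
by apply/eqP; rewrite prodf_seq_eq0; apply/hasP; exists x; rewrite //= subrr.
Qed.

Lemma eigen_op_neq0 l v x : h v = x *: v -> x \notin l -> eigen_op l v = 0 -> v = 0.
Proof.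
move=> hv xl; rewrite (eigen_opE _ hv) => /eqP; rewrite scaler_eq0 => /orP[|/eqP//].
rewrite prodf_seq_eq0 => /hasP[y yl] /=; rewrite subr_eq0 => /eqP xy.
by rewrite xy yl in xl.
Qed.

Lemma eigen_op_sum l (J : finType) (P : pred J) (f : J -> V) :
  eigen_op l (\sum_(j | P j) f j) = \sum_(j | P j) eigen_op l (f j).
Proof.
elim: l => //= r' l ->; rewrite linear_sum scaler_sumr -sumrB.
by apply: eq_bigr.
Qed.

Section Sum.
Variables (I : finType) (T : I -> V) (c : I -> K) (c0 : K).
Hypothesis hT : forall i, h (T i) = c i *: T i.
Hypothesis hS : h (\sum_i T i) = c0 *: (\sum_i T i).

(** The whole sum is killed by the factor h - c0, and every part of eigenvalue other than [r] by its
    own factor. What remains is the part of eigenvalue [r], multiplied by a nonzero scalar. *)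
Lemma eigen_sum_part r : r != c0 -> \sum_(i | c i == r) T i = 0.
Proof.
move=> rc0.
pose l := c0 :: [seq x <- [seq c i | i <- enum I] | x != r].
have l0 : eigen_op l (\sum_i T i) = 0 by rewrite (eigen_op0 hS)// mem_head.
apply: (@eigen_op_neq0 l _ r).
- rewrite linear_sum scaler_sumr; apply: eq_bigr => i /eqP <-; exact: hT.
- by rewrite /l inE (negPf rc0) mem_filter eqxx.
transitivity (eigen_op l (\sum_i T i)); last by [].
rewrite !(eigen_op_sum l _ T) [RHS](bigID (fun i => c i == r)) [X in _ = _ + X]big1 ?addr0// => i cir.
apply: (eigen_op0 (hT i)); rewrite /= in cir.
by rewrite /l inE mem_filter cir map_f ?mem_enum ?orbT.
Qed.

(** Otherwise the product of all h - c i kills the sum termwise, yet multiplies it by a nonzero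
    scalar. *)
Lemma eigen_sum_neq0 : \sum_i T i != 0 -> exists i, c i = c0.
Proof.
apply: contra_neqP => /forallNP nc.
apply: (eigen_op_neq0 (l := [seq c i | i <- enum I]) hS).
  by apply/negP => /mapP[i _ ci]; apply: (nc i).
by rewrite eigen_op_sum big1// => i _; rewrite (eigen_op0 (hT i))// map_f ?mem_enum.
Qed.
End Sum.
End EigenSeparation.

Section Exponential.
Variables (K : numFieldType) (V : lmodType K).
Implicit Types (e : V -> V) (v : V).

Definition dpow e n v : V := n`!%:R^-1 *: iter n e v.

Definition locnil e := forall v, exists n, iter n e v = 0.

Definition expo e v : V := \sum_(n \in [set: nat]) dpow e n v.

Lemma dpow0 e v : dpow e 0 v = v.
Proof. by rewrite /dpow fact0 invr1 scale1r. Qed.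

Lemma dpow1 e v : dpow e 1 v = e v.
Proof. by rewrite /dpow factS fact0 muln1 invr1 scale1r. Qed.

Section Linear.
Variable e : {linear V -> V}.

Lemma iter_linear n : linear (iter n e).
Proof. by elim: n => [//|n IH] a u v /=; rewrite IH linearP. Qed.

HB.instance Definition _ n :=
  GRing.isLinear.Build K V V _ (iter n e) (iter_linear n).

Lemma dpow_linear n : linear (dpow e n).
Proof.
by move=> a u v; rewrite /dpow iter_linear scalerDr !scalerA mulrC.
Qed.

HB.instance Definition _ n :=
  GRing.isLinear.Build K V V _ (dpow e n) (dpow_linear n).

Lemma iter_nil_ge n m v : iter n e v = 0 -> (n <= m)%N -> iter m e v = 0.
Proof.
move=> en nm; rewrite -(subnK nm) iterD en.
by elim: (m - n)%N => //= k ->; rewrite linear0.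
Qed.

Lemma dpow_nil n m v : iter n e v = 0 -> (n <= m)%N -> dpow e m v = 0.
Proof. by move=> en nm; rewrite /dpow (iter_nil_ge en nm) scaler0. Qed.

Lemma dpowD m n v : dpow e m (dpow e n v) = 'C(m + n, m)%:R *: dpow e (m + n) v.
Proof.
rewrite /dpow iterD.
have -> : iter m e (n`!%:R^-1 *: iter n e v) = n`!%:R^-1 *: iter m e (iter n e v).
  by elim: m => //= m ->; rewrite linearZ.
rewrite !scalerA; congr (_ *: _).
have := bin_fact (leq_addr n m); rewrite addKn => /(congr1 (fun x => x%:R : K)).
rewrite !natrM => <-.
have fn0 k : k`!%:R != 0 :> K by rewrite pnatr_eq0 -lt0n fact_gt0.
have bn0 : 'C(m + n, m)%:R != 0 :> K by rewrite pnatr_eq0 -lt0n bin_gt0 leq_addr.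
by rewrite !invfM mulVKf// mulrC.
Qed.

Lemma expoE N v : iter N e v = 0 -> expo e v = \sum_(n < N) dpow e n v.
Proof. by move=> eN; apply: fsbig_nat_lt => n; apply: dpow_nil. Qed.

(** The Leibniz rule when (ad e)^3 kills [X]: here X1 = [e, X] and X2 = [e, [e, X]] / 2, so the last
    binomial coefficient becomes n (n - 1). The truncated predecessors do no harm, as their
    coefficients vanish for small n. *)
Lemma iter_comm (X X1 X2 : {linear V -> V}) :
  (forall v, e (X v) = X (e v) + X1 v) ->
  (forall v, e (X1 v) = X1 (e v) + 2 *: X2 v) ->
  (forall v, e (X2 v) = X2 (e v)) ->
  forall n v, iter n e (X v) = X (iter n e v) + n%:R *: X1 (iter n.-1 e v)
    + (n * n.-1)%:R *: X2 (iter n.-2 e v).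
Proof.
move=> h0 h1 h2; elim=> [|n IH] v; first by rewrite !scale0r !addr0.
rewrite [LHS]/= IH !linearD !linearZ /= h0 h1 h2 scalerDr.
have -> : n%:R *: X1 (e (iter n.-1 e v)) = n%:R *: X1 (iter n e v).
  by case: n {IH} => [|n]; rewrite ?scale0r.
have -> : (n * n.-1)%:R *: X2 (e (iter n.-2 e v)) = (n * n.-1)%:R *: X2 (iter n.-1 e v).
  by case: n {IH} => [|[|n]]; rewrite ?scale0r.
rewrite !scalerA -!addrA; congr (_ + _).
rewrite 2!addrA -{1}[X1 _]scale1r -scalerDl -addrA -scalerDl nat1r.
congr (_ + _ *: _); rewrite -natrM -natrD; congr (_%:R).
by case: n {IH} => //= n; lia.
Qed.

(** This is exp(e) X exp(-e) = exp(ad e) X, whose series stops after the quadratic term. *)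
Lemma expo_comm (X X1 X2 : {linear V -> V}) : locnil e ->
  (forall v, e (X v) = X (e v) + X1 v) ->
  (forall v, e (X1 v) = X1 (e v) + 2 *: X2 v) ->
  (forall v, e (X2 v) = X2 (e v)) ->
  forall v, expo e (X v) = X (expo e v) + X1 (expo e v) + X2 (expo e v).
Proof.
move=> en h0 h1 h2 v; have [N eN] := en v.
have it := iter_comm h0 h1 h2.
(* The correction terms lower the exponent by up to two, so the order of nilpotency is raised by
   two. *)
have z1 : iter N.+1 e v = 0 by rewrite (iter_nil_ge eN).
have z2 : iter N.+2 e v = 0 by rewrite (iter_nil_ge eN)// ltnW.
rewrite (@expoE N.+2 (X v)); last first.
  rewrite it (z2 : iter N.+2 e v = 0) (z1 : iter N.+2.-1 e v = 0).
  by rewrite (eN : iter N.+2.-2 e v = 0) !linear0 ?scaler0 !addr0.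
transitivity (X (\sum_(n < N.+2) dpow e n v) + X1 (\sum_(n < N.+1) dpow e n v)
    + X2 (\sum_(n < N) dpow e n v)); last first.
  by rewrite -!expoE.
rewrite !linear_sum /= [X in _ + X + _]big_ord_recl /= !big_ord_recl /=.
rewrite [X in _ = X + _]addrA -!addrA.
have -> : dpow e 0 (X v) = X (dpow e 0 v) by rewrite !dpow0.
congr (_ + _).
have -> : dpow e 1 (X v) = X (dpow e 1 v) + X1 (dpow e 0 v).
  by rewrite dpow0 !dpow1 h0.
rewrite -!addrA; congr (_ + _); rewrite addrCA; congr (_ + _).
rewrite -!big_split /=; apply: eq_bigr => n _.
rewrite /bump /= !add1n /dpow it !scalerDr !linearZ /= !scalerA.
rewrite -addrA; congr (_ + (_ *: _ + _ *: _)).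
  by rewrite [in LHS]factS natrM invfM mulrA divff ?mul1r// pnatr_eq0.
by rewrite [in LHS]factS [in LHS]factS mulnA [(_ * n`!)%:R]natrM invfM mulrA divff ?mul1r// pnatr_eq0.
Qed.

End Linear.

Lemma expo_linear (e : {linear V -> V}) : locnil e -> linear (expo e).
Proof.
move=> en a u v; have [N1 e1] := en u; have [N2 e2] := en v.
have z1 : iter (maxn N1 N2) e u = 0 by rewrite (iter_nil_ge e1)// leq_maxl.
have z2 : iter (maxn N1 N2) e v = 0 by rewrite (iter_nil_ge e2)// leq_maxr.
rewrite !(@expoE _ (maxn N1 N2))//; last by rewrite iter_linear z1 z2 scaler0 addr0.
by rewrite scaler_sumr -big_split; apply: eq_bigr => n _; exact: dpow_linear.
Qed.

Lemma alternating_binomial k : \sum_(i < k.+1) (-1) ^+ i * 'C(k, i)%:R = (k == 0)%:R :> K.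
Proof.
have := exprDn (1 : K) (-1) k; rewrite subrr expr0n => ->.
by apply: eq_bigr => i _; rewrite expr1n mul1r mulr_natr.
Qed.

Lemma iter_opp (e e' : {linear V -> V}) : (forall v, e' v = - e v) ->
  forall n u, iter n e' u = (-1) ^+ n *: iter n e u.
Proof.
move=> ee'; elim=> [|n IH] u; first by rewrite scale1r.
by rewrite /= IH linearZ /= ee' exprS mulN1r scaleNr scalerN.
Qed.

Lemma dpow_opp (e e' : {linear V -> V}) : (forall v, e' v = - e v) ->
  forall n u, dpow e' n u = (-1) ^+ n *: dpow e n u.
Proof. by move=> ee' n u; rewrite /dpow (iter_opp ee') !scalerA mulrC. Qed.

Lemma locnil_opp (e e' : {linear V -> V}) : (forall v, e' v = - e v) ->
  locnil e -> locnil e'.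
Proof.
move=> ee' en v; have [N eN] := en v; exists N.
by rewrite (iter_opp ee') eN scaler0.
Qed.

(** The double series is summed along antidiagonals, where the alternating binomial sums vanish
    except in degree 0. *)
Lemma expo_inv (e e' : {linear V -> V}) : locnil e -> (forall v, e' v = - e v) ->
  cancel (expo e) (expo e').
Proof.
move=> en ee' v; have [N eN] := en v.
have it := iter_opp ee'; have dp := dpow_opp ee'.
have e'N : iter N e' (expo e v) = 0.
  rewrite it (expoE eN) linear_sum big1 ?scaler0// => n _.
  by rewrite /= /dpow linearZ /= -iterD addnC iterD eN linear0 scaler0.
rewrite (expoE e'N) (expoE eN).
transitivity (\sum_(i < N) \sum_(j < N) ((-1) ^+ i * 'C(i + j, i)%:R) *: dpow e (i + j) v).
  apply: eq_bigr => i _; rewrite dp.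
  rewrite linear_sum scaler_sumr; apply: eq_bigr => j _.
  by rewrite /= dpowD scalerA.
rewrite (@triangular_sum _ (fun i j => ((-1) ^+ i * 'C(i + j, i)%:R) *: dpow e (i + j) v)); last first.
  by move=> i j Nij; rewrite (dpow_nil eN)// scaler0.
transitivity (\sum_(k < N) ((k : nat) == 0)%:R *: dpow e k v).
  apply: eq_bigr => k _; rewrite -alternating_binomial scaler_suml.
  by apply: eq_bigr => i _; rewrite subnKC// -ltnS.
case: N eN {e'N} => [|N] eN; first by rewrite big_ord0 -eN.
rewrite big_ord_recl /= scale1r dpow0 big1 ?addr0// => i _.
by rewrite /bump /= scale0r.
Qed.

Section Reflection.
Variables (e f h H : {linear V -> V}) (a : K).
Hypotheses (en : locnil e) (fn : locnil f).
Hypothesis ef : forall v, e (f v) = f (e v) + h v.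
Hypothesis he : forall v, h (e v) = e (h v) + 2 *: e v.
Hypothesis hf : forall v, h (f v) = f (h v) - 2 *: f v.
Hypothesis He : forall v, H (e v) = e (H v) + a *: e v.
Hypothesis Hf : forall v, H (f v) = f (H v) - a *: f v.

Let ne : {linear V -> V} := \- e.
Let nf : {linear V -> V} := \- f.
Let neE v : ne v = - e v. Proof. by []. Qed.
Let nfE v : nf v = - f v. Proof. by []. Qed.
Let nen := locnil_opp neE en.
Let nfn := locnil_opp nfE fn.

(** The Tits lift of the simple reflection attached to the sl2-triple [e, h, f]. *)
Definition tits v := expo e (expo nf (expo e v)).
Definition tits_inv v := expo ne (expo f (expo ne v)).

Lemma titsK : cancel tits tits_inv.
Proof.
move=> v; rewrite /tits /tits_inv (expo_inv en neE) (expo_inv nfn) ?(expo_inv en neE)//.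
by move=> u; rewrite nfE opprK.
Qed.

Lemma tits_invK : cancel tits_inv tits.
Proof.
move=> v; rewrite /tits /tits_inv (expo_inv nen) => [|u]; last by rewrite neE opprK.
rewrite (expo_inv fn nfE) (expo_inv nen)// => u; by rewrite neE opprK.
Qed.

(** The lift conjugates Cartan operators by the reflection. The three exponentials are moved past
    [H] one at a time; the commutators stay in the span of e, h, f and [H] and stop at second order,
    as [expo_comm] requires. *)
Lemma tits_conj v : tits (H v) = H (tits v) - a *: h (tits v).
Proof.
pose z : {linear V -> V} := \0.
have z0 (g : {linear V -> V}) u : g (z u) = z (g u) by rewrite /= linear0.
pose e_ x : {linear V -> V} := x \*: e.
pose f_ x : {linear V -> V} := x \*: f.
have eH : forall v, expo e (H v) = H (expo e v) - a *: e (expo e v).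
  move=> u; rewrite (expo_comm (X1 := e_ (- a)) (X2 := z))// => [|w|w].
  - by rewrite /= addr0 scaleNr.
  - by rewrite He /= scaleNr addrK.
  - by rewrite /= scaler0 addr0 linearZ.
have fH u : expo nf (H u) = H (expo nf u) - a *: f (expo nf u).
  rewrite (expo_comm (X1 := f_ (- a)) (X2 := z))// => [|w|w].
  - by rewrite /= addr0 scaleNr.
  - by rewrite !nfE linearN /= Hf scaleNr opprD opprK addrK.
  - by rewrite !nfE /= linearN /= scaler0 addr0 linearZ /= scalerN.
have fe u : expo nf (e u) = e (expo nf u) + h (expo nf u) - f (expo nf u).
  rewrite (expo_comm (X1 := h) (X2 := nf))// => w.
  - by rewrite !nfE linearN /= ef opprD addrNK.
  - by rewrite !nfE linearN /= hf scalerN opprD opprK addrK.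
have ee u : expo e (e u) = e (expo e u).
  by rewrite (expo_comm (X1 := z) (X2 := z))//= => *; rewrite ?linear0 ?scaler0 ?addr0.
have eh u : expo e (h u) = h (expo e u) - 2 *: e (expo e u).
  rewrite (expo_comm (X1 := e_ (- 2)) (X2 := z))// => [|w|w].
  - by rewrite /= addr0 scaleNr.
  - by rewrite he /= scaleNr addrK.
  - by rewrite /= scaler0 addr0 linearZ.
have E := expo_linear en; have F := expo_linear nfn.
have EB x u w : expo e (u - x *: w) = expo e u - x *: expo e w.
  by rewrite [u - _]addrC [RHS]addrC -!scaleNr E.
have ED u w : expo e (u + w) = expo e u + expo e w by rewrite -{1}[u]scale1r E scale1r.
have FB x u w : expo nf (u - x *: w) = expo nf u - x *: expo nf w.
  by rewrite [u - _]addrC [RHS]addrC -!scaleNr F.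
rewrite /tits eH FB fH fe; set u := expo nf _.
have -> : H u - a *: f u - a *: (e u + h u - f u) = H u - a *: (e u + h u).
  by rewrite -addrA -opprD -scalerDr [f u + _]addrC addrNK.
rewrite EB eH ED ee eh; set w := expo e u.
rewrite -addrA -opprD -scalerDr; congr (_ - _ *: _).
by rewrite !addrA -mulr2n -scaler_nat [_ + h w]addrC addrK.
Qed.

(** A term of the expanded triple product: [p.2] is the exponent applied first, [p.1.1] the one
    applied last, and the sign comes from -f in the middle factor. *)
Definition tits_term N v (p : 'I_N * 'I_N * 'I_N) : V :=
  (-1) ^+ p.1.2 *: dpow e p.1.1 (dpow f p.1.2 (dpow e p.2 v)).

Lemma locnil_bounded (g : {linear V -> V}) (gn : locnil g) m (w : 'I_m -> V) :
  exists N, forall n i, (N <= n)%N -> iter n g (w i) = 0.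
Proof.
have /fin_all_exists[N HN] i : exists N, iter N g (w i) = 0 by exact: gn.
by exists (\max_i N i) => n i ge; rewrite (iter_nil_ge (HN i))// (leq_trans _ ge)// leq_bigmax.
Qed.

(** The order of nilpotency depends on the vector, but below the earlier cut-offs only finitely many
    vectors occur at each stage, so one bound serves all three exponents. *)
Lemma tits_order v : exists N, forall n3 n2 n1,
  [/\ ((N <= n3)%N -> dpow e n3 v = 0),
      ((N <= n2)%N -> dpow f n2 (dpow e n3 v) = 0) &
      ((N <= n1)%N -> dpow e n1 (dpow f n2 (dpow e n3 v)) = 0)].
Proof.
have [N3 e3] := en v.
have [N2 f2] := locnil_bounded fn (fun i : 'I_N3 => dpow e i v).
(* Pairs of exponents are numbered by quotient and remainder modulo [N2]. *)
have [N1 e1] := locnil_bounded en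
  (fun i : 'I_(N3 * N2) => dpow f (i %% N2) (dpow e (i %/ N2) v)).
exists (N1 + N2 + N3)%N => n3 n2 n1.
have d0 (g : {linear V -> V}) n : dpow g n 0 = 0 by rewrite linear0.
have z3 : (N3 <= n3)%N -> dpow e n3 v = 0 by exact: dpow_nil.
have z2 : (N2 <= n2)%N -> dpow f n2 (dpow e n3 v) = 0.
  have [/z3->|n3N] := leqP N3 n3; first by rewrite linear0.
  by move=> /(f2 _ (Ordinal n3N)); rewrite /dpow => ->; rewrite scaler0.
split=> [le|le|le].
- by apply: z3; lia.
- by apply: z2; lia.
have [/z3->|n3N] := leqP N3 n3; first by rewrite !d0.
have [/z2->|n2N] := leqP N2 n2; first by rewrite d0.
have lt : (n3 * N2 + n2 < N3 * N2)%N by nia.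
have := e1 n1 (Ordinal lt); rewrite /= divnMDl ?modnMDl ?modn_small ?divn_small ?addn0//.
  by rewrite /dpow => ->; [rewrite scaler0|lia].
by lia.
Qed.

Lemma tits_sum N v :
  (forall n3 n2 n1,
    [/\ ((N <= n3)%N -> dpow e n3 v = 0),
        ((N <= n2)%N -> dpow f n2 (dpow e n3 v) = 0) &
        ((N <= n1)%N -> dpow e n1 (dpow f n2 (dpow e n3 v)) = 0)]) ->
  tits v = \sum_p tits_term (N := N) v p.
Proof.
move=> HN.
have expE (g : {linear V -> V}) u : (forall n, (N <= n)%N -> dpow g n u = 0) ->
  expo g u = \sum_(n < N) dpow g n u by exact: fsbig_nat_lt.
have expS (g : {linear V -> V}) (gn : locnil g) (I : finType) (F : I -> V) :
    expo g (\sum_i F i) = \sum_i expo g (F i).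
  pose G : {linear V -> V} := HB.pack (expo g) (GRing.isLinear.Build K V V _ _ (expo_linear gn)).
  exact: (linear_sum G).
rewrite /tits (expE e v); last by move=> n; case: (HN n 0%N 0%N).
rewrite (expS _ nfn) (expS _ en).
transitivity (\sum_(n3 < N) \sum_(n2 < N) \sum_(n1 < N) tits_term v (n1, n2, n3)); last first.
  rewrite pair_bigA pair_bigA /= (reindex (fun p : 'I_N * 'I_N * 'I_N => (p.2, p.1.2, p.1.1))) //=.
  by exists (fun p : 'I_N * 'I_N * 'I_N => (p.2, p.1.2, p.1.1)) => -[[]].
apply: eq_bigr => n3 _; rewrite (expE nf); last first.
  by move=> n Nn; rewrite (dpow_opp nfE); case: (HN n3 n 0%N) => _ -> //; rewrite scaler0.
rewrite expS//; apply: eq_bigr => n2 _; rewrite expE => [|n Nn].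
  by apply: eq_bigr => n1 _; rewrite (dpow_opp nfE) linearZ.
by rewrite (dpow_opp nfE) linearZ /=; case: (HN n3 n2 n) => _ _ -> //; rewrite scaler0.
Qed.

Lemma dpow_eigen (g : {linear V -> V}) b c n v :
  (forall v, h (g v) = g (h v) + b *: g v) -> h v = c *: v ->
  h (dpow g n v) = (c + b *+ n) *: dpow g n v.
Proof.
move=> hg hv; rewrite /dpow linearZ /= [RHS]scalerA mulrC -scalerA; congr (_ *: _).
elim: n => [|n IH] /=; first by rewrite addr0.
by rewrite hg IH linearZ -scalerDl mulrSr addrA.
Qed.

Lemma tits_term_eigen N v c p : h v = c *: v ->
  h (tits_term (N := N) v p) = (c + 2 * (p.1.1%:Z - p.1.2%:Z + p.2%:Z)%:~R) *: tits_term v p.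
Proof.
move=> hv; have h3 := dpow_eigen p.2 he hv.
have hf' w : h (f w) = f (h w) + (- 2) *: f w by rewrite scaleNr hf.
have h2 := dpow_eigen p.1.2 hf' h3.
have h1 := dpow_eigen p.1.1 he h2.
rewrite /tits_term linearZ h1 /= [LHS]scalerA [RHS]scalerA mulrC; congr (_ * _ *: _).
rewrite -[2 *+ p.2]mulr_natr -[(-2) *+ _]mulr_natr -[2 *+ p.1.1]mulr_natr.
by rewrite !rmorphD rmorphN /= -!pmulrn; ring.
Qed.

Lemma tits_linear : linear tits.
Proof.
by move=> x u v; rewrite /tits (expo_linear en) (expo_linear nfn) (expo_linear en).
Qed.

Lemma tits_neq0 v : v != 0 -> tits v != 0.
Proof.
have t0 : tits 0 = 0.
  have := tits_linear (-1) 0 0; rewrite scaleN1r oppr0 addr0 => {1}->.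
  by rewrite scaleN1r addNr.
by apply: contra_neq => tv; rewrite -(titsK v) tv -[in tits_inv _]t0 titsK.
Qed.

End Reflection.

Section Integrality.
Variables (e f h : {linear V -> V}).
Hypotheses (en : locnil e) (fn : locnil f).
Hypothesis ef : forall v, e (f v) = f (e v) + h v.
Hypothesis he : forall v, h (e v) = e (h v) + 2 *: e v.
Hypothesis hf : forall v, h (f v) = f (h v) - 2 *: f v.

Lemma tits_eigen v c : h v = c *: v -> h (tits e f v) = (- c) *: tits e f v.
Proof.
move=> hv; have := tits_conj en fn ef he hf he hf v; rewrite hv.
have -> : tits e f (c *: v) = c *: tits e f v.
  by have := tits_linear en fn (c - 1) v v; rewrite -{2}[v]scale1r -scalerDl subrK
    => ->; rewrite -{2}[tits e f v]scale1r -scalerDl subrK.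
rewrite scaler_nat mulr2n opprD addrA subrr add0r => /(congr1 -%R).
by rewrite opprK -scaleNr => <-.
Qed.

(** The lift of [v] has eigenvalue -c, while each term of its expansion has eigenvalue c + 2 z with
    z an integer. As the lift is not zero, -c = c + 2 z for some term. *)
Lemma eigen_integral v c : h v = c *: v -> v != 0 -> exists z : int, c = z%:~R.
Proof.
move=> hv v0; have [N /(tits_sum en fn) tE] := tits_order en fn v.
have [|||p cp] := @eigen_sum_neq0 _ _ h _ (tits_term (N := N) e f v)
  (fun p => c + 2 * (p.1.1%:Z - p.1.2%:Z + p.2%:Z)%:~R) (- c).
- by move=> p; exact: tits_term_eigen.
- by rewrite -tE (tits_eigen hv).
- by rewrite -tE tits_neq0.
exists (- (p.1.1%:Z - p.1.2%:Z + p.2%:Z)); rewrite rmorphN /=.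
move: cp; set z := _%:~R => cp; have : 2 * (c + z) = c + 2 * z + c by ring.
by rewrite cp addNr => /eqP; rewrite mulf_eq0 pnatr_eq0 /= addr_eq0 => /eqP.
Qed.

(** The homogeneous parts are separated here in characteristic 0; the vanishing survives the passage
    to a completion, where distinct eigenvalues might coincide. *)
Lemma tits_part0 N v c (k : int) : h v = c *: v ->
  tits e f v = \sum_p tits_term (N := N) e f v p ->
  c + 2 * k%:~R != - c ->
  \sum_(p : 'I_N * 'I_N * 'I_N | p.1.1%:Z - p.1.2%:Z + p.2%:Z == k) tits_term (N := N) e f v p = 0.
Proof.
move=> hv tE ck.
rewrite -[RHS](@eigen_sum_part _ _ h _ (tits_term (N := N) e f v)
  (fun p => c + 2 * (p.1.1%:Z - p.1.2%:Z + p.2%:Z)%:~R) (- c) _ _ _ ck).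
- apply: eq_bigl => p; apply/eqP/eqP => [->//|/addrI].
  by move/(mulfI _) => /(_ _)/intr_inj; apply; rewrite pnatr_eq0.
- by move=> p; exact: tits_term_eigen.
- by rewrite -tE (tits_eigen hv).
Qed.
End Integrality.
End Exponential.

(** * The Killing form and the root system *)

Section Trace.
Variables (K : fieldType) (g : vectType K).
Implicit Types f : g -> g.

Definition ltrace f : K :=
  \sum_i coord (vbasis (fullv : {vspace g})) i (f (vbasis (fullv : {vspace g}))`_i).

Lemma ltrace_basis n (b : n.-tuple g) (f : {linear g -> g}) :
  basis_of fullv b -> ltrace f = \sum_i coord b i (f b`_i).
Proof.
move=> bb; rewrite /ltrace; set e := vbasis _.
have eb : basis_of fullv e := vbasisP _.
have bE v : v = \sum_i coord b i v *: b`_i by rewrite -(coord_basis bb) ?memvf.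
have eE v : v = \sum_i coord e i v *: e`_i by rewrite -(coord_basis eb) ?memvf.
transitivity (\sum_(i < n) \sum_j coord e j b`_i * coord b i (f e`_j)).
  rewrite exchange_big; apply: eq_bigr => j _ /=.
  rewrite {1}(bE (f e`_j)) linear_sum; apply: eq_bigr => i _.
  by rewrite linearZ /= mulrC.
apply: eq_bigr => i _; rewrite {2}(eE b`_i) !linear_sum /=.
by apply: eq_bigr => j _; rewrite !linearZ.
Qed.

Lemma ltrace_comm (f1 f2 : {linear g -> g}) : ltrace (f1 \o f2) = ltrace (f2 \o f1).
Proof.
rewrite /ltrace; set e := vbasis _.
have eb : basis_of fullv e := vbasisP _.
have eE v : v = \sum_i coord e i v *: e`_i by rewrite -(coord_basis eb) ?memvf.
have F (f f' : {linear g -> g}) i :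
    coord e i (f (f' e`_i)) = \sum_j coord e j (f' e`_i) * coord e i (f e`_j).
  rewrite {1}(eE (f' e`_i)) !linear_sum /=.
  by apply: eq_bigr => j _; rewrite !linearZ.
under eq_bigr do rewrite /= F.
rewrite exchange_big /=; apply: eq_bigr => j _; rewrite F.
by apply: eq_bigr => i _; rewrite mulrC.
Qed.
End Trace.

Section SpanMap.
Variables (K : fieldType) (vT : vectType K) (I : eqType) (f : I -> vT).

Lemma span_mapP (s : seq I) (v : vT) : uniq s -> v \in <<map f s>>%VS ->
  exists d : I -> K, v = \sum_(a <- s) d a *: f a.
Proof.
elim: s v => [|a s IH] v /=.
  by rewrite span_nil memv0 => _ /eqP ->; exists (fun=> 0); rewrite big_nil.
move=> /andP[as_ us]; rewrite span_cons => /memv_addP[_ /vlineP[k ->]] [w /(IH _ us)[d ->]] ->.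
exists (fun b => if b == a then k else d b); rewrite big_cons eqxx; congr (_ + _).
rewrite [LHS]big_seq [RHS]big_seq; apply: eq_bigr => b bs.
by case: eqP bs as_ => // -> ->.
Qed.

Lemma span_map_sum (s : seq I) (d : I -> K) :
  \sum_(a <- s) d a *: f a \in <<map f s>>%VS.
Proof.
rewrite big_seq; apply: memv_suml => a as_.
by apply/memvZ/memv_span/map_f.
Qed.

Lemma free_map_coef (s : seq I) (d : I -> K) : free (map f s) ->
  \sum_(a <- s) d a *: f a = 0 -> forall a, a \in s -> d a = 0.
Proof.
elim: s => //= a s IH; rewrite free_cons big_cons => /andP[afree /IH{}IH] sum0 b.
suff da : d a = 0.
  by move: sum0; rewrite da scale0r add0r inE => /IH s0 /orP[/eqP ->//|]; apply: s0.
apply: contraNeq afree => da.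
have -> : f a = - (d a)^-1 *: \sum_(b <- s) d b *: f b.
  move/eqP: sum0; rewrite addr_eq0 => /eqP/(congr1 (fun v => (d a)^-1 *: v)).
  by rewrite scalerA mulVf// scale1r => ->; rewrite scalerN scaleNr.
by apply/memvZ/span_map_sum.
Qed.
End SpanMap.

Section ChevalleyTheory.
Variables (R : realType) (L : chevalleyAlgebra R).
Implicit Types (x y z : L) (H : hfin L) (a b : dual_hfin L).

Local Notation "[< x , y >]" := (@lbr R L x y) (at level 0, x, y at level 99).

Lemma lbr_linr x : linear (@lbr R L x).
Proof. by case: (lbrP L) => /(_ x). Qed.
HB.instance Definition _ x := GRing.isLinear.Build R L L _ (@lbr R L x) (lbr_linr x).

Definition rbr y x := [<x, y>].
Lemma rbr_linear y : linear (rbr y).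
Proof. by case: (lbrP L) => _ /(_ y). Qed.
HB.instance Definition _ y := GRing.isLinear.Build R L L _ (rbr y) (rbr_linear y).
Lemma rbrE y x : [<x, y>] = rbr y x. Proof. by []. Qed.

Lemma lbrxx x : [<x, x>] = 0. Proof. by case: (lbrP L). Qed.
Lemma lbrDl x x' y : [<x + x', y>] = [<x, y>] + [<x', y>].
Proof. by rewrite !rbrE linearD. Qed.
Lemma lbrZl c x y : [<c *: x, y>] = c *: [<x, y>].
Proof. by rewrite !rbrE linearZ. Qed.
Lemma lbr0l y : [<0, y>] = 0.
Proof. by rewrite rbrE linear0. Qed.
Lemma lbrC x y : [<x, y>] = - [<y, x>].
Proof.
apply/eqP; rewrite -addr_eq0; have := lbrxx (x + y).
by rewrite lbrDl !linearD /= !lbrxx add0r addr0 => ->.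
Qed.
Lemma lbr_jacobi x y z : [<x, [<y, z>]>] = [<[<x, y>], z>] + [<y, [<x, z>]>].
Proof.
have [_ _ _ /(_ x y z)] := lbrP L.
rewrite (lbrC z x) linearN (lbrC z [<x, y>]) => /eqP.
by rewrite -addrA -opprD subr_eq0 addrC => /eqP ->.
Qed.

Local Notation K := (killing (@lbr R L)).

Lemma killingE x y : K x y = ltrace (@lbr R L x \o @lbr R L y).
Proof. by []. Qed.

Lemma killing_linear x : linear (K x : L -> R^o).
Proof.
move=> c u v; rewrite /killing scaler_sumr -big_split; apply: eq_bigr => i _.
by rewrite lbrDl lbrZl linearP linearP.
Qed.
HB.instance Definition _ x :=
  GRing.isLinear.Build R L R^o _ (K x : L -> R^o) (killing_linear x).

Lemma killingC x y : K x y = K y x.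
Proof. by rewrite !killingE ltrace_comm. Qed.

(** Both sides are differences of traces of triple products, tr(xyz) - tr(yxz) and tr(xyz) -
    tr(xzy), which agree by cyclicity. *)
Lemma killing_invariant x y z : K [<x, y>] z = K x [<y, z>].
Proof.
rewrite [LHS]/killing [RHS]/killing.
have D (f1 f2 : {linear L -> L}) : ltrace (f1 \- f2) = ltrace f1 - ltrace f2.
  by rewrite -sumrB; apply: eq_bigr => i _; rewrite linearB.
pose A u : {linear L -> L} := @lbr R L u.
transitivity (ltrace ((A x \o (A y \o A z)) \- (A y \o (A x \o A z)))).
  by apply: eq_bigr => i _; rewrite /= (lbr_jacobi x y [<z, _>]) addrK.
transitivity (ltrace ((A x \o (A y \o A z)) \- (A x \o (A z \o A y)))); last first.
  apply: eq_bigr => i _; congr (coord _ _ _).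
  by rewrite /= -linearB /= (lbr_jacobi y z) addrK.
rewrite !D; congr (_ - _).
by rewrite (ltrace_comm (A y)).
Qed.

Definition corootseq := [seq vsval (coroot (simpleroot i)) | i <- enum 'I_(rank L)].
Definition rootvecseq : seq L := [seq rootvec a | a <- Delta L].

Lemma chev_free : free (corootseq ++ rootvecseq).
Proof. by have /andP[] := chevalley_basis L. Qed.

Lemma cartan_nspace0 x : x \in cartan L -> x \in <<rootvecseq>>%VS -> x = 0.
Proof.
have := chev_free; rewrite cat_free => /and3P[_ _ /directv_addP].
have /andP[/eqP -> _] := cartan_basis L => cap xc xn.
by apply/eqP; rewrite -memv0 -cap memv_cap xc xn.
Qed.

Lemma chev_decomp x : exists H (d : dual_hfin L -> R),
  x = vsval H + \sum_(a <- Delta L) d a *: rootvec a.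
Proof.
have /andP[/eqP full _] := chevalley_basis L.
have : x \in fullv by exact: memvf.
rewrite -full span_cat => /memv_addP[u uc] [v /(span_mapP (Delta_uniq L))[d vE] ->].
have /andP[/eqP cE _] := cartan_basis L.
have uh : u \in cartan L by rewrite -cE.
by exists (vsproj (cartan L) u), d; rewrite vsprojK// vE.
Qed.

Lemma chev_decomp0 H (d : dual_hfin L -> R) :
  vsval H + \sum_(a <- Delta L) d a *: rootvec a = 0 ->
  H = 0 /\ forall a, a \in Delta L -> d a = 0.
Proof.
set v := \sum_(_ <- _) _ => Hv.
have vn : v \in <<rootvecseq>>%VS by exact: span_map_sum.
have H0 : vsval H = 0.
  apply: cartan_nspace0 (subvsP _) _.
  by move/eqP: Hv; rewrite addr_eq0 => /eqP ->; rewrite rpredN.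
split; first by apply: subvs_inj; rewrite H0 linear0.
apply: (@free_map_coef _ _ _ (@rootvec R L)); last by rewrite H0 add0r in Hv.
by have := chev_free; rewrite cat_free => /and3P[].
Qed.

Lemma chev_decomp_inj H H' (d d' : dual_hfin L -> R) :
  vsval H + \sum_(a <- Delta L) d a *: rootvec a =
  vsval H' + \sum_(a <- Delta L) d' a *: rootvec a ->
  H = H' /\ forall a, a \in Delta L -> d a = d' a.
Proof.
move/eqP; rewrite -subr_eq0 opprD addrACA -sumrB -linearB /= => /eqP eq0.
have [] := @chev_decomp0 (H - H') (fun a => d a - d' a).
  by rewrite -[RHS]eq0; congr (_ + _); apply: eq_bigr => a _; rewrite scalerBl.
move=> /eqP; rewrite subr_eq0 => /eqP -> dd; split=> // a /dd /eqP.
by rewrite subr_eq0 => /eqP.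
Qed.

Lemma rootvec_neq0 a : a \in Delta L -> rootvec a != 0.
Proof.
move=> aD; have := chev_free; rewrite cat_free => /and3P[_ + _].
by move=> fr; apply: (free_not0 fr); apply: map_f.
Qed.

Lemma Delta_neq0 a : a \in Delta L -> a != 0.
Proof. by move=> /DeltaP[]. Qed.

Lemma lfun_neq0P a : a != 0 -> exists H, a H != 0.
Proof.
move=> a0; apply: contrapT => /forallNP aH; move/eqP: a0; apply.
by apply/lfunP => H; rewrite zero_lfunE; apply/eqP/negPn/negP; exact: aH.
Qed.

Definition weightv a x := forall H, [<vsval H, x>] = a H *: x.

Lemma vsvalZ c H : vsval (c *: H) = c *: vsval H.
Proof. by []. Qed.

Lemma weightv_lbr a b x y : weightv a x -> weightv b y -> weightv (a + b) [<x, y>].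
Proof.
move=> wx wy H; rewrite lbr_jacobi wx wy lbrZl linearZ /= -scalerDl.
by rewrite add_lfunE.
Qed.

Lemma weightv_rootvec a : a \in Delta L -> weightv a (rootvec a).
Proof. by move=> aD H; exact: rootvec_weight. Qed.

Lemma cartan_lbr H H' : exists H'', [<vsval H, vsval H'>] = vsval H''.
Proof.
have [/(_ _ _ (subvsP H) (subvsP H')) m _ _] := cartanP L.
by exists (vsproj (cartan L) [<vsval H, vsval H'>]); rewrite vsprojK.
Qed.

Lemma weightv_neq0 a x : a != 0 -> weightv a x -> x != 0 -> a \in Delta L.
Proof. by move=> a0 wx x0; apply/DeltaP; split=> //; exists x. Qed.

(** Comparing coefficients in the Chevalley basis leaves the root vector of [a] and a Cartan
    component. The Cartan subalgebra is so far known only to be nilpotent: ad H multiplies that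
    component by a(H), so a choice with a(H) <> 0 forces it to vanish. *)
Lemma weightv_rootspace a x : a != 0 -> weightv a x -> exists c, x = c *: rootvec a.
Proof.
move=> a0 wx; have [H0 [d xE]] := chev_decomp x.
have key H : [<vsval H, vsval H0>] = a H *: vsval H0 /\
    forall b, b \in Delta L -> d b * b H = a H * d b.
  have [H' H'E] := cartan_lbr H H0.
  have := wx H; rewrite {1}xE linearD /= linear_sum /= H'E.
  rewrite big_seq (eq_bigr (fun b => (d b * b H) *: rootvec b)); last first.
    by move=> b bD; rewrite linearZ /= rootvec_weight// scalerA.
  rewrite -big_seq xE scalerDr scaler_sumr.
  under [X in _ = _ + X]eq_bigr do rewrite scalerA.
  by rewrite -linearZ => /(@chev_decomp_inj _ _ (fun b => d b * b H) (fun b => a H * d b))[-> dE].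
have H00 : vsval H0 = 0.
  have [H aH] := lfun_neq0P a0.
  have [_ [n nil] _] := cartanP L.
  have := nil (nseq n (vsval H)) (vsval H0) (size_nseq _ _).
  rewrite all_nseq /= subvsP orbT => /(_ isT (subvsP _)).
  have -> : foldr (@lbr R L) (vsval H0) (nseq n (vsval H)) = a H ^+ n *: vsval H0.
    elim: n {nil} => [|n IH] /=; first by rewrite scale1r.
    by rewrite IH linearZ /= (key H).1 scalerA exprSr.
  by move/eqP; rewrite scaler_eq0 expf_eq0 (negPf aH) andbF => /eqP.
exists (if a \in Delta L then d a else 0); rewrite {1}xE H00 add0r.
have d0 b : b \in Delta L -> b != a -> d b = 0.
  move=> bD ba; have [|H baH] := @lfun_neq0P (b - a); first by rewrite subr_eq0.
  have /(_ b bD)/eqP := (key H).2; rewrite mulrC -subr_eq0 -mulrBl mulf_eq0.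
  by rewrite add_lfunE opp_lfunE in baH; rewrite (negPf baH) => /eqP.
case: ifPn => aD.
  rewrite (bigD1_seq a)//= ?Delta_uniq// big_seq_cond big1 ?addr0// => b /andP[bD ba].
  by rewrite d0// scale0r.
rewrite scale0r big_seq big1// => b bD; rewrite d0 ?scale0r//.
by apply: contraNneq aD => <-.
Qed.

Lemma weightv_nspace a x : a != 0 -> weightv a x -> x \in <<rootvecseq>>%VS.
Proof.
move=> a0 wx; have [->|x0] := eqVneq x 0; first exact: mem0v.
have aD := weightv_neq0 a0 wx x0; have [c ->] := weightv_rootspace a0 wx.
by apply/memvZ/memv_span/map_f.
Qed.

Lemma coroot_neq0 a : a \in Delta L -> coroot a != 0.
Proof.
move=> /coroot2 a2; apply/eqP => c0; move: a2; rewrite c0 linear0 => /eqP.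
by rewrite eq_sym pnatr_eq0.
Qed.

(** If -a were not a root, [rootvec (- a)] would be an unspecified vector, but its bracket with
    [rootvec a] would still lie in the span of the root vectors. This bracket is a nonzero coroot,
    hence in the Cartan subalgebra. *)
Lemma Delta_opp a : a \in Delta L -> - a \in Delta L.
Proof.
move=> aD; apply: contraT => naD.
have [H [d yE]] := chev_decomp (rootvec (- a)).
suff cn : vsval (coroot a) \in <<rootvecseq>>%VS.
  have := coroot_neq0 aD; rewrite -(inj_eq subvs_inj) => /negP[].
  by rewrite (cartan_nspace0 (subvsP _) cn) linear0.
rewrite -rootvec_opp// yE linearD /= lbrC rootvec_weight//; apply: rpredD.
  by rewrite rpredN; apply/memvZ/memv_span/map_f.
rewrite linear_sum big_seq; apply: rpred_sum => b bD; rewrite linearZ; apply: memvZ.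
apply: (@weightv_nspace (a + b)); last by apply: weightv_lbr; exact: weightv_rootvec.
by rewrite addr_eq0; apply: contraNneq naD => ->; rewrite opprK.
Qed.

(** The Cartan subalgebra is spanned by coroots, and these are brackets of root vectors of opposite
    weights, so the two contributions in the Jacobi identity cancel. *)
Lemma cartan_abelian H H' : [<vsval H, vsval H'>] = 0.
Proof.
rewrite (@coord_span _ _ _ (in_tuple corootseq) (vsval H')); last first.
  by have /andP[/eqP -> _] := cartan_basis L; exact: subvsP.
rewrite linear_sum big1// => i _; rewrite linearZ /=.
have : (in_tuple corootseq)`_i \in corootseq by apply: mem_nth; exact: (ltn_ord i).
move=> /mapP[j _ ->]; rewrite -rootvec_opp ?simpleroot_Delta// lbr_jacobi.
rewrite !rootvec_weight ?Delta_opp ?simpleroot_Delta// lbrZl linearZ /= -scalerDl.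
by rewrite opp_lfunE subrr scale0r scaler0.
Qed.

Lemma killing_cartan H H' :
  K (vsval H) (vsval H') = \sum_(a <- Delta L) a H * a H'.
Proof.
have bb : basis_of fullv (in_tuple (corootseq ++ rootvecseq)) by exact: chevalley_basis.
rewrite killingE (ltrace_basis _ bb).
pose ev := nseq (size corootseq) 0 ++ [seq a H * a H' | a <- Delta L].
transitivity (\sum_(i < size (corootseq ++ rootvecseq)) ev`_i); last first.
  have -> : size (corootseq ++ rootvecseq) = size ev.
    by rewrite !size_cat size_nseq !size_map.
  rewrite -(big_mkord xpredT (fun i => ev`_i)) -(big_nth 0 xpredT id) big_cat /=.
  by rewrite big_nseq iter_addr addr0 mul0rn add0r big_map.
apply: eq_bigr => i _.
transitivity (coord (in_tuple (corootseq ++ rootvecseq)) i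
    (ev`_i *: (in_tuple (corootseq ++ rootvecseq))`_i)); last first.
  rewrite linearZ /= (@coord_free _ _ _ (in_tuple (corootseq ++ rootvecseq))) ?chev_free//.
  by rewrite eqxx mulr1.
congr (coord _ _ _); rewrite /= /ev !nth_cat size_nseq; case: ifPn => [ilt|ige].
  rewrite nth_nseq ilt scale0r.
  have /mapP[j _ ->] : corootseq`_i \in corootseq by exact: mem_nth.
  by rewrite cartan_abelian linear0.
have lt : (i - size corootseq < size (Delta L))%N.
  have := ltn_ord i; rewrite [X in (_ < X)%N]size_cat (size_map (@rootvec R L)) => ilt.
  by rewrite ltn_subLR// leqNgt.
rewrite (nth_map 0)// (nth_map 0)// !rootvec_weight ?mem_nth//.
by rewrite linearZ /= rootvec_weight ?mem_nth// scalerA mulrC.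
Qed.

Lemma killing_rootvec a H y : a \in Delta L ->
  K (vsval H) [<rootvec a, y>] = a H * K (rootvec a) y.
Proof.
move=> aD; rewrite -killing_invariant rootvec_weight// [LHS]killingC [in RHS]killingC.
by rewrite linearZ.
Qed.

Local Notation h0 := (coroot (highroot L)).

Lemma killing_gt0 a H : a \in Delta L -> a H != 0 -> 0 < K (vsval H) (vsval H).
Proof.
move=> aD aH; rewrite killing_cartan (bigD1_seq a)//= ?Delta_uniq// ltr_pwDl//.
  by rewrite -expr2 lt_neqAle eq_sym sqrf_eq0 aH sqr_ge0.
by rewrite sumr_ge0// => b _; rewrite -expr2 sqr_ge0.
Qed.

Definition fnorm : R := 2 / K (vsval h0) (vsval h0).

Lemma fnorm_gt0 : 0 < fnorm.
Proof.
rewrite divr_gt0//; apply: (@killing_gt0 (highroot L)); rewrite ?highroot_Delta//.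
by rewrite coroot2 ?highroot_Delta// pnatr_eq0.
Qed.

Local Notation form := (@Defs.form R L).

Lemma form_killing x y : form x y = fnorm * K x y.
Proof. by rewrite /Defs.form /fnorm mulrAC. Qed.

Lemma formC x y : form x y = form y x.
Proof. by rewrite !form_killing killingC. Qed.

Lemma form_linear x : linear (form x : L -> R^o).
Proof.
move=> c u v; rewrite !form_killing linearP mulrDr; congr (_ + _).
by rewrite /GRing.scale /= mulrCA.
Qed.
HB.instance Definition _ x :=
  GRing.isLinear.Build R L R^o _ (form x : L -> R^o) (form_linear x).

Definition hform H H' := form (vsval H) (vsval H').

Lemma hformE H H' : hform H H' = fnorm * \sum_(a <- Delta L) a H * a H'.
Proof. by rewrite /hform form_killing killing_cartan. Qed.

Lemma hform_linear H : linear (hform H : hfin L -> R^o).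
Proof. by move=> c u v; exact: (form_linear (vsval H) c (vsval u) (vsval v)). Qed.
HB.instance Definition _ H :=
  GRing.isLinear.Build R (hfin L) R^o _ (hform H : hfin L -> R^o) (hform_linear H).

Lemma hformC H H' : hform H H' = hform H' H.
Proof. exact: formC. Qed.

Lemma roots_eq0 H : (forall i, @simpleroot R L i H = 0) -> H = 0.
Proof.
move=> sH.
have z (f : dual_hfin L) : f H = 0.
  rewrite (@coord_span _ _ _ (in_tuple [seq simpleroot i | i <- enum 'I_(rank L)]) f); last first.
    by have /andP[/eqP -> _] := simpleroot_basis L; exact: memvf.
  rewrite sum_lfunE big1// => i _; rewrite scale_lfunE.
  have /mapP[j _ ->] : (in_tuple [seq @simpleroot R L i | i <- enum 'I_(rank L)])`_i
      \in [seq simpleroot i | i <- enum 'I_(rank L)].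
    by apply: mem_nth; exact: (ltn_ord i).
  by rewrite sH scaler0.
have b := vbasisP (fullv : {vspace (hfin L)}).
rewrite (coord_basis b (memvf H)) big1// => i _.
have := z (linfun (coord (vbasis fullv) i : hfin L -> R^o)); rewrite lfunE /= => ->.
by rewrite scale0r.
Qed.

Lemma hform_def H : hform H H <= 0 -> H = 0.
Proof.
move=> H0; apply: roots_eq0 => i; apply/eqP; apply: contraTT H0 => iH.
rewrite -ltNge /hform form_killing mulr_gt0 ?fnorm_gt0//.
exact: killing_gt0 (simpleroot_Delta i) iH.
Qed.

Lemma hform_inj H H' : (forall H1, hform H H1 = hform H' H1) -> H = H'.
Proof.
move=> HH; apply/eqP; rewrite -subr_eq0; apply/eqP/hform_def.
by rewrite linearB /= ![hform (H - H') _]hformC !HH subrr.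
Qed.

Definition rnorm a := hform (coroot a) (coroot a).

Lemma rnorm_gt0 a : a \in Delta L -> 0 < rnorm a.
Proof.
by move=> /coroot_neq0; apply: contraNT; rewrite -leNgt => /hform_def ->.
Qed.

Lemma hform_coroot a H : a \in Delta L -> hform H (coroot a) = a H * (rnorm a / 2).
Proof.
move=> aD; have f H' : hform H' (coroot a) = a H' * form (rootvec a) (rootvec (- a)).
  by rewrite /hform -rootvec_opp// !form_killing killing_rootvec// mulrCA.
by rewrite /rnorm !f coroot2// [2 * _]mulrC mulfK ?pnatr_eq0.
Qed.

Lemma form_rootvec a : a \in Delta L ->
  form (rootvec a) (rootvec (- a)) = rnorm a / 2.
Proof.
move=> aD; have := hform_coroot (coroot a) aD.
have -> : hform (coroot a) (coroot a) = form (vsval (coroot a)) [<rootvec a, rootvec (- a)>].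
  by rewrite rootvec_opp.
rewrite !form_killing killing_rootvec// coroot2// mulrCA => /mulfI; apply.
by rewrite pnatr_eq0.
Qed.

Lemma rnorm_highroot : rnorm (highroot L) = 2.
Proof.
rewrite /rnorm /hform /Defs.form mulfK// gt_eqF//.
apply: (@killing_gt0 (highroot L)); rewrite ?highroot_Delta//.
by rewrite coroot2 ?highroot_Delta// pnatr_eq0.
Qed.

Lemma coroot_opp a : a \in Delta L -> coroot (- a) = - coroot a.
Proof.
move=> aD; apply: subvs_inj; rewrite -rootvec_opp ?Delta_opp// opprK lbrC.
by rewrite rootvec_opp// linearN.
Qed.

Lemma form_reprP a : a \in Delta L -> form_repr a = (2 / rnorm a) *: coroot a.
Proof.
move=> aD; have r0 : rnorm a != 0 by rewrite gt_eqF// rnorm_gt0.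
rewrite /form_repr; case: xgetP => [u _ /= uP|/(_ ((2 / rnorm a) *: coroot a))[]].
  apply: hform_inj => H; rewrite [LHS]uP hformC linearZ /= hform_coroot//.
  by rewrite /GRing.scale /=; field.
move=> H; rewrite -/(hform _ H) hformC linearZ /= hform_coroot//.
by rewrite /GRing.scale /=; field.
Qed.

Lemma dual_form_highroot : dual_form (highroot L) (highroot L) = 2.
Proof.
rewrite /dual_form !form_reprP ?highroot_Delta// rnorm_highroot divff// scale1r.
exact: rnorm_highroot.
Qed.

End ChevalleyTheory.

Section RootSystem.
Variables (R : realType) (L : chevalleyAlgebra R).
Implicit Types (x y z : L) (H : hfin L) (a b : dual_hfin L).
Local Notation "[< x , y >]" := (@lbr R L x y) (at level 0, x, y at level 99).

Lemma nilv_comb (e : {linear L -> L}) c u v :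
  (exists n, iter n e u = 0) -> (exists n, iter n e v = 0) ->
  exists n, iter n e (c *: u + v) = 0.
Proof.
move=> [m mu] [n nv]; exists (maxn m n).
rewrite linearP /= (iter_nil_ge mu) ?leq_maxl// (iter_nil_ge nv) ?leq_maxr//.
by rewrite scaler0 addr0.
Qed.

Lemma weightv_iter a b x n : weightv a x -> b \in Delta L ->
  weightv (a + b *+ n) (iter n (@lbr R L (rootvec b)) x).
Proof.
move=> wx bD; elim: n => [|n IH]; first by rewrite addr0.
by rewrite iterS mulrSr addrA addrC; apply: weightv_lbr => //; exact: weightv_rootvec.
Qed.

(** The weights a + n b are pairwise distinct and only finitely many are roots or zero, so a power
    kills each root vector; on the Cartan part two brackets suffice. *)
Lemma ad_rootvec_locnil b : b \in Delta L -> locnil (@lbr R L (rootvec b)).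
Proof.
move=> bD x; have b0 := Delta_neq0 bD.
have nroot a : a \in Delta L -> exists n, iter n (@lbr R L (rootvec b)) (rootvec a) = 0.
  move=> aD; pose w n := a + b *+ n.
  have winj : injective w.
    move=> m n /addrI /eqP; rewrite -(scaler_nat m b) -(scaler_nat n b) -subr_eq0 -scalerBl scaler_eq0.
    by rewrite (negPf b0) orbF subr_eq0 eqr_nat => /eqP.
  (* Pigeonhole: this many distinct weights do not fit into the list of the roots and 0, which is
     shorter by one. *)
  have [[n nD] | all_] : (exists n : 'I_(size (Delta L)).+2, w n \notin 0 :: Delta L) \/
      forall n : 'I_(size (Delta L)).+2, w n \in 0 :: Delta L.
    have [/existsP|/existsPn h] := boolP [exists n : 'I_(size (Delta L)).+2, w n \notin 0 :: Delta L].
      by left.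
    by right=> n; apply/negPn/h.
    exists n; apply/eqP; apply: contraNT nD => it0; rewrite inE.
    have [->//|wn0] := eqVneq (w n) 0.
    by apply: (weightv_neq0 wn0) it0; apply: weightv_iter => //; exact: weightv_rootvec.
  exfalso; have u : uniq [seq w n | n <- map val (enum 'I_(size (Delta L)).+2)].
    by rewrite map_inj_uniq// val_enum_ord iota_uniq.
  have /(uniq_leq_size u) : {subset [seq w n | n <- map val (enum 'I_(size (Delta L)).+2)] <= 0 :: Delta L}.
    by move=> _ /mapP[_ /mapP[n _ ->] ->]; exact: all_.
  by rewrite val_enum_ord size_map size_iota /= ltnn.
have [H [d ->]] := chev_decomp x.
rewrite -[vsval H]scale1r; apply: nilv_comb.
  exists 2%N => /=; rewrite [lbr _ (vsval H)]lbrC rootvec_weight// linearN linearZ /=.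
  by rewrite lbrxx scaler0 oppr0.
have [n nP] : exists n, forall a, a \in Delta L -> iter n (@lbr R L (rootvec b)) (rootvec a) = 0.
  elim: (Delta L) nroot => [|a s IH] nr; first by exists 0%N.
  have [|m mP] := IH; first by move=> c cs; apply: nr; rewrite inE cs orbT.
  have [n nP] := nr a (mem_head _ _).
  exists (maxn n m) => c; rewrite inE => /predU1P[->|/mP cm].
    by rewrite (iter_nil_ge nP)// leq_maxl.
  by rewrite (iter_nil_ge cm)// leq_maxr.
exists n; rewrite big_seq linear_sum big1// => a aD.
by rewrite linearZ /= nP// scaler0.
Qed.

Section Sl2.
Variable b : dual_hfin L.
Hypothesis bD : b \in Delta L.
Let e := @lbr R L (rootvec b).
Let f := @lbr R L (rootvec (- b)).
Let h := @lbr R L (vsval (coroot b)).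

Lemma ad_ef v : e (f v) = f (e v) + h v.
Proof. by rewrite /e /f /h lbr_jacobi rootvec_opp// addrC. Qed.

Lemma ad_He H v : [<vsval H, e v>] = e [<vsval H, v>] + b H *: e v.
Proof. by rewrite /e lbr_jacobi rootvec_weight// lbrZl addrC. Qed.

Lemma ad_Hf H v : [<vsval H, f v>] = f [<vsval H, v>] - b H *: f v.
Proof.
rewrite /f lbr_jacobi rootvec_weight ?Delta_opp// lbrZl addrC.
by rewrite opp_lfunE scaleNr.
Qed.

Lemma ad_he v : h (e v) = e (h v) + 2 *: e v.
Proof. by rewrite /h ad_He coroot2. Qed.

Lemma ad_hf v : h (f v) = f (h v) - 2 *: f v.
Proof. by rewrite /h ad_Hf coroot2. Qed.

Lemma root_integral a : a \in Delta L -> exists z : int, a (coroot b) = z%:~R.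
Proof.
move=> aD; apply: (eigen_integral (ad_rootvec_locnil bD) (ad_rootvec_locnil (Delta_opp bD))
  ad_ef ad_he ad_hf _ (rootvec_neq0 aD)).
exact: rootvec_weight.
Qed.

(** The Tits lift attached to [b] carries the root vector of [a] to a nonzero vector, whose weight
    is the reflected one. *)
Lemma root_refl a : a \in Delta L -> a - a (coroot b) *: b \in Delta L.
Proof.
move=> aD; have en := ad_rootvec_locnil bD; have fn := ad_rootvec_locnil (Delta_opp bD).
have t0 := tits_neq0 en fn (rootvec_neq0 aD).
apply: weightv_neq0 t0.
  (* The reflected weight is not zero: otherwise a = a(h) b, with h the coroot of [b], and
     evaluation at h gives a(h) = 2 a(h), hence a = 0. *)
  apply/eqP => /eqP; rewrite subr_eq0 => /eqP ab.
  have := congr1 (fun c : dual_hfin L => c (coroot b)) ab.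
  rewrite scale_lfunE coroot2// /GRing.scale /= => ab2.
  have : a (coroot b) = 0 by lra.
  move=> c0; have := Delta_neq0 aD; rewrite ab c0 scale0r eqxx //.
move=> H; have te := tits_eigen en fn ad_ef ad_he ad_hf (rootvec_weight (coroot b) aD).
have := tits_conj en fn ad_ef ad_he ad_hf (ad_He H) (ad_Hf H) (rootvec a).
rewrite /= rootvec_weight// te.
have tZ c v : tits e f (c *: v) = c *: tits e f v.
  have := tits_linear en fn (c - 1) v v; rewrite -{2}[v]scale1r -scalerDl subrK => ->.
  by rewrite -{2}[tits e f v]scale1r -scalerDl subrK.
rewrite tZ => /eqP; rewrite scaleNr scalerN opprK -subr_eq => /eqP <-.
rewrite scalerA -scalerBl add_lfunE opp_lfunE scale_lfunE; congr (_ *: _).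
by rewrite /GRing.scale /= mulrC.
Qed.
End Sl2.

(** The axiom on structure constants, with both roots equal to [a], would make [x, x] = 0 a nonzero
    multiple of a root vector. *)
Lemma double_notroot a : a \in Delta L -> a *+ 2 \notin Delta L.
Proof.
move=> aD; apply/negP; rewrite mulr2n => aaD.
have [r [_ _]] := rootvec_add aD aD aaD; rewrite lbrxx => h.
have : r.+1%:R *: rootvec (a + a) = 0 :> L by case: h => /eqP; rewrite eq_sym ?oppr_eq0 => /eqP.
by move/eqP; rewrite scaler_eq0 pnatr_eq0 (negPf (rootvec_neq0 aaD)).
Qed.

(** The pairing of [a] with the coroot of n a is 2 / n and must be an integer, so only n = 2 remains
    to be excluded. *)
Lemma multiple_root n a : a \in Delta L -> a *+ n \in Delta L -> n = 1%N.
Proof.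
move=> aD naD; have [z zE] := root_integral naD aD.
have mE H : (a *+ n) H = n%:R * a H by rewrite -scaler_nat scale_lfunE.
have := coroot2 naD; rewrite mE zE => h.
have : (n%:Z * z) = 2 by apply/eqP; rewrite -(eqr_int R) rmorphM /= -pmulrn h.
move=> nz; have := congr1 absz nz; rewrite abszM /= => nz2.
have : (n <= 2)%N by rewrite dvdn_leq// -[X in (_ %| X)%N]nz2 dvdn_mulr.
case: n naD nz {mE zE h nz2} => [|[|[|//]]] naD nz _ //.
  by move: nz; rewrite mul0r.
by have := double_notroot aD; rewrite naD.
Qed.

Definition srtuple := in_tuple [seq @simpleroot R L i | i <- enum 'I_(rank L)].

Lemma srtuple_size : size [seq @simpleroot R L i | i <- enum 'I_(rank L)] = rank L.
Proof. by rewrite size_map size_enum_ord. Qed.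

Definition rcoef (i : 'I_(rank L)) a : R := coord srtuple (cast_ord (esym srtuple_size) i) a.

Lemma rcoef_linear i : linear (rcoef i : dual_hfin L -> R^o).
Proof. by move=> c u v; rewrite /rcoef linearP. Qed.
HB.instance Definition _ i := GRing.isLinear.Build R (dual_hfin L) R^o _
  (rcoef i : dual_hfin L -> R^o) (rcoef_linear i).

Lemma srtuple_nth (i : 'I_(rank L)) : srtuple`_i = simpleroot i.
Proof.
rewrite (nth_map i) ?size_enum_ord// nth_ord_enum //.
Qed.

Lemma rcoefB i a b : rcoef i (a - b) = rcoef i a - rcoef i b.
Proof. exact: linearB. Qed.

Lemma rcoefD i a b : rcoef i (a + b) = rcoef i a + rcoef i b.
Proof. exact: linearD. Qed.

Lemma rcoef_simple i j : rcoef i (simpleroot j) = (i == j)%:R.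
Proof.
rewrite /rcoef -(srtuple_nth j).
have := @coord_free _ _ _ srtuple (cast_ord (esym srtuple_size) j) (cast_ord (esym srtuple_size) i).
rewrite /= => ->; last by have /andP[] := simpleroot_basis L.
by rewrite -!val_eqE /= eq_sym.
Qed.

Lemma rcoefE a : a = \sum_i rcoef i a *: simpleroot i.
Proof.
rewrite {1}(coord_basis (simpleroot_basis L : basis_of _ srtuple) (memvf a)).
rewrite (reindex (cast_ord (esym srtuple_size))) /=; last first.
  by exists (cast_ord srtuple_size) => i _; rewrite ?cast_ordK ?cast_ordKV.
by apply: eq_bigr => i _; rewrite -srtuple_nth.
Qed.

Lemma rcoef_sum i (n : 'I_(rank L) -> nat) :
  rcoef i (\sum_j simpleroot j *+ n j) = (n i)%:R.
Proof.
rewrite linear_sum (bigD1 i)//= big1 => [|j ji]; rewrite raddfMn /= rcoef_simple.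
  by rewrite eqxx addr0.
by rewrite eq_sym (negPf ji) mul0rn.
Qed.

Lemma rcoef_eq0 a : (forall i, rcoef i a = 0) -> a = 0.
Proof. by move=> a0; rewrite (rcoefE a) big1// => i _; rewrite a0 scale0r. Qed.

Lemma posroot_Delta a : posroot a -> a \in Delta L. Proof. by case. Qed.

Lemma posroot_ge0 a i : posroot a -> 0 <= rcoef i a.
Proof. by case=> _ [n ->]; rewrite rcoef_sum. Qed.

Lemma root_sign a : a \in Delta L -> posroot a \/ posroot (- a).
Proof.
move=> aD; have [n [E|E]] := Delta_sign aD; [left|right].
  by split=> //; exists n.
by split; [exact: Delta_opp|exists n; rewrite E opprK].
Qed.

Lemma posrootN a : posroot a -> posroot (- a) -> False.
Proof.
move=> pa na; have /eqP[] := Delta_neq0 (posroot_Delta pa).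
apply: rcoef_eq0 => i; apply/eqP; rewrite eq_le (posroot_ge0 i pa) andbT.
by have := posroot_ge0 i na; rewrite linearN /= oppr_ge0.
Qed.

Lemma posroot_gt0 a i : a \in Delta L -> 0 < rcoef i a -> posroot a.
Proof.
move=> aD ai; have [//|/(posroot_ge0 i)] := root_sign aD.
by rewrite linearN /= oppr_ge0 leNgt ai.
Qed.

Lemma posroot_all_ge0 a : a \in Delta L -> (forall i, 0 <= rcoef i a) -> posroot a.
Proof.
move=> aD age; have [//|na] := root_sign aD.
have /eqP[] := Delta_neq0 aD; apply: rcoef_eq0 => i; apply/eqP; rewrite eq_le age andbT.
by have := posroot_ge0 i na; rewrite linearN /= oppr_ge0.
Qed.

Lemma simpleroot_pos i : posroot (@simpleroot R L i).
Proof.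
apply: (@posroot_gt0 _ i); first exact: simpleroot_Delta.
by rewrite rcoef_simple eqxx.
Qed.

Lemma posroot_other_coef i a : posroot a -> a != simpleroot i ->
  exists2 j, j != i & 0 < rcoef j a.
Proof.
move=> pa ai; have aD := posroot_Delta pa.
apply: contrapT => /forall2NP h; move/eqP: ai; apply.
have aE : a = rcoef i a *: simpleroot i.
  rewrite {1}(rcoefE a) (bigD1 i)//= big1 ?addr0// => j ji.
  have [//|/negP] := h j; rewrite -leNgt => aj.
  by rewrite (@le_anti _ _ (rcoef j a) 0) ?scale0r// aj posroot_ge0.
have [_ [n nE]] := pa; have := rcoef_sum i n; rewrite -nE => ni.
move: aE; rewrite ni scaler_nat => aE.
by rewrite aE (@multiple_root (n i) (simpleroot i)) ?simpleroot_Delta// -aE.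
Qed.

(** The reflection changes only the i-th coefficient; some other coefficient is positive, stays so,
    and decides the sign. *)
Lemma simple_refl_pos i a : posroot a -> a != simpleroot i ->
  posroot (a - a (coroot (simpleroot i)) *: simpleroot i).
Proof.
move=> pa ai; have aD := posroot_Delta pa; have [j ji aj] := posroot_other_coef pa ai.
apply: (@posroot_gt0 _ j); first exact: root_refl (simpleroot_Delta i) _ aD.
by rewrite linearB linearZ /= rcoef_simple (negPf ji) /GRing.scale /= mulr0 subr0.
Qed.

Local Notation a0 := (highroot L).

Lemma highroot_ge b i : b \in Delta L -> rcoef i b <= rcoef i a0.
Proof.
move=> /highrootP[n nE]; rewrite -subr_ge0.
by have := rcoef_sum i n; rewrite -nE linearB /= => ->.
Qed.

Lemma highroot_subr_ge0 b i : b \in Delta L -> 0 <= rcoef i (a0 - b).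
Proof. by move=> bD; rewrite linearB subr_ge0; exact: highroot_ge. Qed.

Lemma highroot_ge1 i : 1 <= rcoef i a0.
Proof. by rewrite (le_trans _ (highroot_ge i (simpleroot_Delta i)))// rcoef_simple eqxx. Qed.

Lemma highroot_pos : posroot a0.
Proof.
apply: posroot_all_ge0; first exact: highroot_Delta.
by move=> i; rewrite (le_trans _ (highroot_ge1 i)).
Qed.

(** With k the pairing, a - k a0 is a root, so its coefficients are bounded in absolute value by
    those of a0. Together with 0 <= a <= a0 this forces a = 0 if k <= -1 and a = a0 if k >= 2. *)
Lemma highroot_pair a : posroot a ->
  [\/ a = a0, a (coroot a0) = 0 | a (coroot a0) = 1].
Proof.
move=> pa; have aD := posroot_Delta pa.
have [k kE] := root_integral (highroot_Delta L) aD.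
have sD := root_refl (highroot_Delta L) aD; rewrite kE in sD.
have c1 := highroot_ge1.
have up i := highroot_ge i (Delta_opp sD).
have ag i := posroot_ge0 i pa; have al i := highroot_ge i aD.
have {}up i : (k%:~R - 1) * rcoef i a0 <= rcoef i a.
  have := up i; rewrite linearN linearB linearZ /= /GRing.scale /= => h; lra.
have up' i : rcoef i a <= (1 + k%:~R) * rcoef i a0.
  have := highroot_ge i sD; rewrite linearB linearZ /= /GRing.scale /= => h; lra.
rewrite kE; have {kE} : (k <= -1) || (2 <= k) || (k == 0) || (k == 1) by lia.
case/orP => [/orP[/orP[km|k2]|/eqP ->]|/eqP ->]; last 2 first.
- by apply: Or32.
- by apply: Or33.
- have km' : k%:~R <= -1 :> R by rewrite -[-1]/((-1)%:~R) ler_int.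
  have /eqP[] := Delta_neq0 aD; apply: rcoef_eq0 => i; apply/eqP; rewrite eq_le ag andbT.
  have := up' i; have := c1 i; nra.
have k2' : 2 <= k%:~R :> R by rewrite -[2]/(2%:~R) ler_int.
apply: Or31; apply/eqP; rewrite -subr_eq0; apply/eqP/rcoef_eq0 => i.
rewrite linearB /=; have := up i; have := c1 i; have := al i => h1 h2 h3.
by apply/eqP; rewrite subr_eq0 eq_le h1 /=; nra.
Qed.

End RootSystem.

(** * The affine Weyl group *)

Lemma scaleoE (R : pzRingType) (c : R) (x : R^o) : c *: x = c * x.
Proof. by []. Qed.

Lemma linfun_of_linear (K : fieldType) (aT rT : vectType K) (f : aT -> rT) :
  linear f -> linfun f =1 f.
Proof.
move=> lf x; pose g : {linear aT -> rT} := HB.pack f (GRing.isLinear.Build K aT rT _ f lf).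
exact: (lfunE g).
Qed.

Lemma lfun_subZ (R : fieldType) (V : vectType R) (f : 'Hom(V, R^o)) x c y :
  f (x - c *: y) = f x - c * f y.
Proof. by rewrite linearB [X in _ - X]linearZ. Qed.

Section AffineWeylGroup.
Variables (R : realType) (L : chevalleyAlgebra R).
Local Notation hext := (hext L).
Local Notation dual_hext := (dual_hext L).
Local Notation hform := (@hform R L).
Implicit Types (a b : dual_hfin L) (n : int) (x y : hext) (mu : dual_hext).
Implicit Types (i j : 'I_(rank L).+1) (s t : seq 'I_(rank L).+1) (w : 'End(hext)).

Lemma realrootE a n x : realroot a n x = a x.1.1 + n%:~R * x.2.
Proof.
rewrite /realroot add_lfunE /ext_root linfun_of_linear => [|c u v]; last first.
  by rewrite /= linearP.
by rewrite -scaler_int scale_lfunE /Defs.delta linfun_of_linear.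
Qed.

Lemma realroot_inj a b n m : realroot a n = realroot b m -> a = b /\ n = m.
Proof.
move=> e; split.
  apply/lfunP => H; have := congr1 (fun f : dual_hext => f (H, 0, 0)) e.
  by rewrite !realrootE /= !mulr0 !addr0.
have := congr1 (fun f : dual_hext => f (0, 0, 1)) e.
by rewrite !realrootE /= !linear0 !add0r !mulr1 => /intr_inj.
Qed.

Lemma realrootN a n : - realroot a n = realroot (- a) (- n).
Proof.
apply/lfunP => x; rewrite opp_lfunE !realrootE opp_lfunE opprD.
by rewrite rmorphN mulNr.
Qed.

(** The coroot of [a + n delta], with one formula for simple and other roots. *)
Definition rcoroot a n : hext := (coroot a, n%:~R * (rnorm a / 2), 0).

(** The invariant form on the Cartan subalgebra, in which [c] and [D] are dual isotropic
    vectors. *)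
Definition bform x y : R := hform x.1.1 y.1.1 + x.1.2 * y.2 + x.2 * y.1.2.

Lemma bformC x y : bform x y = bform y x.
Proof. by rewrite /bform hformC; ring. Qed.

Lemma bform_linear x : linear (bform x : hext -> R^o).
Proof.
move=> c u v; rewrite /bform /= linearP scaleoE.
have key (h1 h2 d e u1 u2 v1 v2 : R) : c * h1 + h2 + d * (c * u2 + v2) + e * (c * u1 + v1)
  = c * (h1 + d * u2 + e * u1) + (h2 + d * v2 + e * v1) by ring.
exact: key.
Qed.
HB.instance Definition _ x :=
  GRing.isLinear.Build R hext R^o _ (bform x : hext -> R^o) (bform_linear x).

Lemma bform_inj x y : (forall z, bform x z = bform y z) -> x = y.
Proof.
move=> e; case: x y e => [[H c] d] [[H' c'] d'] e.
have -> : H = H'.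
  by apply: hform_inj => H1; have := e (H1, 0, 0); rewrite /bform /= !mulr0 !addr0.
have := e (0, 0, 1); rewrite /bform /= !linear0 !mulr0 !addr0 !mulr1 !add0r => ->.
have := e (0, 1, 0); rewrite /bform /= !linear0 !mulr0 !mulr1 !add0r => ->.
by [].
Qed.

Lemma bform_rcoroot a n x : a \in Delta L ->
  bform x (rcoroot a n) = realroot a n x * (rnorm a / 2).
Proof.
move=> aD; rewrite /bform /= hform_coroot// mulr0 addr0 realrootE; ring.
Qed.

Lemma realroot_rcoroot a n : a \in Delta L -> realroot a n (rcoroot a n) = 2.
Proof. by move=> aD; rewrite realrootE /= mulr0 addr0 coroot2. Qed.

Definition sidx i : dual_hfin L := (aff_simple_idx i).1.
Definition sdeg i : int := (aff_simple_idx i).2.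

Lemma sidx_Delta i : sidx i \in Delta L.
Proof.
rewrite /sidx /aff_simple_idx; case: unliftP => [j _|_] /=; first exact: simpleroot_Delta.
exact/Delta_opp/highroot_Delta.
Qed.

Lemma rnorm_opp a : a \in Delta L -> rnorm (- a) = rnorm a.
Proof. by move=> aD; rewrite /rnorm coroot_opp// linearN /= [hform (- _) _]hformC linearN opprK. Qed.

Lemma aff_simplerootE i : aff_simpleroot i = realroot (sidx i) (sdeg i).
Proof. by []. Qed.

Lemma aff_simplecorootE i : aff_simplecoroot L i = rcoroot (sidx i) (sdeg i).
Proof.
rewrite /aff_simplecoroot /rcoroot /sidx /sdeg /aff_simple_idx.
case: unliftP => [j _|_] /=; first by rewrite mul0r.
rewrite coroot_opp ?highroot_Delta// dual_form_highroot rnorm_opp ?highroot_Delta//.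
by rewrite rnorm_highroot divff ?pnatr_eq0// mul1r.
Qed.

Lemma aff_reflectionE i x :
  aff_reflection i x = x - aff_simpleroot i x *: aff_simplecoroot L i.
Proof.
rewrite /aff_reflection linfun_of_linear// => c u v.
by rewrite linearP scalerBr scalerDl -addrA opprD addrACA scalerA addrA.
Qed.

Lemma aff_simpleroot_coroot i : aff_simpleroot i (aff_simplecoroot L i) = 2.
Proof. by rewrite aff_simplecorootE aff_simplerootE realroot_rcoroot// sidx_Delta. Qed.

Lemma aff_reflectionK i : involutive (aff_reflection (L := L) i).
Proof.
move=> x; rewrite !aff_reflectionE lfun_subZ aff_simpleroot_coroot.
rewrite -addrA -opprD -scalerDl; set c : R := aff_simpleroot i x.
by have -> : c + (c - c * 2) = 0 by [ring]; rewrite scale0r subr0.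
Qed.

Lemma bform_reflection i x y : bform (aff_reflection i x) (aff_reflection i y) = bform x y.
Proof.
have subZ u c v z : bform u (v - c *: z) = bform u v - c * bform u z.
  by rewrite linearB [X in _ - X]linearZ.
rewrite !aff_reflectionE subZ ![bform (_ - _) _]bformC !subZ.
rewrite !aff_simplecorootE ![bform (rcoroot _ _) _]bformC !bform_rcoroot ?sidx_Delta//.
rewrite realroot_rcoroot ?sidx_Delta// [bform y x]bformC aff_simplerootE.
have key (b p q r : R) : b - p * (q * r) - q * (p * r - p * (2 * r)) = b by ring.
exact: key.
Qed.

Lemma weyl_word_cat s t : weyl_word (s ++ t) = (weyl_word s \o weyl_word t)%VF.
Proof.
elim: s => [|i s IH] /=; first by rewrite comp_lfun1l.
by rewrite IH comp_lfunA.
Qed.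

Lemma weyl_wordK s : cancel (weyl_word s) (weyl_word (rev s)).
Proof.
move=> x; elim: s => [|i s IH] /=; first by rewrite !id_lfunE.
rewrite rev_cons -cats1 weyl_word_cat !comp_lfunE id_lfunE.
by rewrite aff_reflectionK.
Qed.

Lemma weyl_wordVK s : cancel (weyl_word (rev s)) (weyl_word s).
Proof. by move=> x; have := weyl_wordK (rev s) x; rewrite revK. Qed.

Lemma weyl_wordV s : ((weyl_word s)^-1)%VF = weyl_word (rev s).
Proof.
have k0 : lker (weyl_word s) == 0%VS by apply/lker0P/(can_inj (weyl_wordK s)).
apply/lfunP => x; rewrite -{1}(weyl_wordVK s x).
by rewrite lker0_lfunK.
Qed.

Lemma bform_word s x y : bform (weyl_word s x) (weyl_word s y) = bform x y.
Proof.
elim: s => [|i s IH] /=; first by rewrite !id_lfunE.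
by rewrite !comp_lfunE bform_reflection.
Qed.

Lemma bform_wordV s x y : bform (weyl_word s x) y = bform x (weyl_word (rev s) y).
Proof. by rewrite -{1}(weyl_wordVK s y) bform_word. Qed.

Definition wact s mu := weyl_act (weyl_word s) mu.

Lemma wactE s mu x : wact s mu x = mu (weyl_word (rev s) x).
Proof. by rewrite /wact /weyl_act comp_lfunE weyl_wordV. Qed.

Lemma wact_nil mu : wact [::] mu = mu.
Proof. by apply/lfunP => x; rewrite wactE /= id_lfunE. Qed.

Lemma wact_cat s t mu : wact (s ++ t) mu = wact s (wact t mu).
Proof. by apply/lfunP => x; rewrite !wactE rev_cat weyl_word_cat comp_lfunE. Qed.

Lemma wactN s mu : wact s (- mu) = - wact s mu.
Proof. by apply/lfunP => x; rewrite opp_lfunE !wactE opp_lfunE. Qed.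

Lemma wact1E i mu : wact [:: i] mu = mu - mu (aff_simplecoroot L i) *: aff_simpleroot i.
Proof.
apply/lfunP => x; rewrite wactE /= comp_lfunE id_lfunE aff_reflectionE.
by rewrite lfun_subZ add_lfunE opp_lfunE scale_lfunE [_ *: _]mulrC.
Qed.

Lemma wact_simple i : wact [:: i] (aff_simpleroot i) = - aff_simpleroot i.
Proof.
by rewrite wact1E aff_simpleroot_coroot scaler_nat mulr2n opprD addrA subrr add0r.
Qed.

Lemma wact1_realroot i a n : a \in Delta L -> exists z : int,
  [/\ a (coroot (sidx i)) = z%:~R, a - z%:~R *: sidx i \in Delta L &
   wact [:: i] (realroot a n) = realroot (a - z%:~R *: sidx i) (n - z * sdeg i)].
Proof.
move=> aD; have [z zE] := root_integral (sidx_Delta i) aD; exists z; split=> //.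
  by rewrite -zE; exact: root_refl (sidx_Delta i) _ aD.
apply/lfunP => x; rewrite wact1E add_lfunE opp_lfunE scale_lfunE aff_simplerootE.
rewrite aff_simplecorootE !realrootE /= add_lfunE opp_lfunE scale_lfunE zE.
rewrite /GRing.scale /= mulr0 addr0 rmorphB rmorphM /=; ring.
Qed.

Definition isreal mu := exists a n, a \in Delta L /\ mu = realroot a n.

Lemma isreal_simple i : isreal (aff_simpleroot i).
Proof. by exists (sidx i), (sdeg i); rewrite sidx_Delta. Qed.

Lemma isreal_wact s mu : isreal mu -> isreal (wact s mu).
Proof.
elim: s => [|i s IH]; first by rewrite wact_nil.
move=> /IH[a [n [aD E]]]; rewrite -cat1s wact_cat E.
by have [z [_ zD ->]] := wact1_realroot i n aD; exists (a - z%:~R *: sidx i), (n - z * sdeg i).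
Qed.

Lemma DeltaW_posP a n : DeltaW_pos L (realroot a n) <->
  posroot a /\ 0 <= n \/ posroot (- a) /\ 0 < n.
Proof.
split=> [[b [m [+ /realroot_inj[-> ->]]]] //|h].
by exists a, n.
Qed.

Lemma isreal_sign mu : isreal mu -> DeltaW_pos L mu \/ DeltaW_pos L (- mu).
Proof.
move=> [a [n [aD ->]]]; rewrite realrootN !DeltaW_posP opprK.
have [n0|n0|->] := ltgtP n 0.
- by right; rewrite oppr_ge0 oppr_gt0 n0 ltW//; case: (root_sign aD); [right|left].
- by left; case: (root_sign aD); [left|right].
- by rewrite oppr0; case: (root_sign aD) => ?; [left|right]; left.
Qed.

Lemma DeltaW_posN mu : DeltaW_pos L mu -> DeltaW_pos L (- mu) -> False.
Proof.
move=> [a [n [h ->]]]; rewrite realrootN DeltaW_posP opprK oppr_ge0 oppr_gt0.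
case: h => -[pa n0] [[pa' n0']|[pa' n0']].
- exact: posrootN pa pa'.
- by have := lt_le_trans n0' n0; rewrite ltxx.
- by have := lt_le_trans n0 n0'; rewrite ltxx.
- exact: (posrootN pa').
Qed.

Lemma aff_simpleroot_pos i : DeltaW_pos L (aff_simpleroot i).
Proof.
rewrite aff_simplerootE DeltaW_posP /sidx /sdeg /aff_simple_idx.
case: unliftP => [j _|_] /=; first by left; split=> //; exact: simpleroot_pos.
by right; rewrite opprK; split=> //; exact: highroot_pos.
Qed.

(** At a finite node [n] is unchanged and only n = 0 needs the finite root system. At the affine
    node [highroot_pair] leaves pairings of absolute value 0, 1 or 2, and the shift of [n] is
    checked in each case. *)
Lemma reflection_pos i mu : DeltaW_pos L mu -> mu <> aff_simpleroot i ->
  DeltaW_pos L (wact [:: i] mu).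
Proof.
move=> [a [n [h ->]]] ne; have aD : a \in Delta L.
  by case: h => -[/posroot_Delta] // /Delta_opp; rewrite opprK.
have [z [zE zD ->]] := wact1_realroot i n aD; rewrite DeltaW_posP.
move: zE zD ne; rewrite aff_simplerootE /sidx /sdeg /aff_simple_idx.
case: unliftP => [j _|_] /=.
  move=> zE zD ne; rewrite mulr0 subr0.
  have [n0|n0|n0] := ltgtP n 0.
  - by case: h => -[_]; [rewrite leNgt n0|move=> /(lt_trans n0); rewrite ltxx].
  - by case: (root_sign zD) => pz; [left|right].
  case: h => -[pa]; last by rewrite n0 ltxx.
  move=> _; left; split=> //; rewrite -zE; apply: simple_refl_pos => //.
  by apply/eqP => aj; apply: ne; rewrite aj n0.
rewrite coroot_opp ?highroot_Delta// linearN /= => zE zD ne.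
rewrite mulr1 scalerN opprK.
rewrite scalerN opprK in zD.
have zi (k : int) : a (coroot (highroot L)) = k%:~R -> z = - k.
  by move=> ak; apply: (@intr_inj R); rewrite -zE ak rmorphN.
case: h => -[pa n0].
  have [ah|a_0|a1] := highroot_pair pa.
  - have -> : z = - 2 by apply: (zi 2); rewrite ah coroot2// highroot_Delta.
    right; split; last by lia.
    by rewrite ah rmorphN /= scaleNr opprB -[X in _ - X]scale1r -scalerBl (_ : 2%:~R - 1 = 1) ?scale1r; [exact: highroot_pos|ring].
  - have -> : z = 0 by rewrite (zi 0 a_0) oppr0.
    by left; rewrite scale0r addr0 subr0.
  have z1 : z = - 1 by exact: (zi 1 a1).
  move: zD; rewrite z1 rmorphN /= scaleN1r => zD.
  right; split; last by lia.
  rewrite opprB; apply: posroot_all_ge0 => [|i']; first by rewrite -opprB; exact: Delta_opp.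
  exact: highroot_subr_ge0.
have aN (k : int) : (- a) (coroot (highroot L)) = k%:~R -> z = k.
  by rewrite opp_lfunE => ak; apply: (@intr_inj R); rewrite -zE ak.
have [ah|a_0|a1] := highroot_pair pa.
- have -> : z = 2 by apply: (aN 2); rewrite ah coroot2// highroot_Delta.
  have ah' : a = - highroot L by rewrite -ah opprK.
  (* The reflection lowers [n] by 2, so n = 1 would fail; that is the affine simple root itself,
     which is excluded. *)
  have n1 : n != 1 by apply/eqP => n1; apply: ne; rewrite ah' n1.
  left; split; last by lia.
  rewrite ah' -[X in X + _]scaleN1r -scalerDl (_ : -1 + 2%:~R = 1) ?scale1r; first exact: highroot_pos.
  by ring.
- have -> : z = 0 by exact: (aN 0 a_0).
  by right; rewrite scale0r addr0 subr0.
have z1 : z = 1 by exact: (aN 1 a1).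
move: zD; rewrite z1 scale1r => zD.
left; split; last by lia.
apply: posroot_all_ge0 => // i'.
by rewrite addrC -[a]opprK; apply: highroot_subr_ge0; exact: posroot_Delta.
Qed.

End AffineWeylGroup.

(** * Length, inversions, and growth along the orbit of D *)

Section WeylLength.
Variables (R : realType) (L : chevalleyAlgebra R).
Local Notation hext := (hext L).
Local Notation dual_hext := (dual_hext L).
Local Notation hform := (@hform R L).
Implicit Types (a b : dual_hfin L) (n : int) (x y : hext) (mu : dual_hext).
Implicit Types (i j : 'I_(rank L).+1) (s t u : seq 'I_(rank L).+1) (H : hfin L).

(** By invariance of [bform] the two vectors represent proportional functionals, hence are
    proportional, and the root takes the value 2 on both. So the choice of word and index made by
    [aff_coroot] does not matter. *)
Lemma wact_coroot s i a n : a \in Delta L ->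
  wact s (aff_simpleroot i) = realroot a n ->
  weyl_word s (aff_simplecoroot L i) = rcoroot a n.
Proof.
move=> aD E; set x := weyl_word s _.
have Bx y : bform x y = realroot a n y * (rnorm (sidx i) / 2).
  rewrite bform_wordV aff_simplecorootE bformC bform_rcoroot ?sidx_Delta//.
  by rewrite -E wactE.
have N0 : 0 < rnorm (sidx i) / 2 by rewrite divr_gt0// rnorm_gt0// sidx_Delta.
have M0 : 0 < rnorm a / 2 by rewrite divr_gt0// rnorm_gt0.
have ax : realroot a n x = 2.
  apply: (mulIf (lt0r_neq0 N0)); rewrite -Bx bform_word aff_simplecorootE.
  by rewrite bform_rcoroot ?sidx_Delta// realroot_rcoroot// sidx_Delta.
set q := (rnorm (sidx i) / 2) / (rnorm a / 2).
have xE : x = q *: rcoroot a n.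
  apply: bform_inj => z; rewrite Bx bformC linearZ /= [in RHS]bform_rcoroot//.
  by rewrite scaleoE /q [in RHS]mulrCA divfK ?lt0r_neq0.
rewrite xE; suff -> : q = 1 by rewrite scale1r.
move: ax; rewrite xE linearZ /= realroot_rcoroot// scaleoE => q2.
by apply: (@mulIf _ 2); rewrite ?pnatr_eq0// q2 mul1r.
Qed.

(** Reading from the right, some letter [j] turns the image of the simple root negative. By
    [reflection_pos] that image is then the j-th simple root, so the letter [j] cancels against the
    appended [i]. *)
Lemma exchange_word s i : DeltaW_pos L (- wact s (aff_simpleroot i)) ->
  exists2 t, (size t < size s)%N & weyl_word t = weyl_word (rcons s i).
Proof.
elim: s => [|j s IH].
  by rewrite wact_nil => /(DeltaW_posN (aff_simpleroot_pos i)).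
rewrite -cat1s wact_cat => neg.
have [pos|/IH[t ts tE]] := isreal_sign (isreal_wact s (isreal_simple i)); last first.
  by exists (j :: t) => //=; rewrite tE.
have sj : wact s (aff_simpleroot i) = aff_simpleroot j.
  apply: contrapT => ne; apply: DeltaW_posN neg.
  exact: reflection_pos.
exists s => //; rewrite -cats1 -catA; apply/lfunP => x.
have hE : weyl_word s (aff_simplecoroot L i) = aff_simplecoroot L j.
  by rewrite (wact_coroot (sidx_Delta j) sj) aff_simplecorootE.
have sx y : aff_simpleroot i y = aff_simpleroot j (weyl_word s y).
  by rewrite -sj wactE weyl_wordK.
rewrite !weyl_word_cat !comp_lfunE !id_lfunE.
rewrite [aff_reflection i x]aff_reflectionE linearB linearZ /= hE aff_reflectionE.
rewrite lfun_subZ aff_simpleroot_coroot sx.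
set y := weyl_word s x; set c : R := aff_simpleroot j y.
rewrite -addrA -opprD -scalerDl (_ : c + (c - c * 2) = 0); first by rewrite scale0r subr0.
by ring.
Qed.

Definition reduced_word t := forall u, weyl_word u = weyl_word t -> (size t <= size u)%N.

Lemma weyl_length_reduced w : affW L w -> exists t,
  [/\ weyl_word t = w, reduced_word t & weyl_length w = size t].
Proof.
move=> [s _ sw].
have [n [[[t tn tw] nmin] _]] : exists n : nat, ((exists2 t, size t = n & weyl_word t = w) /\
    forall t, weyl_word t = w -> (n <= size t)%N) /\ True.
  have ex : exists n : nat, `[< exists2 t, size t = n & weyl_word t = w >].
    by exists (size s); apply/asboolP; exists s.
  case: (ex_minnP ex) => n /asboolP nP nmin; exists n; split=> //; split=> //.
  by move=> t tw; apply: nmin; apply/asboolP; exists t.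
exists t; split=> //; first by move=> u; rewrite tw tn; exact: nmin.
rewrite /weyl_length; case: xgetP => [m _ /= [[t' <- t'w] mmin]|/(_ n)[]]; last first.
  by split=> //; exists t.
by apply/eqP; rewrite eqn_leq mmin// tn nmin.
Qed.

(** Induction on the last letter [i]: the i-th simple root is an inversion of a reduced word, and
    the inversions of the shorter word are obtained by reflecting the remaining ones. *)
Lemma reduced_size_le t (S : seq dual_hext) : reduced_word t ->
  (forall mu, DeltaW_pos L mu -> DeltaW_pos L (- wact t mu) -> mu \in S) ->
  (size t <= size S)%N.
Proof.
elim/last_ind: t S => // t i IH S red inv.
have redt : reduced_word t.
  move=> u uE; have := red (rcons u i); rewrite !size_rcons ltnS; apply.
  by rewrite -!cats1 !weyl_word_cat uE.
have wi mu : wact (rcons t i) mu = wact t (wact [:: i] mu) by rewrite -cats1 wact_cat.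
have ii mu : wact [:: i] (wact [:: i] mu) = mu.
  by apply/lfunP => x; rewrite !wactE weyl_wordK.
have pos : DeltaW_pos L (wact t (aff_simpleroot i)).
  have [//|/exchange_word[u ut uE]] := isreal_sign (isreal_wact t (isreal_simple i)).
  by have := red _ uE; rewrite size_rcons leqNgt (ltn_trans ut).
have iS : aff_simpleroot i \in S.
  by apply: inv; [exact: aff_simpleroot_pos|rewrite wi wact_simple wactN opprK].
rewrite size_rcons.
have := IH [seq wact [:: i] mu | mu <- rem (aff_simpleroot i) S] redt.
rewrite size_map size_rem//; case: S iS inv => // c S iS inv; apply=> mu mupos muneg.
apply/mapP; exists (wact [:: i] mu); last by rewrite ii.
have mui : mu <> aff_simpleroot i by move=> E; apply: (DeltaW_posN pos); rewrite -E.
apply: rem_mem; last by apply: inv; [exact: reflection_pos|rewrite wi ii].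
apply/eqP => E; apply: (DeltaW_posN (aff_simpleroot_pos i)).
by rewrite -wact_simple -E ii.
Qed.

(** The finite component of [w^-1 D]; all estimates are made in terms of it. *)
Definition dcomp s : hfin L := (weyl_word (rev s) (hext_D L)).1.1.

Definition rootsum H : R := \sum_(a <- Delta L) `|a H|.

Lemma rootsum_ge0 H : 0 <= rootsum H.
Proof. by rewrite sumr_ge0. Qed.

Lemma weyl_word_snd s x : (weyl_word s x).2 = x.2.
Proof.
elim: s => [|i s IH] /=; first by rewrite id_lfunE.
rewrite comp_lfunE aff_reflectionE aff_simplecorootE /= IH.
by rewrite scaleoE mulr0 subr0.
Qed.

(** The D coordinate never changes, and D is isotropic for the invariant form; isotropy of the image
    determines its central coordinate from the finite one. *)
Lemma weyl_word_D s : weyl_word (rev s) (hext_D L) =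
  (dcomp s, - (hform (dcomp s) (dcomp s) / 2), 1).
Proof.
rewrite /dcomp; set x := weyl_word _ _.
have x2 : x.2 = 1 by rewrite weyl_word_snd.
have : bform x x = 0.
  by rewrite bform_word /bform /= !linear0 mulr0 mul0r !addr0.
case: x x2 => [[H c] d] /= ->; rewrite /bform /= mulr1 mul1r => h.
by congr (_, _, _); lra.
Qed.

(** A real root [a + k delta] can change sign under [w] only if [k <= |a H|], where
    [w^-1 D] has finite component [H]. *)
Definition invlist H : seq dual_hext :=
  [seq realroot a k%:Z | a <- Delta L, k <- iota 0 (Num.truncn `|a H|).+1].

Lemma inversion_invlist s mu : DeltaW_pos L mu -> DeltaW_pos L (- wact s mu) ->
  mu \in invlist (dcomp s).
Proof.
move=> [a [n [h E]]] [a' [n' [h' E']]].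
have aD : a \in Delta L by case: h => -[/posroot_Delta] // /Delta_opp; rewrite opprK.
have n0 : 0 <= n by case: h => -[_] // /ltW.
have n0' : 0 <= n' by case: h' => -[_] // /ltW.
(* Evaluation at D reads off the coefficient of delta: n + a(H) = -n' <= 0. *)
have := congr1 (fun f : dual_hext => f (hext_D L)) E'.
rewrite opp_lfunE wactE E weyl_word_D !realrootE /= !linear0 add0r !mulr1 => an.
case: n n0 an E h => // n _ an _ _.
apply/allpairsPdep; exists a, n; split=> //; rewrite mem_iota /= add0n ltnS.
rewrite truncn_ge_nat ?normr_ge0//.
have : 0 <= n'%:~R :> R by rewrite ler0z.
rewrite -an => /= h; have := ler_norm (- a (dcomp s)); rewrite normrN.
by apply: le_trans; move: h; rewrite oppr_ge0 -lerBrDl sub0r pmulrn.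
Qed.

Lemma size_invlist H : (size (invlist H))%:R <= (size (Delta L))%:R + rootsum H.
Proof.
rewrite size_allpairs_dep sumnE big_map natr_sum /rootsum.
rewrite -sum1_size natr_sum -big_split /=; apply: ler_sum => a _.
by rewrite size_iota -addn1 natrD [leLHS]addrC lerD2l truncn_le.
Qed.

Lemma reduced_size_dcomp s : reduced_word s ->
  (size s)%:R <= (size (Delta L))%:R + rootsum (dcomp s).
Proof.
move=> red; apply: le_trans (size_invlist _); rewrite ler_nat.
by apply: reduced_size_le => // mu; exact: inversion_invlist.
Qed.

Lemma functional_bound (phi : dual_hfin L) :
  exists2 C : R, 0 <= C & forall H, `|phi H| <= C * rootsum H.
Proof.
exists (\sum_i `|rcoef i phi|); first by rewrite sumr_ge0.
move=> H; rewrite {1}(rcoefE phi) sum_lfunE mulr_suml.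
apply: le_trans (ler_norm_sum _ _ _) _; apply: ler_sum => i _.
rewrite scale_lfunE scaleoE normrM ler_wpM2l// /rootsum.
rewrite (bigD1_seq (simpleroot i)) ?simpleroot_Delta ?Delta_uniq//=.
by rewrite lerDl sumr_ge0.
Qed.

(** The inequality x <= 1 + x^2 replaces a square root. *)
Lemma hform_root_bound a H : a \in Delta L -> `|a H| <= 1 + hform H H / fnorm L.
Proof.
move=> aD; have f0 := fnorm_gt0 L.
have : (a H) ^+ 2 <= hform H H / fnorm L.
  rewrite hformE mulrAC divff ?gt_eqF// mul1r (bigD1_seq a)//= ?Delta_uniq//.
  by rewrite -expr2 lerDl sumr_ge0// => b _; rewrite -expr2 sqr_ge0.
rewrite -real_normK ?num_real//; have := normr_ge0 (a H); set x := `|a H| => x0 h.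
by apply: le_trans (lerD (lexx 1) h); nra.
Qed.

Lemma hform_abs_bound H H' (C : R) : (forall a, a \in Delta L -> `|a H| <= C) ->
  `|hform H H'| <= fnorm L * C * rootsum H'.
Proof.
move=> HC; rewrite hformE normrM gtr0_norm ?fnorm_gt0// -mulrA.
rewrite ler_pM2l ?fnorm_gt0// mulr_sumr.
apply: le_trans (ler_norm_sum _ _ _) _; rewrite big_seq [leRHS]big_seq.
by apply: ler_sum => a aD; rewrite normrM ler_wpM2r// HC.
Qed.

(** The image [y] of a simple coroot keeps its norm, so its finite part is bounded by definiteness
    of the form. Its pairing with the image of D is preserved as well, which expresses its central
    coordinate by the pairing with [dcomp s], hence linearly. *)
Lemma coroot_orbit_bound (psi : dual_hhat L) : exists2 C : R, 0 <= C & forall s i,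
  `|psi (weyl_word (rev s) (aff_simplecoroot L i)).1| <= C * (1 + rootsum (dcomp s)).
Proof.
pose phi : dual_hfin L := linfun (fun H => psi (H, 0)).
have phiE H : phi H = psi (H, 0).
  rewrite /phi linfun_of_linear// => c u v.
  rewrite -linearP; congr (psi _); congr (_, _).
  by rewrite /= scaleoE mulr0 addr0.
have [C C0 phiC] := functional_bound phi.
pose N : R := \sum_i rnorm (sidx (L := L) i).
have Ni i : rnorm (sidx i) <= N.
  rewrite /N (bigD1 i)//= lerDl sumr_ge0// => j _; exact/ltW/rnorm_gt0/sidx_Delta.
have N0 : 0 <= N by rewrite sumr_ge0// => j _; exact/ltW/rnorm_gt0/sidx_Delta.
have f0 := fnorm_gt0 L.
pose M := 1 + N / fnorm L.
have M0 : 0 <= M by rewrite addr_ge0// divr_ge0// ltW.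
have fM : 0 <= fnorm L * M by rewrite mulr_ge0// ltW.
have sM : 0 <= (size (Delta L))%:R * M by rewrite mulr_ge0.
pose k : R := `|psi (0, 1)|.
exists (C * ((size (Delta L))%:R * M) + k * (N + fnorm L * M)).
  by apply: addr_ge0; apply: mulr_ge0; rewrite /k ?normr_ge0 ?addr_ge0.
move=> s i; set y := weyl_word _ _.
have y2 : y.2 = 0 by rewrite /y weyl_word_snd aff_simplecorootE.
have byy : bform y y = rnorm (sidx i).
  rewrite /y bform_word aff_simplecorootE bform_rcoroot ?sidx_Delta//.
  by rewrite realroot_rcoroot ?sidx_Delta// mulrC divfK// pnatr_eq0.
have byD : bform y (weyl_word (rev s) (hext_D L)) = (sdeg (L := L) i)%:~R * (rnorm (sidx i) / 2).
  rewrite /y bform_word aff_simplecorootE /bform /= linear0 add0r mulr1 mul0r addr0.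
  by [].
have yyE : hform y.1.1 y.1.1 = rnorm (sidx i).
  by rewrite -byy /bform y2 mul0r mulr0 !addr0.
have yc : y.1.2 = (sdeg (L := L) i)%:~R * (rnorm (sidx i) / 2) - hform y.1.1 (dcomp s).
  by rewrite -byD weyl_word_D /bform y2 /= mulr1 mul0r addr0 addrC addKr.
have ya a : a \in Delta L -> `|a y.1.1| <= M.
  move=> aD; apply: le_trans (hform_root_bound _ aD) _.
  by rewrite yyE lerD2l ler_pM2r ?invr_gt0.
have yH : rootsum y.1.1 <= (size (Delta L))%:R * M.
  rewrite /rootsum big_seq; apply: le_trans (ler_sum _ ya) _.
  by rewrite -big_seq big_const_seq count_predT iter_addr addr0 mulr_natl.
have hyH := hform_abs_bound (dcomp s) ya.
have r0 := rootsum_ge0 (dcomp s).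
have deg1 : `|(sdeg (L := L) i)%:~R * (rnorm (sidx i) / 2)| <= N.
  have rp := rnorm_gt0 (sidx_Delta i).
  have rp2 : 0 < rnorm (sidx i) / 2 by apply: divr_gt0.
  rewrite normrM [X in _ * X]gtr0_norm//.
  have : `|(sdeg (L := L) i)%:~R| <= 1 :> R.
    by rewrite /sdeg /aff_simple_idx; case: unliftP => [j _|_] /=; rewrite ?normr0 ?normr1.
  have := Ni i; set d := `|_|; have d0 : 0 <= d by exact: normr_ge0.
  by nra.
have yE : psi y.1 = phi y.1.1 + y.1.2 * psi (0, 1).
  rewrite phiE -[y.1.2 * _]scaleoE -linearZ -linearD; congr (psi _).
  by case: (y.1) => u v /=; congr (_, _); rewrite /= ?scaler0 ?addr0 ?scaleoE ?mulr1 ?add0r.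
rewrite yE; apply: le_trans (ler_normD _ _) _.
have h1 : `|phi y.1.1| <= C * ((size (Delta L))%:R * M).
  by apply: le_trans (phiC _) _; rewrite ler_wpM2l.
have h2 : `|y.1.2| <= N + fnorm L * M * rootsum (dcomp s).
  by rewrite yc; apply: le_trans (ler_normB _ _) _; apply: lerD.
rewrite normrM -/k mulrDl; apply: lerD.
  by apply: le_trans h1 _; rewrite ler_peMr ?lerDl// mulr_ge0// mulr_ge0.
rewrite mulrC -mulrA ler_wpM2l ?normr_ge0//; apply: le_trans h2 _.
by nra.
Qed.

Definition rootsq H : R := \sum_(a <- Delta L) (a H) ^+ 2.

Lemma D_orbit_bound (psi : dual_hhat L) : psi (0, 1) < 0 ->
  exists c C : R, [/\ 0 < c, 0 <= C & forall s,
    c * rootsq (dcomp s) - C * rootsum (dcomp s) <= psi (weyl_word (rev s) (hext_D L)).1].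
Proof.
move=> k0.
pose phi : dual_hfin L := linfun (fun H => psi (H, 0)).
have phiE H : phi H = psi (H, 0).
  rewrite /phi linfun_of_linear// => c u v.
  rewrite -linearP; congr (psi _); congr (_, _).
  by rewrite /= scaleoE mulr0 addr0.
have [C C0 phiC] := functional_bound phi.
(* The factor [fnorm L / 2] converts |H|^2 / 2 into the sum of the squares of the root values. *)
exists (- psi (0, 1) * (fnorm L / 2)), C; split=> //.
  by rewrite mulr_gt0 ?oppr_gt0// divr_gt0// fnorm_gt0.
move=> s; rewrite weyl_word_D /=; set H := dcomp s; set q := - (_ / 2).
have -> : psi (H, q) = phi H + q * psi (0, 1).
  rewrite phiE -[q * _]scaleoE -linearZ -linearD; congr (psi _); congr (_, _).
    by rewrite /= scaler0 addr0.
  by rewrite /= scaleoE mulr1 add0r.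
have -> : q * psi (0, 1) = - psi (0, 1) * (fnorm L / 2) * rootsq H.
  rewrite /q hformE /rootsq; under eq_bigr do rewrite -expr2.
  by set S := \sum_(_ <- _) _; ring.
rewrite addrC lerD2r; have := phiC H; rewrite ler_norml => /andP[+ _].
by [].
Qed.

End WeylLength.

(** * Quotients of zeta values *)

Local Existing Instance summability.totally_filter.

Section Nets.
Variables (R : realType) (I : choiceType).
Implicit Types (A B : {fset I}) (f : {fset I} -> R).

Lemma near_totally (A : {fset I}) (P : {fset I} -> Prop) :
  (forall B, (A `<=` B)%fset -> P B) -> \forall B \near summability.totally, P B.
Proof. by move=> h; exists A. Qed.

Lemma nondecreasing_net_cvg f (M : R) :
  (forall A B, (A `<=` B)%fset -> f A <= f B) -> (forall A, f A <= M) ->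
  f @ summability.totally --> sup (range f).
Proof.
move=> fmono fM; have ub : has_ubound (range f) by exists M => _ [A _ <-].
have hs : has_sup (range f) by split=> //; exists (f fset0), fset0.
apply/cvgrPdist_lt => e e0; have [_ [A _ <-] fA] := sup_adherent e0 hs.
apply: (@near_totally A) => B AB; have := ub_le_sup ub (imageT f B).
have := fmono _ _ AB; rewrite ltr_norml; lra.
Qed.

Lemma nondecreasing_net_bounded f :
  (forall A B, (A `<=` B)%fset -> f A <= f B) -> cvg (f @ summability.totally) ->
  exists M, forall A, f A <= M.
Proof.
move=> fmono /cvgrPdist_lt/(_ 1 ltr01)[A _ hA]; set l := lim _ in hA.
exists (l + 1) => B; have := hA (A `|` B)%fset (fsubsetUl A B).
rewrite /= ltr_norml; have := fmono _ _ (fsubsetUr A B); lra.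
Qed.
End Nets.

Lemma ler_prod_fsubset (R : realType) (I : choiceType) (F : I -> R) (A B : {fset I}) :
  (forall i, 1 <= F i) -> (A `<=` B)%fset -> \prod_(i <- A) F i <= \prod_(i <- B) F i.
Proof.
move=> F1 AB; have -> : A = [fset i in B | i \in A]%fset.
  apply/fsetP => i; rewrite !inE /= andb_idl//.
  by move: i; apply/fsubsetP.
rewrite (big_fsetID _ (mem A) B) /=.
have P1 (J : {fset I}) : 1 <= \prod_(i <- J) F i.
  by elim/big_ind: _ => // x y x1 y1; rewrite -[1]mulr1 ler_pM.
by rewrite ler_peMr// (le_trans _ (P1 _)).
Qed.

Section Zeta.
Variables (k : finFieldType) (F : fieldExtType {fraction {poly k}}) (R : realType).
Implicit Types (nu : place F) (s : R).

Lemma valuation1 (K : fieldType) (v : K -> int) : is_valuation v -> v 1 = 0.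
Proof.
move=> vv; have := Defs.valM vv (oner_neq0 K) (oner_neq0 K).
by rewrite mulr1 -[X in X = _]addr0 => /addrI <-.
Qed.

Lemma valuationN (K : fieldType) (v : K -> int) x : is_valuation v -> x != 0 -> v (- x) = v x.
Proof.
move=> vv x0; have n0 : -1 != 0 :> K by rewrite oppr_eq0 oner_eq0.
have := Defs.valM vv n0 n0; rewrite mulrNN mulr1 (valuation1 vv) => h.
by rewrite -mulN1r (Defs.valM vv)//; lia.
Qed.

(** 0 and 1 lie in different residue classes, and the default of [get], taken if there is no finite
    system of representatives, is 0. The estimates below therefore treat the cardinalities 0 and at
    least 2. *)
Lemma residue_card_neq1 nu : residue_card nu <> 1%N.
Proof.
have vv := place_valP nu; have v1 := valuation1 vv.
rewrite /residue_card; case: xgetP => [n -> [r [_ rP]]|_ //] n1.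
move: n1 r rP => -> r rP.
have [|i0 [h0 _]] := rP 0; first by rewrite /val_ge eqxx.
have [|i1 [h1 _]] := rP 1; first by rewrite /val_ge v1 lexx orbT.
have ii : i0 = i1 by rewrite (ord1 i0) (ord1 i1).
move: h0 h1; rewrite -{}ii sub0r /val_ge; set x := r i0.
have [x0 _|x0] := eqVneq x 0.
  by rewrite x0 subr0 oner_eq0 v1.
rewrite oppr_eq0 (negPf x0) /= valuationN// => vx.
have [/eqP|x1 /= vx1] := eqVneq (1 - x) 0.
  by rewrite subr_eq0 => /eqP xE; move: vx; rewrite -xE v1.
have := Defs.valD vv x1 x0; rewrite subrK v1 oner_neq0 => /(_ isT).
by rewrite ge_min => /orP[] h; [have := le_trans vx1 h|have := le_trans vx h]; rewrite ler10.
Qed.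

Let euler nu s : R := (1 - (residue_card nu)%:R `^ (- s))^-1.
Let eprod s (A : {fset place F}) : R := \prod_(nu <- A) euler nu s.

Lemma residue_powR nu s : 0 < s ->
  0 <= (residue_card nu)%:R `^ (- s) < (1 : R).
Proof.
move=> s0; rewrite powR_ge0 /=.
case: (residue_card nu) (@residue_card_neq1 nu) => [|[|q]] // _.
  by rewrite powR0 ?ltr01// oppr_eq0 gt_eqF.
rewrite powRN invf_lt1 ?powR_gt0//.
rewrite /powR pnatr_eq0 /= -[ltLHS]expR0 ltr_expR; apply: mulr_gt0 => //.
by apply: ln_gt0; rewrite ltr1n.
Qed.

Lemma euler_ge1 nu s : 0 < s -> 1 <= euler nu s.
Proof.
by move=> /(residue_powR nu)/andP[p0 p1]; rewrite /euler invf_ge1 ?subr_gt0// lerBlDr lerDl.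
Qed.

Lemma euler_anti nu s s' : 0 < s -> s <= s' -> euler nu s' <= euler nu s.
Proof.
move=> s0 ss; have s0' := lt_le_trans s0 ss.
have /andP[p0 p1] := residue_powR nu s0; have /andP[p0' p1'] := residue_powR nu s0'.
rewrite /euler lef_pV2 ?posrE ?subr_gt0// lerD2l lerN2.
case: (residue_card nu) (@residue_card_neq1 nu) => [|[|q]] // _.
  by rewrite !powR0 ?oppr_eq0 ?gt_eqF.
by apply: ler_powR; rewrite ?lerN2// ler1n.
Qed.

Lemma eprod_mono s : 0 < s -> forall A B, (A `<=` B)%fset -> eprod s A <= eprod s B.
Proof. by move=> s0 A B; apply: ler_prod_fsubset => nu; exact: euler_ge1. Qed.

Lemma eprod_ge1 s A : 0 < s -> 1 <= eprod s A.
Proof.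
move=> s0; have := eprod_mono s0 (fsub0set A).
by rewrite {1}/eprod big_seq_fset0.
Qed.

Lemma eprod_anti s s' A : 0 < s -> s <= s' -> eprod s' A <= eprod s A.
Proof.
move=> s0 ss; apply: ler_prod => nu _; rewrite euler_anti// andbT.
by rewrite (le_trans ler01)// euler_ge1// (lt_le_trans s0).
Qed.

Lemma zeta_bounded s M : 0 < s -> (forall A, eprod s A <= M) ->
  1 <= zeta F s <= M.
Proof.
move=> s0 sM; have cv := nondecreasing_net_cvg (eprod_mono s0) sM.
rewrite /zeta (cvg_lim _ cv)//; apply/andP; split.
  apply: le_trans (eprod_ge1 fset0 s0) _; apply: ub_le_sup; last by exists fset0.
  by exists M => _ [A _ <-].
apply: ge_sup; last by move=> _ [A _ <-].
by exists (eprod s fset0), fset0.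
Qed.

(** Either the Euler product converges somewhere, or it diverges everywhere
    and [zeta] takes the same junk value at [s] and [s + 1]. *)
Lemma zeta_ratio_bounded : exists s1 M : R, forall s, s1 <= s ->
  `|zeta F s / zeta F (s + 1)| <= M.
Proof.
have [[s1 [s10 cv]]|nc] := pselect (exists s1, 0 < s1 /\ cvg (eprod s1 @ summability.totally)).
  have [M sM] := nondecreasing_net_bounded (eprod_mono s10) cv.
  exists s1, M => s ss; have s0 := lt_le_trans s10 ss.
  have M0 s' A : s1 <= s' -> eprod s' A <= M.
    by move=> h; apply: le_trans (eprod_anti _ _ h) (sM _).
  have s0' : 0 < s + 1 by rewrite addr_gt0.
  have ss' : s1 <= s + 1 by rewrite (le_trans ss)// lerDl.
  have /andP[z1 zM] := zeta_bounded s0 (fun A => M0 s A ss).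
  have /andP[z1' zM'] := zeta_bounded s0' (fun A => M0 (s + 1) A ss').
  rewrite ger0_norm ?divr_ge0 ?(le_trans ler01)//.
  rewrite ler_pdivrMr ?(lt_le_trans ltr01)//; apply: le_trans zM _.
  by rewrite ler_peMr// (le_trans ler01)// (le_trans z1').
pose p : R := @point R; exists 1, `|p / p| => s s1.
have zp s' : 0 < s' -> zeta F s' = p.
  by move=> s0'; apply: dvgP => cv; apply: nc; exists s'.
by rewrite !zp// ?addr_gt0// (lt_le_trans ltr01).
Qed.

Lemma zeta_ratio_progression (p d : R) : 0 < d -> exists M : R, forall n : nat,
  `|zeta F (p + n%:R * d) / zeta F (p + n%:R * d + 1)| <= M.
Proof.
move=> d0; have [s1 [M sM]] := zeta_ratio_bounded.
pose f n := `|zeta F (p + n%:R * d) / zeta F (p + n%:R * d + 1)|.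
(* From this index on the argument is at least [s1]; the finitely many earlier values are added to
   the bound. *)
pose N := (Num.truncn `|(s1 - p) / d|).+1.
exists (M + \sum_(n < N) f n) => n.
have M0 : 0 <= M by apply: le_trans (sM s1 (lexx _)).
have S0 : 0 <= \sum_(n < N) f n by apply: sumr_ge0 => i _; exact: normr_ge0.
have [Nn|nN] := leqP N n.
  apply: le_trans (sM _ _) _; last by rewrite lerDl.
  rewrite -lerBlDl -ler_pdivrMr//; apply: le_trans (ler_norm _) _.
  by apply: le_trans (ltW (truncnS_gt _)) _; rewrite ler_nat.
rewrite -[leLHS]/(f n) (bigD1 (Ordinal nN))//= addrCA lerDl addr_ge0//.
by apply: sumr_ge0 => i _; exact: normr_ge0.
Qed.
End Zeta.

(** The product runs over a finite subset of [D], or is 1 if the support is infinite; M >= 1 makes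
    room for both cases. *)
Lemma ler_norm_fprod (R : realType) (I : choiceType) (D : set I) (f : I -> R) (S : seq I) (M : R) :
  1 <= M -> (forall i, D i -> i \in S) -> (forall i, D i -> `|f i| <= M) ->
  `|\big[*%R/1]_(i \in D) f i| <= M ^+ size S.
Proof.
move=> M1 DS fM; case: finite_supportP => [_|X XD _ _].
  by rewrite big_nil normr1 exprn_ege1.
rewrite normr_prod; apply: le_trans (_ : M ^+ size X <= _); last first.
  by rewrite ler_weXn2l//; apply: uniq_leq_size (fset_uniq _) _ => i /XD /DS.
have -> : M ^+ size X = \prod_(i <- X) M.
  by rewrite big_const_seq count_predT iter_mulr_1.
rewrite big_seq [leRHS]big_seq.
by apply: ler_prod => i /XD /fM ->; rewrite normr_ge0.
Qed.

Section CoefBound.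
Variables (R : realType) (L : chevalleyAlgebra R).
Variables (k : finFieldType) (F : fieldExtType {fraction {poly k}}) (g : nat).

(** For a fixed finite root the values of -psi at the coroots form a progression with positive step,
    because psi is negative on the center. One constant thus bounds all factors, and [invlist]
    bounds their number. *)
Lemma c_coef_bound (chi rho : dual_hhat L) : (chi + rho) (0, 1) < 0 ->
  exists2 M : R, 1 <= M & forall t, reduced_word t ->
    `|c_coef F g chi rho (weyl_word t)| <= M ^+ (size t) * M ^+ size (invlist (dcomp t)).
Proof.
set psi := chi + rho => psi0; pose zr (s : R) : R := `|zeta F s / zeta F (s + 1)|.
have step (a : dual_hfin L) : exists M : R, a \in Delta L -> forall n : nat,
    zr (- psi (rcoroot a n%:Z).1) <= M.
  have [aD|] := boolP (a \in Delta L); last by exists 0.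
  have d0 : 0 < - psi (0, 1) * (rnorm a / 2).
    by apply: mulr_gt0; rewrite ?oppr_gt0//; apply: divr_gt0 => //; exact: rnorm_gt0.
  have [M MP] := zeta_ratio_progression F (- psi (coroot a, 0)) d0.
  exists M => _ n; have -> : - psi (rcoroot a n%:Z).1 = - psi (coroot a, 0) + n%:R * (- psi (0, 1) * (rnorm a / 2)).
    have E : (rcoroot a n%:Z).1 = (coroot a, 0) + (n%:R * (rnorm a / 2)) *: (0, 1) :> hhat L.
      by congr (_, _); rewrite /= ?scaler0 ?addr0// scaleoE mulr1 add0r.
    by rewrite E linearD linearZ /= scaleoE; ring.
  exact: MP.
pose M0 (a : dual_hfin L) : R := xget 0 [set M : R | a \in Delta L -> forall n : nat,
    zr (- psi (rcoroot a n%:Z).1) <= M].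
have M0P a : a \in Delta L -> forall n : nat,
    zr (- psi (rcoroot a n%:Z).1) <= M0 a.
  by rewrite /M0; apply: (xgetPex 0 (step a)).
(* The value at the default coroot 0 of [aff_coroot] is included in [M] too. *)
pose Z : R := `|zeta F (- psi 0) / zeta F (- psi 0 + 1)|.
pose M : R := 1 + #|k|%:R + Z + \sum_(a <- Delta L) `|M0 a|.
have Z0 : 0 <= Z by exact: normr_ge0.
have S0 : 0 <= \sum_(a <- Delta L) `|M0 a| by rewrite sumr_ge0.
have M1 : 1 <= M by rewrite /M -!addrA lerDl !addr_ge0.
exists M => // t red; rewrite /c_coef normrM; apply: ler_pM => //.
  have affWt : affW L (weyl_word t) by exists t.
  have [t' [t'E red' ->]] := weyl_length_reduced affWt.
  have -> : size t' = size t.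
    by apply/eqP; rewrite eqn_leq red'// red.
  have q1 : 1 <= #|k|%:R :> R by rewrite ler1n; apply/card_gt0P; exists 0.
  rewrite ger0_norm; last by rewrite exprz_ge0.
  (* The exponent l(w) (1 - g) is at most l(w), and the base is at least 1. *)
  apply: le_trans (_ : #|k|%:R ^+ size t <= _).
    by rewrite [leRHS]exprnP; apply: ler_weXz2l => //; nia.
  by rewrite lerXn2r ?nnegrE// ?(le_trans ler01)// /M -!addrA addrCA lerDl !addr_ge0.
apply: ler_norm_fprod => // [a [pa na]|a [[b [n [h ->]]] _]].
  by apply: inversion_invlist.
have n0 : 0 <= n by case: h => -[_] // /ltW.
have bD : b \in Delta L by case: h => -[/posroot_Delta] // /Delta_opp; rewrite opprK.
case: n n0 {h} => // n _.
rewrite /aff_coroot; case: xgetP => [x _ /= [w [i [[s _ <-] E ->]]]|_]; last first.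
  apply: le_trans (_ : Z <= M); first by [].
  by rewrite /M -addrA addrCA -addrA lerDl !addr_ge0.
rewrite (wact_coroot bD (esym E)); apply: le_trans (M0P b bD n) _.
apply: le_trans (ler_norm _) _; rewrite /M (bigD1_seq b)//= ?Delta_uniq//.
by rewrite addrCA lerDl !addr_ge0// sumr_ge0.
Qed.

End CoefBound.

(** * Estimates *)

Section Center.
Variables (R : realType) (L : chevalleyAlgebra R).

Lemma highroot_coroot : coroot (highroot L) =
  \sum_i (rcoef i (highroot L) * (2 / rnorm (simpleroot i))) *: coroot (simpleroot i).
Proof.
apply: hform_inj => H; rewrite ![hform _ H]hformC hform_coroot ?highroot_Delta//.
rewrite rnorm_highroot divff ?pnatr_eq0// mulr1 linear_sum.
rewrite {1}(rcoefE (highroot L)) sum_lfunE; apply: eq_bigr => i _.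
rewrite scale_lfunE linearZ /= hform_coroot ?simpleroot_Delta// !scaleoE.
have : rnorm (@simpleroot R L i) != 0 by rewrite gt_eqF// rnorm_gt0// simpleroot_Delta.
by move=> r0; field.
Qed.

(** In this normalization the affine simple coroot is the central element minus the highest coroot,
    and the latter is expanded in simple coroots. The [p i] are the dual Kac labels. *)
Lemma center_coroots : exists2 p : 'I_(rank L).+1 -> R, forall i, 0 < p i &
  (0, 1, 0) = \sum_i p i *: aff_simplecoroot L i :> hext L.
Proof.
pose c i := rcoef i (highroot L) * (2 / rnorm (@simpleroot R L i)).
exists (fun i => if unlift ord_max i is Some j then c j else 1).
  move=> i; case: unliftP => // j _; rewrite mulr_gt0 ?(lt_le_trans ltr01 (highroot_ge1 _))//.
  by apply: divr_gt0 => //; exact/rnorm_gt0/simpleroot_Delta.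
rewrite big_ord_recr /= unlift_none scale1r /aff_simplecoroot unlift_none.
rewrite dual_form_highroot divff ?pnatr_eq0// highroot_coroot.
have E i : unlift ord_max (widen_ord (leqnSn (rank L)) i) = Some i.
  have -> : widen_ord (leqnSn (rank L)) i = lift ord_max i.
    by apply: val_inj; rewrite /= /bump leqNgt ltn_ord.
  by rewrite liftK.
under eq_bigr do rewrite E.
have -> : \sum_(i < rank L) c i *: ((coroot (simpleroot i), 0, 0) : hext L) =
    (\sum_(i < rank L) c i *: coroot (simpleroot i), 0, 0).
  elim/big_rec2: _ => // i x y _ ->; congr (_, _, _); rewrite /= ?scaler0 ?add0r//.
by congr (_, _, _); rewrite /= ?add0r// subrr.
Qed.

End Center.

Section RealEstimates.
Variable R : realType.

Lemma powR_bound (r x b : R) : 0 <= r -> `|ln r| <= b -> r `^ x <= expR (b * `|x|).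
Proof.
move=> r0 lb; have b0 : 0 <= b by apply: le_trans lb.
(* A zero base gives 0 or 1, while the bound is at least 1. *)
rewrite /powR; case: ifP => _.
  case: (x == 0) => /=; last by rewrite expR_ge0.
  by rewrite -[leLHS]expR0 ler_expR mulr_ge0.
rewrite ler_expR mulrC; apply: le_trans (ler_norm _) _; rewrite normrM.
by rewrite ler_wpM2r.
Qed.

(** Where the residue cardinality is positive the factors agree; where it is the default 0, the
    factor is 0 or 1 against exp(0), whence an inequality. *)
Lemma place_prod_bound (F : fieldType) (m : place F -> int) (x : R) :
  finite_set [set nu | m nu != 0] ->
  0 <= \big[*%R/1]_(nu \in [set: place F])
      (((residue_card nu)%:R^-1 : R) `^ ((m nu)%:~R * x))
    <= expR (- (x * \sum_(nu \in [set: place F]) ln ((residue_card nu)%:R : R) * (m nu)%:~R)).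
Proof.
move=> mf; pose S := fset_set [set nu | m nu != 0].
have notS nu : nu \notin S -> m nu = 0.
  by rewrite in_fset_set// mem_setE /= negbK => /eqP.
rewrite (fsbigTE S) => [|nu /notS ->]; last by rewrite mul0r powRr0.
rewrite (fsbigTE S) => [|nu /notS ->]; last by rewrite mulr0.
rewrite mulr_sumr -sumrN; apply/andP; split.
  by rewrite prodr_ge0// => nu _; exact: powR_ge0.
have -> : expR (\sum_(nu <- S) - (x * (ln (residue_card nu)%:R * (m nu)%:~R))) =
    \prod_(nu <- S) expR (- (x * (ln (residue_card nu)%:R * (m nu)%:~R))).
  by elim/big_rec2: _ => [|nu y z _ <-]; rewrite ?expR0 ?expRD.
apply: ler_prod => nu _; rewrite powR_ge0 /=.
have [q0|q0] := eqVneq (residue_card nu) 0%N.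
  rewrite q0 invr0 ln0// mul0r mulr0 oppr0 expR0 /powR eqxx.
  by case: (_ == _).
have qp : 0 < (residue_card nu)%:R :> R by rewrite ltr0n lt0n.
rewrite /powR invr_eq0 gt_eqF// lnV ?posrE// ler_expR.
by rewrite le_eqVlt; apply/orP; left; apply/eqP; ring.
Qed.

End RealEstimates.

Section Quadratic.
Variables (R : realType) (L : chevalleyAlgebra R).

(** The square is completed for each root value separately: K y - c y^2 <= K^2 / (4 c). *)
Lemma quadratic_bound (K c : R) (H : hfin L) : 0 < c ->
  K * rootsum H - c * rootsq H <= (size (Delta L))%:R * (K ^+ 2 / (4 * c)).
Proof.
move=> c0; rewrite /rootsum /rootsq !mulr_sumr -sumrB -sum1_size natr_sum mulr_suml.
apply: ler_sum => a _; rewrite mul1r -(real_normK (num_real (a H))).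
set y := `|_|; rewrite -subr_ge0.
have -> : K ^+ 2 / (4 * c) - (K * y - c * y ^+ 2) = (K - 2 * c * y) ^+ 2 / (4 * c).
  by field; rewrite gt_eqF.
by rewrite divr_ge0 ?sqr_ge0// mulr_ge0// ltW.
Qed.
End Quadratic.

Section Words.
Variables (R : realType) (I : finType).

(** Grouping by length compares the sum with a geometric series of ratio 1/2. *)
Lemma words_sum_bound (r : R) (X : seq (seq I)) : uniq X ->
  0 <= r -> #|I|%:R * r <= 2^-1 -> \sum_(x <- X) r ^+ size x <= 2.
Proof.
move=> uX r0 rI; pose N := (\max_(x <- X) size x).+1.
have count n : (size [seq x <- X | size x == n] <= #|I| ^ n)%N.
  rewrite -card_tuple cardE -(size_map val); apply: uniq_leq_size.
    exact: filter_uniq.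
  move=> x; rewrite mem_filter => /andP[xn _]; apply/mapP.
  by exists (Tuple xn) => //; rewrite mem_enum.
have -> : \sum_(x <- X) r ^+ size x = \sum_(n < N) \sum_(x <- X | size x == n) r ^+ size x.
  rewrite (exchange_big_dep xpredT) //= big_seq [RHS]big_seq; apply: eq_bigr => x xX.
  have xN : (size x < N)%N by rewrite ltnS leq_bigmax_seq.
  by rewrite (big_pred1 (Ordinal xN)).
apply: le_trans (_ : \sum_(n < N) (2^-1) ^+ n <= 2).
  apply: ler_sum => n _; rewrite (eq_bigr (fun=> r ^+ n)) => [|x /eqP -> //].
  rewrite -big_filter big_const_seq count_predT iter_addr addr0.
  apply: le_trans (_ : (#|I|%:R * r) ^+ n <= _).
    rewrite exprMn -[leLHS]mulr_natl -natrX ler_wpM2r ?exprn_ge0// ler_nat; exact: count.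
  by rewrite lerXn2r ?nnegrE ?mulr_ge0// invr_ge0.
have h : (1 - 2^-1) * \sum_(n < N) 2^-1 ^+ n = 1 - 2^-1 ^+ N :> R.
  rewrite -opprB mulNr -subrX1 opprB //.
have p : 0 <= 2^-1 ^+ N :> R by rewrite exprn_ge0// invr_ge0.
lra.
Qed.

End Words.

(** * The Weierstrass test over finite subsets *)

Section MTest.
Variables (R : realType) (I : choiceType) (T : topologicalType).
Variables (f : I -> T -> R) (a : I -> R) (C : set T) (M : R).
Hypothesis fa : forall i h, C h -> `|f i h| <= a i.
Hypothesis aM : forall A : {fset I}, \sum_(i <- A) a i <= M.

Lemma mtest_summable h : C h -> summable [set: I] (fun i => (f i h)%:E).
Proof.
move=> Ch; rewrite /summable; apply: le_lt_trans (_ : (M%:E < +oo)%E); last exact: ltry.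
rewrite /esum; apply: ge_ereal_sup => _ [A [fA _] <-].
rewrite fsbig_finite//= sumEFin lee_fin.
apply: le_trans (aM (fset_set A)); apply: ler_sum => i _; exact: fa.
Qed.

(** For nonnegative terms the partial sums are a monotone net with their supremum as limit, and the
    majorant leaves at most [e] outside [A] at every point, so the error is uniform in [h]. *)
Lemma mtest_part (P : I -> T -> R) : (forall i h, C h -> 0 <= P i h <= a i) ->
  (forall i, 0 <= a i) ->
  forall h, C h -> forall (A : {fset I}) e,
  (forall B : {fset I}, \sum_(i <- B) a i <= \sum_(i <- A) a i + e) ->
  forall B, (A `<=` B)%fset ->
  let S := sup (range (fun B : {fset I} => \sum_(i <- B) P i h)) in
  \sum_(i <- B) P i h <= S <= \sum_(i <- B) P i h + e.
Proof.
move=> Pa a0 h Ch A e tail B AB /=; set G := fun B : {fset I} => _.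
have G0 (X Y : {fset I}) : (X `<=` Y)%fset -> G X <= G Y /\
    G Y - G X <= \sum_(i <- Y) a i - \sum_(i <- X) a i.
  move=> XY; have XE : X = [fset i in Y | i \in X]%fset.
    apply/fsetP => i; rewrite !inE /= andb_idl//.
    by move: i; apply/fsubsetP.
  rewrite /G (big_fsetID _ (mem X) Y) [in \sum_(i <- Y) a i](big_fsetID _ (mem X) Y) /= -XE.
  split.
    by rewrite lerDl sumr_ge0// => i _; case/andP: (Pa i h Ch).
  rewrite [X in X <= _]addrC addKr [X in _ <= X]addrC addKr.
  by apply: ler_sum => i _; case/andP: (Pa i h Ch).
have ub : has_ubound (range G).
  exists (\sum_(i <- A) a i + e) => _ [X _ <-]; apply: le_trans (tail X).
  by apply: ler_sum => i _; case/andP: (Pa i h Ch).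
apply/andP; split; first by apply: ub_le_sup => //; exists B.
apply: ge_sup; first by exists (G fset0), fset0.
move=> _ [X _ <-].
have [_ h1] := G0 _ _ (fsubsetUl B X); have [h2 _] := G0 _ _ (fsubsetUr B X).
have := tail (B `|` X)%fset.
have : \sum_(i <- A) a i <= \sum_(i <- B) a i.
  have AE : A = [fset i in B | i \in A]%fset.
    apply/fsetP => i; rewrite !inE /= andb_idl//.
    by move: i; apply/fsubsetP.
  by rewrite (big_fsetID _ (mem A) B) /= -AE lerDl sumr_ge0.
rewrite -/(G B); lra.
Qed.

Lemma mtest_uniform : (forall i, 0 <= a i) -> exists S : T -> R,
  {uniform C, (fun (A : {fset I}) h => \sum_(i <- A) f i h) @ summability.totally --> S}.
Proof.
move=> a0.
(* Positive and negative parts reduce the signed series to two monotone nets. *)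
pose fp i h : R := Num.max (f i h) 0; pose fn i h : R := Num.max (- f i h) 0.
have fpa i h : C h -> 0 <= fp i h <= a i.
  move=> /(fa i); rewrite ler_norml /fp => /andP[_ h1].
  by rewrite le_max lexx orbT ge_max h1 a0.
have fna i h : C h -> 0 <= fn i h <= a i.
  move=> /(fa i); rewrite ler_norml /fn => /andP[h1 _].
  by rewrite le_max lexx orbT ge_max lerNl h1 a0.
have fE i h : f i h = fp i h - fn i h.
  rewrite /fp /fn; have [h1|h1] := leP (f i h) 0.
    by rewrite max_l ?oppr_ge0// sub0r opprK.
  by rewrite max_r ?oppr_le0 ?ltW// subr0.
pose S (P : I -> T -> R) h := sup (range (fun B : {fset I} => \sum_(i <- B) P i h)).
exists (fun h => S fp h - S fn h) => P /uniform_nbhs[E [entE EP]].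
move: entE; rewrite -entourage_ballE => -[e /= e0 eE].
pose G (A : {fset I}) : R := \sum_(i <- A) a i.
have hs : has_sup (range G).
  by split; [exists (G fset0), fset0|exists M => _ [A _ <-]; exact: aM].
have e4 : 0 < e / 4 by rewrite divr_gt0.
have [_ [A _ <-] GA] := sup_adherent e4 hs.
have tail (B : {fset I}) : \sum_(i <- B) a i <= \sum_(i <- A) a i + e / 4.
  have : G B <= sup (range G) by apply: sup_upper_bound => //; exists B.
  by move: GA; rewrite /G; lra.
exists A => // B AB; apply: EP => h Ch; apply: eE; rewrite /ball /=.
have /andP[p1 p2] := mtest_part fpa a0 Ch tail AB.
have /andP[n1 n2] := mtest_part fna a0 Ch tail AB.
have -> : \sum_(i <- B) f i h = \sum_(i <- B) fp i h - \sum_(i <- B) fn i h.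
  by rewrite -sumrB; apply: eq_bigr.
rewrite ltr_norml -/(S fp h) -/(S fn h) in p1 p2 n1 n2 *; lra.
Qed.
End MTest.

(** * Integrability of the highest weight module *)

Section AffineBracket.
Variables (R : realType) (L : chevalleyAlgebra R).
Local Notation "[< x , y >]" := (@lbr R L x y) (at level 0, x, y at level 99).
Local Notation form := (@Defs.form R L).
Local Notation affine := (affine L).
Implicit Types (x y z : L) (n m : int) (X Y : affine) (H : hext L).

Definition mon n x : affine := (monomial n x, 0, 0).

Lemma loopP_eq (u v : loop L) : (forall k, u k = v k) -> u = v.
Proof. by move=> uv; apply/val_inj/funext. Qed.

Lemma monomialE n x k : monomial n x k = if k == n then x else 0.
Proof. by []. Qed.

Lemma monomialP n c x y : monomial n (c *: x + y) = c *: monomial n x + monomial n y.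
Proof.
apply: loopP_eq => k; rewrite -[RHS]/(c *: (monomial n x k) + monomial n y k) !monomialE.
by case: ifP => //; rewrite scaler0 addr0.
Qed.

Lemma monomial0 n : monomial n (0 : L) = 0.
Proof. by apply: loopP_eq => k /=; case: ifP. Qed.

Lemma monomialZ n c x : monomial n (c *: x) = c *: monomial n x.
Proof. by rewrite -[c *: x]addr0 monomialP monomial0 addr0. Qed.

Lemma monomialD n x y : monomial n (x + y) = monomial n x + monomial n y.
Proof. by rewrite -[x]scale1r monomialP !scale1r. Qed.

Lemma fsbig_int1 (W : zmodType) (f : int -> W) n : (forall i, i != n -> f i = 0) ->
  \sum_(i \in [set: int]) f i = f n.
Proof.
move=> f0; rewrite (fsbigTE [fset n]%fset) ?big_seq_fset1// => i.
by rewrite inE; exact: f0.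
Qed.

Lemma aff_br_mon n x m y (a b a' b' : R) :
  aff_br ((monomial n x, a, b) : affine) (monomial m y, a', b') =
  (monomial (n + m) [<x, y>] + (b * m%:~R) *: monomial m y - (b' * n%:~R) *: monomial n x,
   if n + m == 0 then n%:~R * form x y else 0, 0).
Proof.
have l0 z : [<z, 0>] = 0 by rewrite linear0.
congr (_, _, _).
  apply: loopP_eq => k.
  rewrite -[RHS]/(monomial (n + m) [<x, y>] k + (b * m%:~R) *: monomial m y k
    - (b' * n%:~R) *: monomial n x k).
  rewrite -[LHS]/(aff_br_fun _ _ k) /aff_br_fun /=.
  rewrite (@fsbig_int1 _ _ n) => [|i /negPf in_]; last by rewrite in_ lbr0l.
  rewrite eqxx (_ : (k - n == m) = (k == n + m)); last by rewrite subr_eq addrC.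
  congr (_ + _ - _).
  - by case: ifP.
  - by case: eqP => [->|]; rewrite ?scaler0.
  - by case: eqP => [->|]; rewrite ?scaler0.
rewrite /= (@fsbig_int1 _ _ n) => [|i /negPf in_]; last first.
  by rewrite /= in_ formC linear0 mulr0.
rewrite /= eqxx.
rewrite (_ : (- n == m) = (n + m == 0)); last by rewrite addrC addr_eq0 eq_sym.
by case: ifP => //; rewrite linear0 mulr0.
Qed.

Lemma mon_br n x m y : aff_br (mon n x) (mon m y) =
  (monomial (n + m) [<x, y>], if n + m == 0 then n%:~R * form x y else 0, 0).
Proof. by rewrite aff_br_mon !mul0r !scale0r addr0 subr0. Qed.

Lemma form_weight a b x y : weightv a x -> weightv b y -> a + b != 0 -> form x y = 0.
Proof.
move=> wx wy /lfun_neq0P[H abH]; rewrite form_killing.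
have : (a + b) H * killing (@lbr R L) x y = 0.
  have := killing_invariant (vsval H) x y; rewrite wx killingC linearZ /= => e1.
  have := killing_invariant x (vsval H) y; rewrite wy linearZ /= lbrC wx => e2.
  have := linearN (killing (@lbr R L) y) (a H *: x) => e3.
  rewrite killingC e3 linearZ /= in e2.
  rewrite add_lfunE mulrDl; rewrite -[b H * _]/(b H *: (killing (@lbr R L) x y : R^o)) -e2.
  by rewrite (killingC y x) scaleoE subrr.
by move/eqP; rewrite mulf_eq0 (negPf abH) => /eqP ->; rewrite mulr0.
Qed.

Lemma weightv_cartan (H : hfin L) : weightv 0 (vsval H : L).
Proof. by move=> H'; rewrite cartan_abelian zero_lfunE scale0r. Qed.

Lemma cartan_br H b n x : weightv b x ->
  aff_br (aff_cartan H) (mon n x) = realroot b n H *: mon n x.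
Proof.
move=> wx; rewrite /aff_cartan aff_br_mon [X in X *: monomial 0 _]mul0r scale0r subr0 wx add0r.
congr (_, _, _); last by rewrite /= scaler0.
  by rewrite ?add0r monomialZ -scalerDl realrootE [_ * H.2]mulrC.
by rewrite [0%:~R * _]mul0r if_same /= scaler0.
Qed.

Lemma affine_decomp X : exists2 S : seq int, X = \sum_(n <- S) mon n (X.1.1 n) + (0, X.1.2, X.2) &
  forall n, X.1.1 n != 0 -> n \in S.
Proof.
case: X => [[u a] b] /=; have /asboolP fu := loopP u.
pose S := fset_set [set n | u n != 0].
have uS n : u n != 0 -> n \in S by move=> un; rewrite in_fset_set// inE.
exists S => //.
have -> : \sum_(n <- S) mon n (u n) = (\sum_(n <- S) monomial n (u n), 0, 0).
  by elim/big_rec2: _ => // i y z _ ->; congr (_, _, _); rewrite /= ?addr0.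
congr (_, _, _); rewrite /= ?add0r// addr0; apply: loopP_eq => k.
have -> : forall s, (\sum_(n <- s) monomial n (u n)) k = \sum_(n <- s) monomial n (u n) k.
  by elim=> [|i s IH]; rewrite ?big_nil// !big_cons -IH.
have [kS|kS] := boolP (k \in S).
  rewrite (bigD1_seq k kS (fset_uniq _)) /= eqxx big1 ?addr0// => i ik.
  by rewrite eq_sym (negPf ik).
rewrite big_seq big1; last first.
  by move=> i iS /=; case: eqP => // ki; move: iS kS; rewrite -ki => ->.
by apply/eqP; apply: contraNT kS => /uS.
Qed.

(** The central element and D are covered by the last case, as members of the extended Cartan
    subalgebra. *)
Lemma affine_ind (P : affine -> Prop) :
  P 0 -> (forall c X Y, P X -> P Y -> P (c *: X + Y)) ->
  (forall b n, b \in Delta L -> P (xi b n)) ->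
  (forall n (H : hfin L), n != 0 -> P (mon n (vsval H))) ->
  (forall H, P (aff_cartan H)) -> forall X, P X.
Proof.
move=> P0 PD Proot Pim Pcart X; have [S -> _] := affine_decomp X.
have PA Y Z : P Y -> P Z -> P (Y + Z) by rewrite -{2}[Y]scale1r; exact: PD.
have monD n x y : mon n (x + y) = mon n x + mon n y.
  by congr (_, _, _); rewrite ?addr0// monomialD.
have monZ n c x : mon n (c *: x) = c *: mon n x.
  by congr (_, _, _); rewrite /= ?scaler0// monomialZ.
have mon0 n : mon n 0 = 0 by have := monZ n 0 0; rewrite !scale0r.
apply: (PA); last first.
  have := Pcart (0, X.1.2, X.2); by rewrite /aff_cartan /= monomial0.
elim: S => [|n S IH]; first by rewrite big_nil.
rewrite big_cons; apply: (PA) => //; have [H [d ->]] := chev_decomp (X.1.1 n).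
rewrite monD; apply: (PA).
  have [->|n0] := eqVneq n 0; last exact: Pim.
  exact: (Pcart (H, 0, 0)).
rewrite big_seq; elim/big_ind: _ => [|x y Px Py|b bD]; first by rewrite mon0.
  by rewrite monD; exact: (PA).
by rewrite monZ -[_ *: _]addr0; apply: PD => //; exact: Proot.
Qed.

End AffineBracket.

Section HighestWeight.
Variables (R : realType) (L : chevalleyAlgebra R) (lam : dual_hext L) (V : hwModule lam).
Local Notation "[< x , y >]" := (@lbr R L x y) (at level 0, x, y at level 99).
Local Notation form := (@Defs.form R L).
Local Notation affine := (affine L).
Implicit Types (x y z : L) (n m : int) (X Y : affine) (H : hext L) (v : V).

Local Notation act := (@hwact R L lam V).
HB.instance Definition _ X := GRing.isLinear.Build R V V _ (act X) (@hwact_linr R L lam V X).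

Definition ract v X := act X v.
HB.instance Definition _ v := GRing.isLinear.Build R affine V _ (ract v) (@hwact_linl R L lam V v).
Lemma ractE X v : act X v = ract v X. Proof. by []. Qed.

Lemma act_comm X Y v : act X (act Y v) = act Y (act X v) + act (aff_br X Y) v.
Proof. by rewrite hwact_br addrC subrK. Qed.

Section RealRoot.
Variables (a : dual_hfin L) (n : int).
Hypothesis aD : a \in Delta L.

Lemma xi_br : aff_br (xi a n) (xi (- a) (- n)) = aff_cartan (rcoroot a n).
Proof.
by rewrite mon_br rootvec_opp// subrr eqxx form_rootvec.
Qed.

Lemma act_cartan_weight b m x H v : weightv b x ->
  act (aff_cartan H) (act (mon m x) v) =
  act (mon m x) (act (aff_cartan H) v) + realroot b m H *: act (mon m x) v.
Proof. by move=> wx; rewrite act_comm (cartan_br H m wx) [act (_ *: _) v]ractE linearZ. Qed.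

Lemma act_He H v : act (aff_cartan H) (act (xi a n) v) =
  act (xi a n) (act (aff_cartan H) v) + realroot a n H *: act (xi a n) v.
Proof. by apply: act_cartan_weight; exact: weightv_rootvec. Qed.

Lemma act_Hf H v : act (aff_cartan H) (act (xi (- a) (- n)) v) =
  act (xi (- a) (- n)) (act (aff_cartan H) v) - realroot a n H *: act (xi (- a) (- n)) v.
Proof.
rewrite (act_cartan_weight (b := - a)) -?realrootN ?opp_lfunE ?scaleNr//.
exact/weightv_rootvec/Delta_opp.
Qed.

Lemma act_ef v : act (xi a n) (act (xi (- a) (- n)) v) =
  act (xi (- a) (- n)) (act (xi a n) v) + act (aff_cartan (rcoroot a n)) v.
Proof. by rewrite act_comm xi_br. Qed.

Lemma act_he v : act (aff_cartan (rcoroot a n)) (act (xi a n) v) =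
  act (xi a n) (act (aff_cartan (rcoroot a n)) v) + 2 *: act (xi a n) v.
Proof. by rewrite act_He realroot_rcoroot. Qed.

Lemma act_hf v : act (aff_cartan (rcoroot a n)) (act (xi (- a) (- n)) v) =
  act (xi (- a) (- n)) (act (aff_cartan (rcoroot a n)) v) - 2 *: act (xi (- a) (- n)) v.
Proof. by rewrite act_Hf realroot_rcoroot. Qed.

(** By the Leibniz rule e^(N + K) X v consists of terms (ad e)^i X e^j v with i + j = N + K, so i >=
    K or j >= N. Induction on N + K avoids the coefficients. *)
Lemma locnil_comm (X : affine) (K : nat) v N :
  iter K (aff_br (xi a n)) X = 0 -> iter N (act (xi a n)) v = 0 ->
  iter (N + K) (act (xi a n)) (act X v) = 0.
Proof.
move s : (N + K)%N => t; elim: t N K X v s => [|t IH] N K X v s.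
  have [-> ->] : N = 0%N /\ K = 0%N by lia.
  by move=> /= _ ->; rewrite linear0.
move=> XK vN.
case: K XK s => [/= -> _|K XK s]; first by rewrite (ractE 0) !linear0.
case: N vN s => [/= -> _|N vN s]; first by rewrite !linear0.
rewrite iterSr act_comm linearD /= (IH N K.+1) ?add0r//; last 2 first.
- by lia.
- by rewrite -iterSr.
apply: (IH N.+1 K) => //; first by lia.
by rewrite -iterSr.
Qed.

Lemma iter_br_mon m x K : exists c : R, iter K (aff_br (xi a n)) (mon m x) =
  (monomial (m + n *+ K) (iter K (@lbr R L (rootvec a)) x), c, 0).
Proof.
elim: K => [|K [c IH]]; first by exists 0; rewrite mulr0n addr0.
eexists; rewrite !iterS IH /xi aff_br_mon !mul0r !scale0r addr0 subr0.
by congr (monomial _ _, _, _); rewrite mulrSr; lia.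
Qed.

Lemma br_central c : aff_br (xi a n) ((0, c, 0) : affine) = 0.
Proof.
have -> : ((0, c, 0) : affine) = (monomial 0 0, c, 0) by rewrite monomial0.
have l0 : [<rootvec a, 0>] = 0 by rewrite linear0.
have f0 : form (rootvec a) 0 = 0 by rewrite linear0.
rewrite /xi aff_br_mon l0 f0 [n%:~R * 0]mulr0 if_same !mul0r !scale0r.
by congr (_, _, _); rewrite monomial0 addr0 subr0.
Qed.

Definition nilact v := exists N, iter N (act (xi a n)) v = 0.

Lemma nilact_comb c u v : nilact u -> nilact v -> nilact (c *: u + v).
Proof.
move=> [M uM] [N vN]; exists (maxn M N).
rewrite linearP /= (iter_nil_ge uM) ?leq_maxl// (iter_nil_ge vN) ?leq_maxr//.
by rewrite scaler0 addr0.
Qed.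

Lemma nilact_act X v : nilact v -> nilact (act X v).
Proof.
move: X v; apply: affine_ind => [v _|c X Y PX PY v vn|b m bD v [N vN]|m H m0 v [N vN]|H v [N vN]].
- by exists 0%N; rewrite /= (ractE 0) linear0.
- by rewrite ractE linearP; apply: nilact_comb; [exact: PX|exact: PY].
- have [K aK] := ad_rootvec_locnil aD (rootvec b).
  have [c cE] := iter_br_mon m (rootvec b) K.
  (* The first K brackets may leave a central element, which one more bracket kills. *)
  exists (N + K.+1)%N; apply: locnil_comm => //; rewrite iterS cE aK.
  by rewrite monomial0 br_central.
- have [K aK] := ad_rootvec_locnil aD (vsval H).
  have [c cE] := iter_br_mon m (vsval H) K.
  exists (N + K.+1)%N; apply: locnil_comm => //; rewrite iterS cE aK.
  by rewrite monomial0 br_central.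
exists N; elim: N v vN => [|N IH] v; first by move=> /= ->; rewrite linear0.
rewrite !iterSr => vN.
have -> : act (xi a n) (act (aff_cartan H) v) =
    (- realroot a n H) *: act (xi a n) v + act (aff_cartan H) (act (xi a n) v).
  by rewrite act_He addrCA scaleNr addNr addr0.
by rewrite linearP /= vN scaler0 add0r IH.
Qed.

(** The vectors on which [xi a n] acts nilpotently form a submodule. *)
Lemma act_locnil v : v != 0 -> nilact v -> locnil (act (xi a n)).
Proof.
move=> v0 vn u.
have [] := @hwact_irr R L lam V [set w | nilact w].
- by exists 0%N.
- by move=> c x y; exact: nilact_comb.
- by move=> X w; exact: nilact_act.
- move=> /seteqP[/(_ v vn) /= /eqP]; by rewrite (negPf v0).
by move=> /seteqP[_ /(_ u)]; apply.
Qed.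

End RealRoot.
End HighestWeight.

Section Singular.
Variables (R : realType) (L : chevalleyAlgebra R) (lam : dual_hext L) (V : hwModule lam).
Local Notation "[< x , y >]" := (@lbr R L x y) (at level 0, x, y at level 99).
Local Notation affine := (affine L).
Local Notation act := (@hwact R L lam V).
Local Notation hwv := (@hwvec R L lam V).
Implicit Types (a b : dual_hfin L) (n k : int) (X Y Z : affine) (v : V).

Lemma hwvec_posroot b k : DeltaW_pos L (realroot b k) -> act (xi b k) hwv = 0.
Proof.
move=> /DeltaW_posP[[pb]|[_ k0]]; last exact: hwvec_pos.
by rewrite le_eqVlt => /predU1P[ <-|k0]; [exact: hwvec_simple|exact: hwvec_pos].
Qed.

(** The real and imaginary positive root vectors, without the [i]-th simple one; closed under
    bracketing with the [i]-th negative simple root vector. *)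
Definition raising (i : 'I_(rank L).+1) Z :=
  (exists c b k, [/\ b \in Delta L, DeltaW_pos L (realroot b k),
     realroot b k <> aff_simpleroot i & Z = mon k (c *: rootvec b)]) \/
  (exists k (H : hfin L), 0 < k /\ Z = mon k (vsval H)).

Lemma simpleroot_shift (i : 'I_(rank L).+1) k : DeltaW_pos L (realroot (sidx i) k) ->
  k <> sdeg i -> 0 < k - sdeg i.
Proof.
rewrite DeltaW_posP /sidx /sdeg /aff_simple_idx; case: unliftP => [j _|_] /= h kn.
  case: h => -[pa k0]; first by lia.
  by case: (posrootN (simpleroot_pos j) pa).
by case: h => -[pa k0]; [case: (posrootN (highroot_pos L) pa)|lia].
Qed.

Lemma pos_sub_simple i b k : b \in Delta L -> DeltaW_pos L (realroot b k) ->
  realroot b k <> aff_simpleroot i -> b - sidx i \in Delta L ->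
  DeltaW_pos L (realroot (b - sidx i) (k - sdeg i)).
Proof.
rewrite !DeltaW_posP aff_simplerootE /sidx /sdeg /aff_simple_idx => bD.
case: unliftP => [j _|_] /=.
  rewrite subr0 => h ne bsD; have [k0|k0|k0] := ltgtP k 0.
  - by case: h => -[_ h]; lia.
  - by case: (root_sign bsD) => p; [left|right].
  case: h => -[pb h]; last by lia.
  have bj : b != simpleroot j by apply/eqP => bj; apply: ne; rewrite bj k0.
  have [j' jj bj'] := posroot_other_coef pb bj.
  left; split=> //; apply: (posroot_gt0 (i := j')) => //.
  by rewrite rcoefB rcoef_simple (negPf jj) subr0.
rewrite opprK => h ne bsD; case: h => -[pb h].
  have /eqP[] := Delta_neq0 bD; apply: rcoef_eq0 => i'; apply/eqP.
  have := highroot_ge i' bsD; rewrite rcoefD gerDr => le0.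
  by rewrite eq_le le0 posroot_ge0.
left; split; last by lia.
apply: posroot_all_ge0 => // i'.
by rewrite addrC -[b]opprK; apply: highroot_subr_ge0; exact: posroot_Delta.
Qed.

Lemma negsimple_shift_pos i k : 0 < k -> DeltaW_pos L (realroot (- sidx i) (k - sdeg i)).
Proof.
rewrite DeltaW_posP opprK /sidx /sdeg /aff_simple_idx => k0.
case: unliftP => [j _|_] /=; first by right; split; [exact: simpleroot_pos|lia].
by left; rewrite opprK; split; [exact: highroot_pos|lia].
Qed.

(** The bracket subtracts the simple root. If the finite parts agree, it lands in an imaginary root
    space, otherwise in a real one or at zero; the central terms vanish by degree or weight. The
    simple root itself is not reached: from a real root this would make twice its finite part a
    root, from an imaginary one its finite part would be its own negative. *)
Lemma raising_br i Z : raising i Z ->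
  raising i (aff_br (xi (- sidx i) (- sdeg i)) Z).
Proof.
have aD := sidx_Delta i; have naD := Delta_opp aD.
have wna := weightv_rootvec naD.
have mon0 k c b : mon k (0 : L) = mon c (0 *: rootvec b) by rewrite scale0r /mon !monomial0.
case=> [[c [b [k [bD pos ne ->]]]]|[k [H [k0 ->]]]]; rewrite /xi mon_br.
  rewrite linearZ /=; have [ba|ba] := eqVneq b (sidx i).
    have kn : k <> sdeg i by move=> kn; apply: ne; rewrite ba kn.
    have kp : 0 < k - sdeg i by apply: simpleroot_shift; rewrite -?ba.
    right; exists (k - sdeg i), (- c *: coroot (sidx i)); split=> //.
    rewrite ifF; last by rewrite addrC; apply/eqP; lia.
    have -> : vsval (- c *: coroot (sidx i)) = c *: [<rootvec (- sidx i), rootvec b>].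
      by rewrite ba lbrC rootvec_opp// scalerN -scaleNr vsvalZ.
    by rewrite /mon addrC.
  have ba0 : - sidx i + b != 0 by rewrite addrC subr_eq0.
  have wb := weightv_lbr wna (weightv_rootvec bD).
  rewrite linearZ /= (form_weight wna (weightv_rootvec bD) ba0) scaleoE !mulr0 if_same.
  have [abD|nabD] := boolP (- sidx i + b \in Delta L); last first.
    have -> : [<rootvec (- sidx i), rootvec b>] = 0.
      by apply/eqP; apply: contraNT nabD; exact: weightv_neq0.
    by rewrite scaler0; left; exists 0, b, k; split=> //; exact: mon0.
  have [d ->] := weightv_rootspace ba0 wb.
  left; exists (c * d), (b - sidx i), (k - sdeg i); rewrite [b - _]addrC [k - _]addrC scalerA.
  split=> //.
    by rewrite [- _ + b]addrC [- _ + k]addrC; apply: pos_sub_simple => //; rewrite addrC.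
  rewrite aff_simplerootE => /realroot_inj[e _].
  have : sidx i *+ 2 \in Delta L by rewrite mulr2n -{1}e addrC addrA subrr add0r.
  by apply/negP/double_notroot.
left; exists (sidx i H), (- sidx i), (k - sdeg i); split=> //.
- exact: negsimple_shift_pos.
- rewrite aff_simplerootE => /realroot_inj[e _].
  have := congr1 (fun b : dual_hfin L => b (coroot (sidx i))) e.
  rewrite opp_lfunE coroot2// => /eqP; rewrite -subr_eq0 -opprD oppr_eq0.
  by rewrite -[_ + _](natrD R 2 2) pnatr_eq0.
rewrite (form_weight wna (weightv_cartan H)) ?addr0; last exact: Delta_neq0.
rewrite mulr0 if_same lbrC rootvec_weight// /mon [- _ + k]addrC.
by rewrite opp_lfunE scaleNr opprK.
Qed.

Section SimpleIndex.
Variable i : 'I_(rank L).+1.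
Let e := act (xi (sidx i) (sdeg i)).
Let f := act (xi (- sidx i) (- sdeg i)).

Let fZ c v : f (c *: v) = c *: f v. Proof. exact: linearZ. Qed.

Let f0 : f 0 = 0. Proof. exact: linear0. Qed.

(** Raising elements kill the highest weight vector, and moving one past [f] only produces another
    one. *)
Lemma raising_kill Z N : raising i Z -> act Z (iter N f hwv) = 0.
Proof.
elim: N Z => [|N IH] Z Zr.
  case: Zr => [[c [b [k [bD pos _ ->]]]]|[k [H [k0 ->]]]]; last exact: hwvec_pos.
  have -> : mon k (c *: rootvec b) = c *: xi b k.
    by congr (_, _, _); rewrite /= ?scaler0// monomialZ.
  by rewrite ractE linearZ /= -ractE hwvec_posroot// scaler0.
rewrite iterS.
have := act_comm (xi (- sidx i) (- sdeg i)) Z (iter N f hwv).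
rewrite (IH _ Zr) (IH _ (raising_br Zr)) addr0 linear0 => <-.
by [].
Qed.

Lemma act_cartan_pow N H : act (aff_cartan H) (iter N f hwv) =
  (lam H - N%:R * aff_simpleroot i H) *: iter N f hwv.
Proof.
have Hf v : act (aff_cartan H) (f v) = f (act (aff_cartan H) v) - aff_simpleroot i H *: f v.
  by rewrite /f act_Hf ?sidx_Delta.
elim: N => [|N IH]; first by rewrite hwvec_weight mul0r subr0.
rewrite iterS Hf IH fZ -scalerBl; congr (_ *: _).
by rewrite -natr1; ring.
Qed.

(** The sl2 recursion; the factor vanishes for N = lam(h_i), so that [e] kills the next power of [f]
    applied to [hwvec]. *)
Lemma act_e_pow N : e (iter N.+1 f hwv) =
  (N.+1%:R * (lam (aff_simplecoroot L i) - N%:R)) *: iter N f hwv.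
Proof.
have e0 : e hwv = 0 by apply: hwvec_posroot; exact: aff_simpleroot_pos.
have ef v : e (f v) = f (e v) + act (aff_cartan (aff_simplecoroot L i)) v.
  by rewrite aff_simplecorootE; apply: act_ef; exact: sidx_Delta.
elim: N => [|N IH].
  by rewrite iterS ef e0 f0 add0r hwvec_weight mul1r subr0.
rewrite iterS ef IH act_cartan_pow aff_simpleroot_coroot fZ -scalerDl.
congr (_ *: _); rewrite -!natr1; ring.
Qed.
End SimpleIndex.

(** Evaluation of the simple roots is bijective on the finite Cartan subalgebra, which settles the
    finite nodes; the D coordinate is then adjusted for the affine one. This is the principal
    grading. *)
Lemma grading_element : exists H0 : hext L, forall i, aff_simpleroot i H0 = 1.
Proof.
pose g H : 'rV[R]_(rank L) := \row_j @simpleroot R L j H.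
have gl : linear g by move=> c u v; apply/rowP => j; rewrite !mxE linearP.
have gE : linfun g =1 g := linfun_of_linear gl.
have g0 : lker (linfun g) == 0%VS.
  apply/lker0P => u v; rewrite !gE => uv; apply/eqP; rewrite -subr_eq0; apply/eqP.
  apply: roots_eq0 => j; rewrite linearB /=.
  by have := congr1 (fun M : 'rV_(rank L) => M 0 j) uv; rewrite !mxE => ->; rewrite subrr.
have full : limg (linfun g) = fullv.
  apply/eqP; rewrite eqEdim subvf /= limg_dim_eq; last by rewrite (eqP g0) capv0.
  rewrite !dimvf /= /dim /= mul1n.
  have := size_basis (X := in_tuple (corootseq L)) (cartan_basis L).
  by rewrite /= size_map size_enum_ord => ->.
have /memv_imgP[H1 _] : const_mx 1 \in limg (linfun g) by rewrite full memvf.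
rewrite gE => H1E.
have sH j : @simpleroot R L j H1 = 1.
  by have := congr1 (fun M : 'rV_(rank L) => M 0 j) H1E; rewrite !mxE.
exists (H1, 0, 1 + highroot L H1) => i.
rewrite aff_simplerootE realrootE /sidx /sdeg /aff_simple_idx /=.
case: unliftP => [j _|_] /=; first by rewrite sH mul0r addr0.
by rewrite opp_lfunE mul1r addrCA addNr addr0.
Qed.

End Singular.

Section EigenOp.
Variables (K : fieldType) (V : lmodType K) (h : {linear V -> V}).

Lemma eigen_op_linear l : linear (eigen_op h l).
Proof.
elim: l => [//|x l IH] c u v /=.
rewrite IH linearP [x *: (_ + _)]scalerDr opprD addrACA; congr (_ + _).
by rewrite scalerBr !scalerA mulrC.
Qed.

Lemma eigen_op_h l v : eigen_op h l (h v) = h (eigen_op h l v).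
Proof.
elim: l => //= x l ->; rewrite linearB /=; congr (_ - _).
exact/esym/linearZ.
Qed.

Lemma eigen_op_cat0 l l' v : eigen_op h l v = 0 -> eigen_op h (l' ++ l) v = 0.
Proof.
by move=> e; elim: l' => //= x l' ->; rewrite linear0 scaler0 subr0.
Qed.

Lemma eigen_op_cat0r l l' v : eigen_op h l v = 0 -> eigen_op h (l ++ l') v = 0.
Proof.
move=> e; elim: l' l e => [|x l' IH] l e; first by rewrite cats0.
rewrite -cat_rcons; apply: IH; rewrite -cats1 /eigen_op foldr_cat /=.
have := eigen_op_linear l (- x) v (h v); rewrite eigen_op_h e scaler0 linear0 addr0.
by rewrite addrC scaleNr.
Qed.

Lemma eigen_op_shift (y : {linear V -> V}) d l v :
  (forall w, h (y w) = y (h w) + d *: y w) ->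
  eigen_op h [seq x + d | x <- l] (y v) = y (eigen_op h l v).
Proof.
move=> hy; elim: l => //= x l ->; rewrite hy scalerDl opprD addrACA subrr addr0 linearB /=.
by congr (_ - _); exact/esym/linearZ.
Qed.
End EigenOp.

Section Integrable.
Variables (R : realType) (L : chevalleyAlgebra R) (lam : dual_hext L) (V : hwModule lam).
Hypothesis lam_dom : forall i, exists n : nat, lam (aff_simplecoroot L i) = n%:R.
Local Notation affine := (affine L).
Local Notation act := (@hwact R L lam V).
Local Notation hwv := (@hwvec R L lam V).
Implicit Types (a b : dual_hfin L) (n k : int) (X Y Z : affine) (v : V).

Definition lowering Y :=
  (exists b k, [/\ b \in Delta L, DeltaW_pos L (realroot (- b) (- k)) & Y = xi b k]) \/
  (exists k (H : hfin L), k < 0 /\ Y = mon k (vsval H)).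

(** The span of [u] under the enveloping algebra of the negative part, generated inductively instead
    of through that algebra. *)
Inductive lowered (u : V) : V -> Prop :=
| lowered_base : lowered u u
| lowered_comb c x y : lowered u x -> lowered u y -> lowered u (c *: x + y)
| lowered_act Y x : lowering Y -> lowered u x -> lowered u (act Y x).

Lemma lowered0 u : lowered u 0.
Proof. by rewrite -(addNr u) -scaleN1r; apply: lowered_comb; exact: lowered_base. Qed.

Lemma loweredD u x y : lowered u x -> lowered u y -> lowered u (x + y).
Proof. by rewrite -{2}[x]scale1r; exact: lowered_comb. Qed.

(** Any element is commuted past the lowering operators until it reaches [u], where it kills, scales
    or lowers; this induction plays the role of a triangular decomposition. *)
Lemma lowered_stable u :
  (forall b k, b \in Delta L -> DeltaW_pos L (realroot b k) -> act (xi b k) u = 0) ->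
  (forall k (H : hfin L), 0 < k -> act (mon k (vsval H)) u = 0) ->
  (forall H, exists c, act (aff_cartan H) u = c *: u) ->
  forall z, lowered u z -> forall X, lowered u (act X z).
Proof.
move=> kr ki kc z; elim=> [|c x y _ IHx _ IHy|Y x Yl ux IH] X; last 2 first.
- by rewrite linearP; apply: lowered_comb; [exact: IHx|exact: IHy].
- by rewrite act_comm; apply: loweredD; [apply: lowered_act => //; exact: IH|exact: IH].
move: X; apply: affine_ind => [|c X Y PX PY|b n bD|n H n0|H].
- by rewrite ractE linear0; exact: lowered0.
- by rewrite ractE linearP; exact: lowered_comb.
- have [|pos|neg] := @isreal_sign R L (realroot b n); first by exists b, n.
    by rewrite kr//; exact: lowered0.
  apply: lowered_act; last exact: lowered_base.
  by left; exists b, n; rewrite -realrootN.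
- have [np|nn|nE] := ltgtP n 0.
  + by apply: lowered_act; [right; exists n, H|exact: lowered_base].
  + by rewrite ki//; exact: lowered0.
  + by rewrite nE eqxx in n0.
have [c ->] := kc H; rewrite -[_ *: _]addr0.
by apply: lowered_comb; [exact: lowered_base|exact: lowered0].
Qed.

Lemma grading_nat (H0 : hext L) : (forall i, aff_simpleroot i H0 = 1) ->
  (forall b k, DeltaW_pos L (realroot b k) -> exists d : nat, realroot b k H0 = d%:R) /\
  exists d : nat, H0.2 = d%:R.
Proof.
move=> H0P.
have sH j : @simpleroot R L j H0.1.1 = 1.
  have := H0P (lift ord_max j); rewrite aff_simplerootE realrootE /sidx /sdeg /aff_simple_idx.
  by rewrite liftK /= mul0r addr0.
have hb b : b H0.1.1 = \sum_j rcoef j b.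
  rewrite {1}(rcoefE b) sum_lfunE; apply: eq_bigr => j _.
  by rewrite scale_lfunE sH scaleoE mulr1.
have pos b : posroot b -> exists d : nat, b H0.1.1 = d%:R.
  move=> [bD [n nE]]; exists (\sum_j n j)%N; rewrite hb natr_sum.
  by apply: eq_bigr => j _; rewrite {1}nE rcoef_sum.
have H2 : H0.2 = 1 + highroot L H0.1.1.
  have := H0P ord_max; rewrite aff_simplerootE realrootE /sidx /sdeg /aff_simple_idx.
  by rewrite unlift_none /= opp_lfunE mul1r => <-; rewrite addrAC addNr add0r.
have [dh dhE] := pos _ (highroot_pos L).
split; last by exists dh.+1; rewrite H2 dhE nat1r.
move=> b k /DeltaW_posP[[pb]|[nb]]; rewrite realrootE H2 dhE; case: k => // k kp.
  have [d ->] := pos _ pb; exists (d + k * dh.+1)%N.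
  by rewrite natrD natrM nat1r.
have [d dE] := pos _ nb.
have -> : b H0.1.1 = - d%:R by rewrite -dE opp_lfunE opprK.
(* A negative finite root has height at least minus that of the highest root, and k >= 1 adds at
   least the larger height of delta. *)
have ddh : (d <= dh)%N.
  rewrite -(ler_nat R) -dE -dhE !hb; apply: ler_sum => j _.
  by apply: highroot_ge; exact: posroot_Delta.
exists (k * dh.+1 - d)%N; rewrite natrB ?natrM ?nat1r; first by rewrite addrC.
by nia.
Qed.

(** A vanishing product of factors h - (c - k) expresses that only the eigenvalues c - k occur in
    [z]. In this form the property passes to combinations, and a lowering operator merely shifts the
    list. *)
Lemma lowered_grading u H0 c : (forall i, aff_simpleroot i H0 = 1) ->
  act (aff_cartan H0) u = c *: u -> forall z, lowered u z ->
  exists2 l : seq R, forall x, x \in l -> exists k : nat, x = c - k%:R &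
    eigen_op (act (aff_cartan H0)) l z = 0.
Proof.
move=> H0P uc z; have [nat_pos [d0 d0E]] := grading_nat H0P.
elim=> [|b x y _ [l lc lx] _ [l' lc' ly]|Y x Yl _ [l lc lx]].
- exists [:: c]; first by move=> x; rewrite inE => /eqP ->; exists 0%N; rewrite subr0.
  by rewrite /= uc subrr.
- exists (l ++ l') => [w|]; first by rewrite mem_cat => /orP[/lc|/lc'].
  by rewrite eigen_op_linear eigen_op_cat0r// eigen_op_cat0// scaler0 addr0.
have [d dY] : exists d : nat, forall w, act (aff_cartan H0) (act Y w) =
    act Y (act (aff_cartan H0) w) + (- d%:R) *: act Y w.
  case: Yl => [[b [k [bD neg ->]]]|[k [H [k0 ->]]]].
    have [d dE] := nat_pos _ _ neg; exists d => w.
    rewrite (act_cartan_weight _ _ _ (weightv_rootvec bD)); congr (_ + _ *: _).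
    by rewrite -dE -realrootN opp_lfunE opprK.
  exists (`|k| * d0)%N => w.
  rewrite (act_cartan_weight _ _ _ (weightv_cartan H)); congr (_ + _ *: _).
  rewrite realrootE zero_lfunE add0r d0E natrM -mulNr; congr (_ * _).
  by rewrite -[k in LHS]opprK rmorphN /= -(ltr0_norm k0) natr_absz.
exists [seq w - d%:R | w <- l].
  move=> w /mapP[w' /lc[k ->] ->]; exists (k + d)%N.
  by rewrite natrD opprD addrA.
have := @eigen_op_shift _ _ (act (aff_cartan H0)) (act Y) (- d%:R) l x dY.
by rewrite lx linear0.
Qed.

(** Otherwise this vector is singular, and the vectors [lowered] from it form a submodule,
    which misses [hwvec] because its grading eigenvalues are strictly lower. *)
Lemma singular_zero i m : lam (aff_simplecoroot L i) = m%:R ->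
  iter m.+1 (act (xi (- sidx i) (- sdeg i))) hwv = 0.
Proof.
move=> lm; set u := iter _ _ _; apply/eqP; apply: contraT => u0.
have ki k (H : hfin L) : 0 < k -> act (mon k (vsval H)) u = 0.
  by move=> k0; apply: (@raising_kill _ _ _ _ i); right; exists k, H.
have kr b k : b \in Delta L -> DeltaW_pos L (realroot b k) -> act (xi b k) u = 0.
  move=> bD pos; have [E|ne] := pselect (realroot b k = aff_simpleroot i).
    have [-> ->] := realroot_inj E; rewrite act_e_pow lm subrr mulr0.
    by rewrite scale0r.
  apply: (@raising_kill _ _ _ _ i); left; exists 1, b, k; split=> //.
  by rewrite scale1r.
have kc H : exists c, act (aff_cartan H) u = c *: u.
  by exists (lam H - m.+1%:R * aff_simpleroot i H); exact: act_cartan_pow.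
have st := lowered_stable kr ki kc.
have [|||U|U] := @hwact_irr R L lam V (lowered u).
- exact: lowered0.
- by move=> c x y; exact: lowered_comb.
- by move=> X z /st.
- have : lowered u u by exact: lowered_base.
  by rewrite U /= => u0'; rewrite u0' eqxx in u0.
have [H0 H0P] := grading_element L.
have uc : act (aff_cartan H0) u = (lam H0 - m.+1%:R) *: u.
  by rewrite /u act_cartan_pow H0P mulr1.
have hl : lowered u hwv by rewrite U.
have [l lc lh] := lowered_grading H0P uc hl.
have := @hwvec_neq0 R L lam V; rewrite (eigen_op_neq0 (hwvec_weight V H0) _ lh) ?eqxx//.
apply/negP => /lc[k /eqP]; rewrite -addrA -opprD -natrD -[X in X == _]subr0.
by rewrite (inj_eq (addrI _)) eqr_opp eq_sym pnatr_eq0.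
Qed.

(** By [act_locnil] one nonzero vector of finite order suffices, and the highest weight vector is
    one for both operators. *)
Lemma simple_locnil i : locnil (act (xi (sidx i) (sdeg i))) /\
  locnil (act (xi (- sidx i) (- sdeg i))).
Proof.
have aD := sidx_Delta i; have h0 := @hwvec_neq0 R L lam V; split.
  apply: (act_locnil aD h0); exists 1%N => /=.
  by apply: hwvec_posroot; exact: aff_simpleroot_pos.
have [m lm] := lam_dom i.
by apply: (act_locnil (Delta_opp aD) h0); exists m.+1; exact: singular_zero.
Qed.

Lemma lam_center : (exists i, lam (aff_simplecoroot L i) != 0) -> 0 < lam (0, 1, 0).
Proof.
move=> [i li]; have [p p0 ->] := center_coroots L.
have ge j : 0 <= lam (aff_simplecoroot L j) by have [n ->] := lam_dom j.
rewrite linear_sum (bigD1 i)//= ltr_pwDl//.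
  by rewrite linearZ /= scaleoE mulr_gt0// lt_neqAle eq_sym li ge.
by rewrite sumr_ge0// => j _; rewrite linearZ /= scaleoE mulr_ge0// ltW.
Qed.

(** If a(H) <> 0 for a root [a], all [xi a n] act by zero, hence so do the coroots of a + n delta.
    The coroots for n = 1 and n = 0 differ by a multiple of the center, where [lam] is positive. So
    [H] is central, and the same positivity makes it zero. *)
Lemma cartan_faithful (H : hext L) : 0 < lam (0, 1, 0) -> H.2 = 0 ->
  (forall v, act (aff_cartan H) v = 0) -> H = 0.
Proof.
move=> lc H2 HV; have h0 := @hwvec_neq0 R L lam V.
have lamH H' : act (aff_cartan H') hwv = 0 -> lam H' = 0.
  by rewrite hwvec_weight => /eqP; rewrite scaler_eq0 (negPf h0) orbF => /eqP.
have aH a : a \in Delta L -> a H.1.1 = 0.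
  move=> aD; apply/eqP; apply: contraT => aH0.
  have xi0 n v : act (xi a n) v = 0.
    have := act_He n aD H v; rewrite !HV linear0 add0r => /esym/eqP.
    by rewrite scaler_eq0 realrootE H2 mulr0 addr0 (negPf aH0) => /eqP.
  have l0 n : lam (rcoroot a n) = 0.
    by apply: lamH; have := act_ef n aD hwv; rewrite !xi0 linear0 add0r.
  have : lam (rcoroot a 1) - lam (rcoroot a 0) = lam ((rnorm a / 2) *: (0, 1, 0)).
    rewrite -linearB; congr (lam _); congr (_, _, _); rewrite /= ?scaler0 ?subrr//.
    by rewrite mul0r subr0 mul1r scaleoE mulr1.
  rewrite !l0 subrr linearZ /= scaleoE => /esym/eqP.
  rewrite mulf_eq0 (gt_eqF lc) orbF gt_eqF//.
  by apply: divr_gt0 => //; exact: rnorm_gt0.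
have H0 : H.1.1 = 0 by apply: roots_eq0 => i; exact/aH/simpleroot_Delta.
have HE : H = H.1.2 *: (0, 1, 0).
  case: H H0 H2 {HV aH} => [[u c] d] /= -> ->.
  by congr (_, _, _); rewrite /= ?scaler0// scaleoE mulr1.
have := lamH H (HV hwv); rewrite HE linearZ /= scaleoE => /eqP.
by rewrite mulf_eq0 (gt_eqF lc) orbF => /eqP ->; rewrite scale0r.
Qed.

End Integrable.

(** Only the affine simple coroot has a central coordinate; without it the basis of finite coroots
    remains. *)
Lemma aff_simplecoroot_free (R : realType) (L : chevalleyAlgebra R)
    (c : 'I_(rank L).+1 -> R) :
  \sum_i c i *: aff_simplecoroot L i = 0 -> forall i, c i = 0.
Proof.
rewrite big_ord_recr /= /aff_simplecoroot unlift_none => E.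
have w i : unlift ord_max (widen_ord (leqnSn (rank L)) i) = Some i.
  have -> : widen_ord (leqnSn (rank L)) i = lift ord_max i.
    by apply: val_inj; rewrite /= /bump leqNgt ltn_ord.
  by rewrite liftK.
move: E; under eq_bigr do rewrite w.
have -> : \sum_(i < rank L) c (widen_ord (leqnSn (rank L)) i) *:
      ((coroot (simpleroot i), 0, 0) : hext L) =
    (\sum_(i < rank L) c (widen_ord (leqnSn (rank L)) i) *: coroot (simpleroot i), 0, 0).
  elim/big_rec2: _ => // i x y _ ->; congr (_, _, _); rewrite /= ?scaler0 ?add0r//.
rewrite dual_form_highroot divff ?pnatr_eq0// => -[].
rewrite /= scaleoE mulr1 add0r => E1 cm; rewrite cm scale0r addr0 in E1 *.
have c0 j : c (widen_ord (leqnSn (rank L)) j) = 0.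
  have fr : free [seq vsval (coroot (@simpleroot R L i)) | i <- enum 'I_(rank L)].
    by have /andP[] := cartan_basis L.
  apply: (free_map_coef fr (d := fun i => c (widen_ord (leqnSn (rank L)) i))); last first.
    by rewrite mem_enum.
  rewrite big_enum /= -[RHS]E1 linear_sum /=.
  exact: eq_bigr.
move=> _ i; case: (unliftP ord_max i) => [j ->|->] //.
rewrite -[RHS](c0 j); congr (c _); apply: val_inj.
by rewrite /= /bump leqNgt ltn_ord.
Qed.

(** * Root subgroups over the completions *)

Section SpanType.
Variables (K : fieldType) (U : lmodType K) (G : set U).

Definition span_pred : {pred U} := fun w =>
  `[< exists s : seq (K * U), (forall p, p \in s -> G p.2) /\ w = \sum_(p <- s) p.1 *: p.2 >].

Record span_type := SpanType { span_val :> U; span_valP : span_val \in span_pred }.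

Lemma span_closed : submod_closed span_pred.
Proof.
split=> [|a u v /asboolP[s [sG ->]] /asboolP[t [tG ->]]]; apply/asboolP.
  by exists [::]; rewrite big_nil.
exists ([seq (a * p.1, p.2) | p <- s] ++ t); split=> [p|].
  by rewrite mem_cat => /orP[/mapP[q /sG ? ->]|/tG].
rewrite big_cat big_map scaler_sumr; congr (_ + _).
by apply: eq_bigr => p _; rewrite scalerA.
Qed.

HB.instance Definition _ :=
  GRing.isSubmodClosed.Build K U span_pred span_closed.
HB.instance Definition _ := [isSub for span_val].
HB.instance Definition _ := [Choice of span_type by <:].
HB.instance Definition _ := [SubChoice_isSubLmodule of span_type by <:].

Lemma span_pred_gen u : G u -> u \in span_pred.
Proof.
move=> Gu; apply/asboolP; exists [:: (1, u)]; split=> [p|].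
  by rewrite inE => /eqP ->.
by rewrite big_seq1 scale1r.
Qed.
End SpanType.

Section BaseChange.
Variables (R : realType) (L : chevalleyAlgebra R) (lam : dual_hext L).
Variables (V : hwModule lam) (M : chevalleyForm V).
Implicit Types (u v : V) (n : nat).

Lemma finsupp_comb (A : lmodType R) (I : choiceType) (b : I -> A) (c d : I -> R) x :
  finite_set [set i | c i != 0] -> finite_set [set i | d i != 0] ->
  finite_set [set i | x * c i + d i != 0] /\
  \sum_(i \in [set: I]) (x * c i + d i) *: b i =
  x *: (\sum_(i \in [set: I]) c i *: b i) + \sum_(i \in [set: I]) d i *: b i.
Proof.
move=> fc fd; pose S := (fset_set [set i | c i != 0%R] `|` fset_set [set i | d i != 0%R])%fset.
have cS i : i \notin S -> c i = 0.
  by rewrite inE !in_fset_set// => /norP[]; rewrite mem_setE /= negbK => /eqP.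
have dS i : i \notin S -> d i = 0.
  by rewrite inE !in_fset_set// => /norP[_]; rewrite mem_setE /= negbK => /eqP.
split.
  apply: (@sub_finite_set _ _ [set` S]); last exact: finite_fset.
  by move=> i /=; apply: contraNT => iS; rewrite cS// dS// mulr0 addr0.
rewrite !(fsbigTE S) => [|i iS|i iS|i iS]; rewrite ?cS ?dS ?mulr0 ?addr0 ?scale0r//.
rewrite scaler_sumr -big_split; apply: eq_bigr => i _ /=.
by rewrite scalerDl scalerA.
Qed.

(** Coordinates in a Z-basis are linear forms that turn membership in [M] into integrality, which
    makes its closure properties immediate. *)
Lemma Zform_coord : exists (I : Type) (x : I -> V -> R),
  [/\ forall i, linear (x i : V -> R^o), forall v, (forall i, x i v = 0) -> v = 0 &
      forall v, cform M v <-> forall i, exists z : int, x i v = z%:~R].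
Proof.
have [I [b [bspan bfree MP]]] := cform_Z M.
have /choice[x xP] : forall v, exists c : I -> R,
    finite_set [set i | c i != 0] /\ v = \sum_(i \in [set: I]) c i *: b i.
  by move=> v; have [c fc cE] := bspan v; exists c.
have uniq c d : finite_set [set i | c i != 0] -> finite_set [set i | d i != 0] ->
    \sum_(i \in [set: I]) c i *: b i = \sum_(i \in [set: I]) d i *: b i -> c = d.
  move=> fc fd cd; have [fe E] := finsupp_comb b (-1) fc fd.
  rewrite cd scaleN1r addNr in E; apply/funext => i.
  by have /eqP := bfree _ fe E i; rewrite mulN1r addrC subr_eq0 => /eqP.
exists I, (fun i v => x v i); split=> [i a u v|v v0|v].
- have [fu uE] := xP u; have [fv vE] := xP v; have [fw wE] := xP (a *: u + v).
  have [fe E] := finsupp_comb b a fu fv; rewrite -uE -vE wE in E.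
  by have := uniq _ _ fe fw E => /(congr1 (fun f => f i)) <-.
- by have [_ ->] := xP v; rewrite fsbig1// => i _; rewrite v0 scale0r.
have [fv vE] := xP v; split=> [/MP[c fc cE] i|h].
  exists (c i); have fc' : finite_set [set i | ((c i)%:~R : R) != 0].
    by apply: sub_finite_set fc => j /=; apply: contraNneq => ->.
  by rewrite (uniq _ _ fv fc')// -vE.
have /choice[c cE] := h; apply/MP; exists c.
  by apply: sub_finite_set fv => i /=; rewrite cE intr_eq0.
by rewrite {1}vE; apply: eq_fsbigr => i _; rewrite cE.
Qed.

Lemma cform0 : cform M 0.
Proof.
have [I [x [xl _ MP]]] := Zform_coord; apply/MP => i; exists 0.
by have := xl i (-1) 0 0; rewrite scaler0 addr0 scaleN1r addNr.
Qed.

Lemma cform_comb (z : int) u v : cform M u -> cform M v -> cform M (u *~ z + v).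
Proof.
have [I [x [xl _ MP]]] := Zform_coord; move=> /MP ux /MP vx; apply/MP => i.
have [a ua] := ux i; have [b vb] := vx i; exists (z * a + b).
by rewrite -scaler_int xl ua vb scaleoE rmorphD rmorphM.
Qed.

Lemma cformD u v : cform M u -> cform M v -> cform M (u + v).
Proof. by rewrite -{2}[u]mulr1z; exact: cform_comb. Qed.

Lemma cformMz u z : cform M u -> cform M (u *~ z).
Proof. by move=> Mu; rewrite -[_ *~ _]addr0; apply: cform_comb => //; exact: cform0. Qed.

Lemma cformN u : cform M u -> cform M (- u).
Proof. by move=> /(cformMz (-1)); rewrite mulrN1z. Qed.

Lemma cform_sum (I : Type) (s : seq I) (P : pred I) (f : I -> V) :
  (forall i, P i -> cform M (f i)) -> cform M (\sum_(i <- s | P i) f i).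
Proof. by move=> fM; elim/big_ind: _ => //; [exact: cform0|exact: cformD]. Qed.

Lemma cform_sign u n : cform M u -> cform M ((-1) ^+ n *: u).
Proof.
by move=> Mu; rewrite -signr_odd; case: odd; rewrite ?expr1 ?scaleN1r ?scale1r//; exact: cformN.
Qed.

Variables (K : fieldType) (W : base_change M K).
Local Notation bm := (bc_map W).

Lemma bc_map0 : bm 0 = 0.
Proof.
have := bc_mapD W cform0 cform0; rewrite addr0 => /eqP.
by rewrite -[X in X == _]addr0 (inj_eq (addrI _)) => /eqP.
Qed.

Lemma bc_mapN u : cform M u -> bm (- u) = - bm u.
Proof.
move=> Mu; apply/eqP; rewrite -addr_eq0 -bc_mapD ?addNr ?bc_map0//; exact: cformN.
Qed.

Lemma bc_map_sum (I : Type) (s : seq I) (P : pred I) (f : I -> V) :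
  (forall i, P i -> cform M (f i)) ->
  bm (\sum_(i <- s | P i) f i) = \sum_(i <- s | P i) bm (f i).
Proof.
move=> fM; elim: s => [|i s IH]; first by rewrite !big_nil bc_map0.
rewrite !big_cons; case: ifP => // Pi.
by rewrite bc_mapD ?IH//; [exact: fM|exact: cform_sum].
Qed.

Lemma bc_map_sign u n : cform M u -> bm ((-1) ^+ n *: u) = (-1) ^+ n *: bm u.
Proof.
move=> Mu; elim: n => [|n IH]; first by rewrite !scale1r.
by rewrite !exprS !mulN1r !scaleNr bc_mapN ?IH//; exact: cform_sign.
Qed.

Lemma bc_ext (U : lmodType K) (T1 T2 : W -> U) : linear T1 -> linear T2 ->
  (forall u, cform M u -> T1 (bm u) = T2 (bm u)) -> T1 = T2.
Proof.
move=> l1 l2 T12.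
have [|T [_ Tu]] := @bc_univ _ _ _ W U (fun u => T1 (bm u)).
  move=> u v Mu Mv; rewrite bc_mapD//.
  by have := l1 1 (bm u) (bm v); rewrite !scale1r.
transitivity T; [apply/esym/Tu; split=> //|apply: Tu; split=> // u Mu; exact/esym/T12].
Qed.

(** The bundled universal property gives uniqueness only, so [W] is compared with the
    submodule [span_type] generated by the image. *)
Lemma bc_span w : exists s : seq (K * V), (forall p, p \in s -> cform M p.2) /\
  w = \sum_(p <- s) p.1 *: bm p.2.
Proof.
pose G : set W := bm @` cform M.
pose f u : span_type G := insubd 0 (bm u).
have fE u : cform M u -> val (f u) = bm u.
  by move=> Mu; rewrite /f insubdK//; apply: span_pred_gen; exists u.
have [|T [[Tl TE] _]] := @bc_univ _ _ _ W (span_type G) f.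
  by move=> u v Mu Mv; apply: val_inj; rewrite raddfD /= !fE ?bc_mapD//; exact: cformD.
have /(congr1 (fun g => g w)) /= wE : (fun x => val (T x)) = id :> (W -> W).
  apply: bc_ext => // [c x y|u Mu]; first by rewrite Tl linearP.
  by rewrite TE// fE.
have /asboolP[s [sG sE]] := span_valP (T w).
have /choice[g gP] : forall p : K * W, exists v, G p.2 -> cform M v /\ bm v = p.2.
  move=> p; have [[v Mv vE]|nG] := pselect (G p.2); first by exists v.
  by exists 0.
exists [seq (p.1, g p) | p <- s]; split=> [p /mapP[q /sG /gP[Mq _] ->] //|].
rewrite -[LHS]wE [LHS]sE big_map big_seq [RHS]big_seq.
by apply: eq_bigr => p /sG /gP[_ ->].
Qed.

(** A nonzero weight vector can be divided by the characteristic until it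
    survives in the base change. *)
Lemma bc_map_neq0 mu u : cform M u -> weight_vector mu u -> u != 0 ->
  exists u', [/\ cform M u', weight_vector mu u' & bm u' != 0].
Proof.
have [I [x [xl x0 MP]]] := Zform_coord => Mu wu u0.
have [i ui] : exists i, x i u != 0.
  by apply: contra_neqP u0 => /forallNP h; apply: x0 => i; apply/eqP/negPn/negP; exact: h.
have xZ a v : x i (a *: v) = a * x i v.
  have xi0 : x i 0 = 0 by have := xl i (-1) 0 0; rewrite scaler0 addr0 scaleN1r addNr.
  by rewrite -[a *: v]addr0 xl xi0 addr0 scaleoE.
(* The absolute value of this nonzero integral coordinate decreases at each division by the
   characteristic. *)
have [t le_t] := ubnP `|Num.floor (x i u)|%N; elim: t => // t IH in u Mu wu u0 ui le_t *.
have fl v j : cform M v -> (Num.floor (x j v))%:~R = x j v.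
  by move=> /MP/(_ j)[z ->]; rewrite intrKfloor.
(* A coordinate that is nonzero in [K] induces, by the universal property, a linear form detecting
   the image of [u]. *)
have [[j uj]|all0] := pselect (exists j, (Num.floor (x j u))%:~R != 0 :> K).
  have [|T [[Tl TE] _]] := @bc_univ _ _ _ W K^o (fun v => (Num.floor (x j v))%:~R).
    move=> v w Mv Mw; rewrite -rmorphD /=; congr (_%:~R); apply: (@intr_inj R).
    rewrite rmorphD /= !fl//; last exact: cformD.
    by have := xl j 1 v w; rewrite !scale1r.
  exists u; split=> //; apply: contraNneq uj => bu0; rewrite -TE// bu0.
  by have := Tl (-1) 0 0; rewrite scaler0 addr0 scaleN1r addNr => ->.
have flK j : (Num.floor (x j u))%:~R = 0 :> K.
  by apply/eqP; apply: contrapT => h; apply: all0; exists j; apply/negP.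
set z := Num.floor (x i u) in le_t.
have z0 : z != 0 by rewrite -(intr_eq0 R) fl.
have absK (y : int) : y%:~R = 0 :> K -> `|y|%N%:R = 0 :> K.
  case: y => n; first by [].
  by rewrite NegzE mulrNz => /eqP; rewrite oppr_eq0 => /eqP.
have dvdK (p : nat) (y : int) : p \in [pchar K] -> y%:~R = 0 :> K -> (p %| y)%Z.
  by move=> pK y0; rewrite dvdzE /= (dvdn_pcharf pK) absK.
(* A nonzero integer vanishes in [K], so the characteristic is a prime; it divides all coordinates
   of [u]. *)
have [p pK] : exists p, p \in [pchar K].
  have za : (0 < `|z|)%N by rewrite absz_gt0.
  by have /eqP/(natf0_pchar za)[p pK] := absK _ (flK i); exists p.
have pp := pcharf_prime pK; have p0 : p%:R != 0 :> R by rewrite pnatr_eq0 -lt0n prime_gt0.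
pose u' := p%:R^-1 *: u.
have Mu' : cform M u'.
  apply/MP => j; have /dvdzP[y yE] := dvdK _ _ pK (flK j); exists y.
  have xjZ : x j u' = p%:R^-1 * x j u.
    have xj0 : x j 0 = 0 by have := xl j (-1) 0 0; rewrite scaler0 addr0 scaleN1r addNr.
    by rewrite /u' -[_ *: u]addr0 xl xj0 addr0 scaleoE.
  by rewrite xjZ -(fl u j Mu) yE rmorphM /= -pmulrn mulrCA mulVf// mulr1.
have wu' : weight_vector mu u'.
  by move=> H; rewrite /u' linearZ /= wu !scalerA mulrC.
have u0' : u' != 0 by rewrite scaler_eq0 invr_eq0 (negPf p0).
have ui' : x i u' != 0 by rewrite xZ mulf_neq0 ?invr_eq0.
apply: (IH u') => //.
have zE : z = Num.floor (x i u') * p%:Z.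
  by apply: (@intr_inj R); rewrite rmorphM /= !fl// xZ -pmulrn mulrC mulVKf.
move: le_t; rewrite zE abszM /= ltnS; apply: leq_trans.
rewrite ltn_Pmulr ?prime_gt1// absz_gt0.
by rewrite -(intr_eq0 R) fl.
Qed.

End BaseChange.

Section LocalTorus.
Variables (R : realType) (L : chevalleyAlgebra R) (lam : dual_hext L).
Variables (V : hwModule lam) (M : chevalleyForm V).
Variables (F : fieldType) (Fc : forall nu : place F, completion nu).
Variable W : forall nu : place F, base_change M (Fc nu).
Variable nu : place F.
Local Notation K := (cplT (Fc nu)).
Local Notation bm := (bc_map (W nu)).
Local Notation bop := (@bc_op _ _ _ _ M _ _ W nu).
Local Notation chiop := (@chi_op _ _ _ _ M _ _ W nu).
Local Notation wop := (@w_op _ _ _ _ M _ _ W nu).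
Local Notation hop := (@h_op _ _ _ _ M _ _ W nu).
Local Notation act := (@hwact R L lam V).
Implicit Types (a : dual_hfin L) (j : int) (s : K) (u v : V) (w : W nu).

Lemma bc_opP (T : V -> V) : (forall u v, T (u + v) = T u + T v) ->
  (forall u, cform M u -> cform M (T u)) ->
  linear (bop T) /\
  forall u, cform M u -> bop T (bm u) = bm (T u).
Proof.
move=> TD TM.
have [|T' [[T'l T'E] _]] := @bc_univ _ _ _ (W nu) (W nu) (fun u => bm (T u)).
  by move=> u v Mu Mv; rewrite TD bc_mapD//; exact: TM.
pose P := [set T' : W nu -> W nu | linear T' /\
  forall u, cform M u -> T' (bm u) = bm (T u)].
have : P (xget (id : W nu -> W nu) P) by apply: xgetPex; exists T'.
by [].
Qed.

Lemma divpowE a j n : divpow a j n = dpow (act (xi a j)) n :> (V -> V).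
Proof. by []. Qed.

Section Root.
Variables (a : dual_hfin L) (j : int).
Hypothesis aD : a \in Delta L.

Lemma dpow_cform n u : cform M u -> cform M (dpow (act (xi a j)) n u).
Proof. by move=> Mu; rewrite -divpowE; apply: cform_divpow. Qed.

Lemma bc_divpowP n : linear (bop (divpow a j n)) /\
  forall u, cform M u -> bop (divpow a j n) (bm u) = bm (dpow (act (xi a j)) n u).
Proof.
apply: bc_opP => [u v|u Mu]; last exact: cform_divpow.
by rewrite divpowE linearD.
Qed.

Lemma chi_op0 w : chiop a j (0 : K) w = w.
Proof.
rewrite /chi_op (@fsbig_nat_lt _ _ 1) => [|n n0]; last by rewrite expr0n gtn_eqF// scale0r.
rewrite big_ord1 expr0 scale1r; have [l E] := bc_divpowP 0.
by have -> : bop (divpow a j 0) = id by apply: bc_ext => // u Mu; rewrite E// dpow0.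
Qed.

Hypothesis en : locnil (act (xi a j)).

(** By [bc_span] a vector involves finitely many images of integral vectors, each killed by all high
    divided powers. *)
Lemma chi_op_fin w : exists N, forall n, (N <= n)%N -> bop (divpow a j n) w = 0.
Proof.
have [t [tM ->]] := bc_span w; elim: t tM => [_|p t IH tM].
  exists 0%N => n _; rewrite big_nil; have [l _] := bc_divpowP n.
  by have := l (-1) 0 0; rewrite scaler0 addr0 scaleN1r addNr.
have [|N NP] := IH; first by move=> q qt; apply: tM; rewrite inE qt orbT.
have [N' N'P] := en p.2; exists (maxn N N') => n; rewrite geq_max => /andP[Nn N'n].
have [l E] := bc_divpowP n; rewrite big_cons l NP// E; last by apply: tM; rewrite mem_head.
by rewrite (dpow_nil N'P)// bc_map0 scaler0 addr0.
Qed.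

Lemma chi_opE s w N : (forall n, (N <= n)%N -> bop (divpow a j n) w = 0) ->
  chiop a j s w = \sum_(n < N) s ^+ n *: bop (divpow a j n) w.
Proof. by move=> NP; apply: fsbig_nat_lt => n /NP ->; rewrite scaler0. Qed.

Lemma chi_op_linear s : linear (chiop a j s).
Proof.
move=> c u v; have [N1 h1] := chi_op_fin u; have [N2 h2] := chi_op_fin v.
have lin n := (bc_divpowP n).1.
have z1 n : (maxn N1 N2 <= n)%N -> bop (divpow a j n) u = 0.
  by rewrite geq_max => /andP[/h1].
have z2 n : (maxn N1 N2 <= n)%N -> bop (divpow a j n) v = 0.
  by rewrite geq_max => /andP[_ /h2].
rewrite (chi_opE s z1) (chi_opE s z2) (chi_opE s (N := maxn N1 N2)) => [|n nN]; last first.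
  by rewrite lin z1// z2// scaler0 addr0.
rewrite scaler_sumr -big_split; apply: eq_bigr => n _.
by rewrite lin scalerDr !scalerA mulrC.
Qed.

Lemma chi_op_bc s u N : cform M u -> (forall n, (N <= n)%N -> dpow (act (xi a j)) n u = 0) ->
  chiop a j s (bm u) = \sum_(n < N) s ^+ n *: bm (dpow (act (xi a j)) n u).
Proof.
move=> Mu uN; rewrite (chi_opE s (N := N)) => [|n /uN d0].
  by apply: eq_bigr => n _; rewrite (bc_divpowP n).2.
by rewrite (bc_divpowP n).2// d0 bc_map0.
Qed.

End Root.

Lemma linear_sum_fun (T : W nu -> W nu) (I : finType) (f : I -> W nu) : linear T ->
  T (\sum_i f i) = \sum_i T (f i).
Proof.
move=> Tl; pose G : {linear W nu -> W nu} :=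
  HB.pack T (GRing.isLinear.Build K (W nu) (W nu) _ T Tl).
exact: (linear_sum G).
Qed.

Lemma linear_scale_fun (T : W nu -> W nu) c w : linear T -> T (c *: w) = c *: T w.
Proof.
move=> Tl; have T0 : T 0 = 0.
  by have := Tl (-1) 0 0; rewrite scaler0 addr0 scaleN1r addNr.
by rewrite -[c *: w]addr0 Tl T0 addr0.
Qed.

Section RealRoot.
Variables (a : dual_hfin L) (j : int).
Hypothesis aD : a \in Delta L.
Hypothesis en : locnil (act (xi a j)).
Hypothesis fn : locnil (act (xi (- a) (- j))).
Let naD := Delta_opp aD.
Let e : {linear V -> V} := act (xi a j).
Let f : {linear V -> V} := act (xi (- a) (- j)).
Let h : {linear V -> V} := act (aff_cartan (rcoroot a j)).

Lemma expo_cform b k (bD : b \in Delta L) (bn : locnil (act (xi b k))) u : cform M u ->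
  cform M (expo (act (xi b k)) u).
Proof.
move=> Mu; have [N uN] := bn u; rewrite (expoE uN); apply: cform_sum => n _.
exact: dpow_cform.
Qed.

Lemma expo_opp_cform b k (bD : b \in Delta L) (bn : locnil (act (xi b k))) u : cform M u ->
  cform M (expo (\- act (xi b k)) u).
Proof.
move=> Mu; have [N uN] := bn u; have nE v : (\- act (xi b k)) v = - act (xi b k) v by [].
rewrite (@expoE _ _ _ N); last by rewrite (iter_opp nE) uN scaler0.
by apply: cform_sum => n _; rewrite (dpow_opp nE); apply/cform_sign/dpow_cform.
Qed.

Lemma chi_op1 b k (bD : b \in Delta L) (bn : locnil (act (xi b k))) u : cform M u ->
  chiop b k (1 : K) (bm u) = bm (expo (act (xi b k)) u).
Proof.
move=> Mu; have [N uN] := bn u.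
rewrite (chi_op_bc bD 1 (N := N) Mu) => [|n]; last exact: dpow_nil.
rewrite (expoE uN) bc_map_sum => [|n _]; last exact: dpow_cform.
by apply: eq_bigr => n _; rewrite expr1n scale1r.
Qed.

Lemma chi_opN1 b k (bD : b \in Delta L) (bn : locnil (act (xi b k))) u : cform M u ->
  chiop b k (-1 : K) (bm u) = bm (expo (\- act (xi b k)) u).
Proof.
move=> Mu; have [N uN] := bn u; have nE v : (\- act (xi b k)) v = - act (xi b k) v by [].
rewrite (chi_op_bc bD (-1) (N := N) Mu) => [|n]; last exact: dpow_nil.
rewrite (@expoE _ _ _ N); last by rewrite (iter_opp nE) uN scaler0.
rewrite bc_map_sum => [|n _].
  apply: eq_bigr => n _; rewrite (dpow_opp nE) bc_map_sign//; exact: dpow_cform.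
by rewrite (dpow_opp nE); apply/cform_sign/dpow_cform.
Qed.

Lemma tits_cform u : cform M u -> cform M (tits e f u).
Proof.
move=> Mu; rewrite /tits; apply: (expo_cform aD en).
by apply: (expo_opp_cform naD fn); exact: (expo_cform aD en).
Qed.

Lemma tits_inv_cform u : cform M u -> cform M (tits_inv e f u).
Proof.
move=> Mu; rewrite /tits_inv; apply: (expo_opp_cform aD en).
by apply: (expo_cform naD fn); exact: (expo_opp_cform aD en).
Qed.

Lemma w_op_linear s : linear (wop a j s).
Proof.
by move=> c u v; rewrite /w_op /= (chi_op_linear aD en) (chi_op_linear naD fn) (chi_op_linear aD en).
Qed.

Lemma w_op1_bc u : cform M u -> wop a j (1 : K) (bm u) = bm (tits e f u).
Proof.
move=> Mu; rewrite /w_op /= (chi_op1 aD en)// invr1 (chi_opN1 naD fn); last exact: (expo_cform aD en).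
rewrite (chi_op1 aD en)//.
by apply: (expo_opp_cform naD fn); exact: (expo_cform aD en).
Qed.

Let w1inv : W nu -> W nu :=
  chiop a j (-1) \o chiop (- a) (- j) 1 \o chiop a j (-1).

Let w1inv_linear : linear w1inv.
Proof.
by move=> c u v; rewrite /w1inv /= (chi_op_linear aD en) (chi_op_linear naD fn) (chi_op_linear aD en).
Qed.

Let w1inv_bc u : cform M u -> w1inv (bm u) = bm (tits_inv e f u).
Proof.
move=> Mu; rewrite /w1inv /= (chi_opN1 aD en)// (chi_op1 naD fn); last exact: (expo_opp_cform aD en).
rewrite (chi_opN1 aD en)//.
by apply: (expo_cform naD fn); exact: (expo_opp_cform aD en).
Qed.

(** [inverse] is meaningful once a two-sided inverse exists; the product with opposite parameters is
    one, as is checked on integral vectors. *)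
Lemma w_op1_inverse : cancel (wop a j (1 : K)) (inverse (wop a j (1 : K))) /\
  cancel (inverse (wop a j (1 : K))) (wop a j (1 : K)).
Proof.
pose P := [set f' : W nu -> W nu | cancel (wop a j (1 : K)) f' /\ cancel f' (wop a j (1 : K))].
suff : P (xget (id : W nu -> W nu) P) by [].
apply: xgetPex; exists w1inv.
have lw := w_op_linear (1 : K).
have E1 : w1inv \o wop a j (1 : K) = id.
  apply: bc_ext => // [c x y|u Mu] /=; first by rewrite lw w1inv_linear.
  by rewrite w_op1_bc// w1inv_bc ?(titsK en fn)//; exact: tits_cform.
have E2 : wop a j (1 : K) \o w1inv = id.
  apply: bc_ext => // [c x y|u Mu] /=; first by rewrite w1inv_linear lw.
  by rewrite w1inv_bc// w_op1_bc ?(tits_invK en fn)//; exact: tits_inv_cform.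
by split=> w; [exact: (congr1 (fun g => g w) E1)|exact: (congr1 (fun g => g w) E2)].
Qed.

(** [w_a(s)] and [w_a(1)] differ by [s]-powers on the homogeneous components of the triple
    sum for [tits], and only the component of the reflected weight survives. *)
Lemma w_op_weight s (z : int) u : s != 0 -> cform M u -> h u = z%:~R *: u ->
  wop a j s (bm u) = s ^ (- z) *: bm (tits e f u).
Proof.
move=> s0 Mu hu; have [N NP] := tits_order en fn u.
have n3 n : (N <= n)%N -> dpow e n u = 0 by case: (NP n 0%N 0%N).
have n2 n n' : (N <= n)%N -> dpow f n (dpow e n' u) = 0 by case: (NP n' n 0%N).
have n1 n n' n'' : (N <= n)%N -> dpow e n (dpow f n' (dpow e n'' u)) = 0 by case: (NP n'' n' n).
have M3 n : cform M (dpow e n u) by exact: dpow_cform.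
have M2 n n' : cform M (dpow f n (dpow e n' u)) by exact: dpow_cform.
have M1 n n' n'' : cform M (dpow e n (dpow f n' (dpow e n'' u))) by exact: dpow_cform.
have Mt p : cform M (tits_term (N := N) e f u p) by rewrite /tits_term; exact: cform_sign.
pose k (p : 'I_N * 'I_N * 'I_N) : int := p.1.1%:Z - p.1.2%:Z + p.2%:Z.
(* The parameters s, -s^-1, s combine to s^(n1 - n2 + n3) and the sign already contained in
   [tits_term]. *)
have sE (p1 p2 p3 : 'I_N) : s ^+ p3 * ((- s^-1) ^+ p2 * s ^+ p1) =
    s ^ k (p1, p2, p3) * (-1) ^+ p2.
  rewrite /k /= !expfzDr// (exprNn s^-1) (exprVn s) -exprnN -!exprnP; ring.
have wE : wop a j s (bm u) = \sum_p s ^ k p *: bm (tits_term (N := N) e f u p).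
  rewrite /w_op /= (chi_op_bc aD s Mu n3).
  rewrite (linear_sum_fun _ (chi_op_linear naD fn _)) (linear_sum_fun _ (chi_op_linear aD en _)).
  transitivity (\sum_(p3 < N) \sum_(p2 < N) \sum_(p1 < N)
      s ^ k (p1, p2, p3) *: bm (tits_term (N := N) e f u (p1, p2, p3))); last first.
    rewrite pair_bigA pair_bigA /= (reindex (fun p : 'I_N * 'I_N * 'I_N => (p.2, p.1.2, p.1.1))) //=.
    by exists (fun p : 'I_N * 'I_N * 'I_N => (p.2, p.1.2, p.1.1)) => -[[]].
  apply: eq_bigr => p3 _.
  rewrite (linear_scale_fun _ _ (chi_op_linear naD fn _)) (linear_scale_fun _ _ (chi_op_linear aD en _)).
  rewrite (chi_op_bc naD _ (M3 p3) (fun n => @n2 n p3)) (linear_sum_fun _ (chi_op_linear aD en _)).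
  rewrite scaler_sumr; apply: eq_bigr => p2 _.
  rewrite (linear_scale_fun _ _ (chi_op_linear aD en _)).
  rewrite (chi_op_bc aD _ (M2 p2 p3) (fun n => @n1 n p2 p3)) !scaler_sumr; apply: eq_bigr => p1 _.
  rewrite !scalerA -mulrA sE /tits_term bc_map_sign ?scalerA//; exact: M1.
have tE := tits_sum en fn NP.
(* The terms of index k have weight z + 2 k and their total has weight -z, so only k = -z
   survives. *)
have part0 (k0 : int) : k0 != - z -> \sum_(p | k p == k0) bm (tits_term (N := N) e f u p) = 0.
  move=> kz; rewrite -bc_map_sum//.
  rewrite (tits_part0 en fn (act_ef j aD) (act_he j aD) (act_hf j aD) hu tE) ?bc_map0//.
  apply: contraNneq kz => E; rewrite -(eqr_int R) rmorphN /=; apply/eqP.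
  by move: E; set x := k0%:~R; set y := z%:~R => E; lra.
pose l := undup [seq k p | p <- enum {: 'I_N * 'I_N * 'I_N}].
have group (c : int -> K) : \sum_p c (k p) *: bm (tits_term (N := N) e f u p) =
    \sum_(k0 <- l) c k0 *: \sum_(p | k p == k0) bm (tits_term (N := N) e f u p).
  under [RHS]eq_bigr do rewrite scaler_sumr.
  rewrite [RHS](exchange_big_dep xpredT) //=; apply: eq_bigr => p _.
  rewrite -big_filter (_ : [seq k0 <- l | k p == k0] = [:: k p]) ?big_seq1//.
  rewrite -(@filter_pred1_uniq _ l (k p)) ?undup_uniq//.
    by apply: eq_filter => k0; rewrite eq_sym.
  by rewrite mem_undup map_f ?mem_enum.
rewrite wE (group (fun x => s ^ x)) tE bc_map_sum//.
have := group (fun=> s ^ (- z)); rewrite -scaler_sumr => ->.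
apply: eq_bigr => k0 _; have [->//|kz] := eqVneq k0 (- z).
by rewrite part0// !scaler0.
Qed.

Lemma tits_inv_eigen (z : int) u : h u = z%:~R *: u ->
  h (tits_inv e f u) = (- z)%:~R *: tits_inv e f u.
Proof.
move=> hu; have := tits_conj en fn (act_ef j aD) (act_he j aD) (act_hf j aD)
  (act_he j aD) (act_hf j aD) (tits_inv e f u).
rewrite (tits_invK en fn) -/h hu => E.
have /(congr1 (tits_inv e f)) : tits e f (h (tits_inv e f u)) = tits e f ((- z)%:~R *: tits_inv e f u).
  rewrite E -[(- z)%:~R *: _]addr0 (tits_linear en fn) (tits_invK en fn).
  have -> : tits e f 0 = 0.
    by have := tits_linear en fn (-1) 0 0; rewrite scaler0 addr0 scaleN1r addNr.
  by rewrite addr0 scalerA -scalerBl rmorphN /=; congr (_ *: _); ring.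
by rewrite !(titsK en fn).
Qed.

(** w(1)^-1 turns weight [z] into -z; then w(s) contributes s^z and restores the vector. *)
Lemma h_op_weight s (z : int) c u : s != 0 -> cform M u -> h u = z%:~R *: u ->
  hop a j s (c *: bm u) = (s ^ z * c) *: bm u.
Proof.
move=> s0 Mu hu; have [k1 k2] := w_op1_inverse; rewrite /h_op /=.
have Mt := tits_inv_cform Mu.
have E : wop a j (1 : K) (c *: bm (tits_inv e f u)) = c *: bm u.
  by rewrite (linear_scale_fun _ _ (w_op_linear _)) w_op1_bc// (tits_invK en fn).
rewrite -E k1 (linear_scale_fun _ _ (w_op_linear _)).
rewrite (w_op_weight s0 Mt (tits_inv_eigen hu)) opprK (tits_invK en fn) scalerA.
by rewrite mulrC.
Qed.

End RealRoot.
End LocalTorus.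

(** * The adelic torus *)

Lemma valuationV (K : fieldType) (v : K -> int) x : is_valuation v -> x != 0 -> v x^-1 = - v x.
Proof.
move=> vv x0; have := Defs.valM vv x0 (invr_neq0 x0).
by rewrite divff// (valuation1 vv) => h; lia.
Qed.

Lemma valuationX (K : fieldType) (v : K -> int) x (z : int) :
  is_valuation v -> x != 0 -> v (x ^ z) = z * v x.
Proof.
move=> vv x0.
have nat (n : nat) : v (x ^+ n) = n%:Z * v x.
  elim: n => [|n IH]; first by rewrite (valuation1 vv) mul0r.
  by rewrite exprS (Defs.valM vv x0 (expf_neq0 _ x0)) IH; lia.
case: z => n; first exact: nat.
by rewrite NegzE -exprnN (valuationV vv (expf_neq0 _ x0)) nat mulNr.
Qed.

Lemma valuation_prod (K : fieldType) (v : K -> int) (I : finType) (x : I -> K) :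
  is_valuation v -> (forall i, x i != 0) -> v (\prod_i x i) = \sum_i v (x i).
Proof.
move=> vv x0; pose P (a : K) (b : int) := a != 0 /\ v a = b.
suff [] : P (\prod_i x i) (\sum_i v (x i)) by [].
elim/big_rec2: _ => [|i y1 y2 _ [y0 <-]]; first by split; [exact: oner_neq0|exact: valuation1].
by split; [rewrite mulf_neq0|rewrite (Defs.valM vv)].
Qed.

Section Theta.
Variables (R : realType) (L : chevalleyAlgebra R) (lam : dual_hext L).
Hypothesis lam_dom : forall i, exists n : nat, lam (aff_simplecoroot L i) = n%:R.
Hypothesis lam_neq0 : exists i, lam (aff_simplecoroot L i) != 0.
Variables (V : hwModule lam) (M : chevalleyForm V).
Variables (F : fieldType) (Fc : forall nu : place F, completion nu).
Variable W : forall nu : place F, base_change M (Fc nu).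
Local Notation act := (@hwact R L lam V).
Local Notation theta := (@theta_fun _ _ _ _ M _ Fc W).
Implicit Types (s t : 'I_(rank L).+1 -> idele Fc) (nu : place F) (i : 'I_(rank L).+1).

Lemma weight_integral mu (u : V) i : weight_vector mu u -> u != 0 ->
  exists z : int, mu (aff_simplecoroot L i) = z%:~R.
Proof.
move=> wu u0; have aD := sidx_Delta i; have [en fn] := simple_locnil V lam_dom i.
apply: (eigen_integral en fn (act_ef _ aD) (act_he _ aD) (act_hf _ aD) _ u0).
by rewrite aff_simplecorootE; exact: wu.
Qed.

Lemma h_simple_weight nu i (x : Fc nu) (z : int) c mu (u : V) : x != 0 ->
  cform M u -> weight_vector mu u -> mu (aff_simplecoroot L i) = z%:~R ->
  h_simple i x (c *: bc_map (W nu) u) = (x ^ z * c) *: bc_map (W nu) u.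
Proof.
move=> x0 Mu wu mz; have [en fn] := simple_locnil V lam_dom i.
rewrite /h_simple -/(sidx i) -/(sdeg i).
apply: (h_op_weight W (sidx_Delta i) en fn) => //.
by rewrite -mz aff_simplecorootE; exact: wu.
Qed.

Lemma theta_weight s nu mu (u : V) (z : 'I_(rank L).+1 -> int) : cform M u ->
  weight_vector mu u -> (forall i, mu (aff_simplecoroot L i) = (z i)%:~R) ->
  theta s (bc_map (W nu) u) = (\prod_i s i nu ^ z i) *: bc_map (W nu) u.
Proof.
move=> Mu wu mz; rewrite /theta_fun -big_enum.
elim: (enum _) => [|i r IH] /=; first by rewrite big_nil scale1r.
by rewrite IH (h_simple_weight _ (idele_neq0 _ _) Mu wu (mz i)) big_cons.
Qed.

(** The valuations of [s / t] define a cocharacter annihilating all weights of the faithful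
    module [V], and the simple coroots are linearly independent. *)
Lemma theta_valuation s t : theta s = theta t ->
  forall nu i, cpl_val (s i nu) = cpl_val (t i nu).
Proof.
move=> st nu; have vv := cpl_valP (Fc nu).
pose n i : int := cpl_val (s i nu) - cpl_val (t i nu).
pose X : hext L := \sum_i (n i)%:~R *: aff_simplecoroot L i.
suff X0 : X = 0.
  move=> i; apply/eqP; rewrite -subr_eq0 -/(n i) -(intr_eq0 R).
  by rewrite (aff_simplecoroot_free X0).
have wX mu (u : V) : cform M u -> weight_vector mu u -> u != 0 -> mu X = 0.
  move=> Mu wu u0; have [u' [Mu' wu' bu']] := bc_map_neq0 (W nu) Mu wu u0.
  have /choice[z mz] : forall i, exists z : int, mu (aff_simplecoroot L i) = z%:~R.
    by move=> i; exact: weight_integral wu u0.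
  (* Equal operators have equal scalars on this nonzero vector; valuations of the scalars give a
     linear relation on the [n i]. *)
  have := congr1 (fun f => f nu (bc_map (W nu) u')) st.
  rewrite /= !(theta_weight _ _ Mu' wu' mz) => /eqP.
  rewrite -subr_eq0 -scalerBl scaler_eq0 (negPf bu') orbF subr_eq0 => /eqP E.
  have ex (r : 'I_(rank L).+1 -> idele Fc) : cpl_val (\prod_i r i nu ^ z i) = \sum_i z i * cpl_val (r i nu).
    rewrite (valuation_prod vv) => [|i]; last by rewrite expfz_neq0// idele_neq0.
    by apply: eq_bigr => i _; rewrite (valuationX _ vv)// idele_neq0.
  have := congr1 (@cpl_val _ _ (Fc nu)) E; rewrite !ex => /eqP.
  rewrite -subr_eq0 -sumrB => /eqP E0.
  rewrite /X linear_sum -[RHS](_ : (0 : int)%:~R = 0 :> R) // -E0 rmorph_sum.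
  by apply: eq_bigr => i _; rewrite linearZ /= scaleoE mz -rmorphM /n; congr (_%:~R); ring.
have X2 : X.2 = 0.
  have -> : X.2 = \sum_i ((n i)%:~R *: aff_simplecoroot L i).2.
    by rewrite /X; elim/big_rec2: _ => // i x y _ <-.
  by rewrite big1// => i _; rewrite aff_simplecorootE /= scaler0.
apply: (cartan_faithful (V := V) _ X2); first exact: lam_center.
have XM u : cform M u -> act (aff_cartan X) u = 0.
  move=> /cform_graded[r [rM ->]]; rewrite linear_sum big_seq big1// => u' /rM[Mu' [mu wu']].
  have [->|u0] := eqVneq u' 0; first by rewrite linear0.
  by rewrite /= wu' (wX _ _ Mu' wu' u0) scale0r.
move=> v; have [I [b [bspan _ MP]]] := cform_Z M.
have [c fc ->] := bspan v; rewrite (fsbigTE (fset_set [set i | c i != 0])); last first.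
  move=> i; rewrite in_fset_set// mem_setE /= negbK => /eqP ->; exact: scale0r.
rewrite linear_sum big1// => i _; rewrite linearZ /= XM ?scaler0//.
apply/MP; exists (fun k => (k == i)%:Z).
  apply: (@sub_finite_set _ _ [set i]); last exact: finite_set1.
  by move=> k /=; case: (eqVneq k i) => [->|_] //; rewrite eqxx.
rewrite (fsbigTE [fset i]%fset) ?big_seq_fset1 ?eqxx ?scale1r// => k.
by rewrite inE => /negPf ->; rewrite scale0r.
Qed.

(** A single factor is a loop element with coefficients x, 0, 0, ..., because [chi_op] at 0 is the
    identity. *)
Lemma chi_op_K nu a j (x : Fc nu) : a \in Delta L -> val_ge (@cpl_val _ _ (Fc nu)) 0 x ->
  Kgroup (@chi_op _ _ _ _ M _ _ W nu a j x).
Proof.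
move=> aD xO; apply: generated_mem; exists a, j, (fun n => if n == 0%N then x else 0); split=> //.
  by move=> n; case: ifP => // _; rewrite /val_ge eqxx.
move=> v; exists 1%N => -[//|n] _.
rewrite /= addr0; congr (chi_op _ _ _ _).
suff H : forall m, (0 < m)%N -> v = foldr (fun (i : nat) (f : W nu -> W nu) =>
    @chi_op _ _ _ _ M _ _ W nu a (j + i%:Z) (if i == 0%N then x else 0) \o f) id (iota m n) v.
  exact: H.
elim: n => [//|n IH] m m0 /=.
by rewrite -(IH m.+1)// (gtn_eqF m0) /= chi_op0.
Qed.

Lemma h_simple_K nu i (x : Fc nu) : x != 0 -> cpl_val x = 0 ->
  Kgroup (@h_simple _ _ _ _ M _ _ W nu i x).
Proof.
move=> x0 vx; have vv := cpl_valP (Fc nu).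
have aD := sidx_Delta i; have naD := Delta_opp aD.
have [en fn] := simple_locnil V lam_dom i.
have wK (y : Fc nu) : y != 0 -> cpl_val y = 0 ->
    Kgroup (@w_op _ _ _ _ M _ _ W nu (sidx i) (sdeg i) y).
  move=> y0 vy; have vy0 : val_ge (@cpl_val _ _ (Fc nu)) 0 y by rewrite /val_ge vy lexx orbT.
  have vy1 : val_ge (@cpl_val _ _ (Fc nu)) 0 (- y^-1).
    by rewrite /val_ge (valuationN vv) ?invr_eq0// (valuationV vv)// vy oppr0 lexx orbT.
  apply: generated_comp; first apply: generated_comp; exact: chi_op_K.
have w1 := wK _ (oner_neq0 _) (valuation1 vv).
have [k1 k2] := w_op1_inverse W nu aD en fn.
by apply: generated_comp; [exact: wK|exact: generated_inv w1 k1 k2].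
Qed.

(** Away from the finitely many places where some [s i] is not a unit, every factor lies in
    [Kgroup]. *)
Lemma theta_exists s : exists h : adelic_torus W, is_theta s h.
Proof.
have H nu : Hgroup (@theta s nu).
  rewrite /theta_fun; elim: (enum _) => [|i r IH] /=; first exact: generated_id.
  apply: generated_comp => //; apply: generated_mem; exists i, (s i nu).
  by rewrite idele_neq0.
have Kf : finite_set [set nu | ~ Kgroup (@theta s nu)].
  apply: (@sub_finite_set _ _ (\bigcup_(i in [set: 'I_(rank L).+1])
      [set nu | cpl_val (s i nu) != 0])); last first.
    by apply: bigcup_finite; [exact: finite_finset|move=> i _; exact: idele_fin].
  move=> nu /= nK; apply: contrapT => h; apply: nK.
  have v0 i : cpl_val (s i nu) = 0.
    by apply/eqP; apply: contrapT => /negP si; apply: h; exists i.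
  rewrite /theta_fun; elim: (enum _) => [|i r IH] /=; first exact: generated_id.
  by apply: generated_comp => //; apply: h_simple_K; [exact: idele_neq0|].
by exists (AdelicTorus H Kf).
Qed.

End Theta.

(** * Topology of the torus *)

Lemma valuation_addl (K : fieldType) (v : K -> int) x z : is_valuation v ->
  x != 0 -> val_ge v (v x + 1) z -> x + z != 0 /\ v (x + z) = v x.
Proof.
move=> vv x0 /orP[/eqP ->|xz]; first by rewrite addr0.
have [->|z0] := eqVneq z 0; first by rewrite addr0.
have s0 : x + z != 0.
  apply: contraTneq xz => /eqP; rewrite addr_eq0 => /eqP ->.
  by rewrite (valuationN vv)//; lia.
have := Defs.valD vv x0 z0 s0.
have := Defs.valD vv s0 (_ : - z != 0); rewrite oppr_eq0 addrK x0 => /(_ z0 isT).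
by rewrite (valuationN vv)// => h1 h2; split=> //; lia.
Qed.

Section TorusTopology.
Variables (R : realType) (L : chevalleyAlgebra R) (lam : dual_hext L).
Hypothesis lam_dom : forall i, exists n : nat, lam (aff_simplecoroot L i) = n%:R.
Hypothesis lam_neq0 : exists i, lam (aff_simplecoroot L i) != 0.
Variables (V : hwModule lam) (M : chevalleyForm V).
Variables (F : fieldType) (Fc : forall nu : place F, completion nu).
Variable W : forall nu : place F, base_change M (Fc nu).

Definition same_valuation (x y : idele Fc) := forall nu, cpl_val (x nu) = cpl_val (y nu).

(** Prescribing the valuation is an open condition at each place, and at almost all places it is
    that of the units, so the set is a box. *)
Lemma open_same_valuation (y : idele Fc) : open [set x : idele Fc | same_valuation x y].
Proof.
pose U nu := [set x : Fc nu | x != 0 /\ cpl_val x = cpl_val (y nu)].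
have box : idele_box [set x : idele Fc | same_valuation x y].
  exists U; split.
  - move=> nu x [x0 vx]; exists (cpl_val x + 1) => z xz.
    have [h1 h2] := valuation_addl (cpl_valP (Fc nu)) x0 xz.
    by move: h1 h2; rewrite addrC subrK /U /= => h1 ->.
  - apply: (sub_finite_set _ (idele_fin y)) => nu /= UN; apply/eqP => y0; apply: UN.
    by rewrite /U /int_units y0.
  - apply/seteqP; split=> x /= h nu; last by have [] := h nu.
    by split; [exact: idele_neq0|exact: h].
exists [set [set x : idele Fc | same_valuation x y]]; last by rewrite bigcup_set1.
move=> _ ->; exists [fset [set x : idele Fc | same_valuation x y]]%fset.
  by move=> A; rewrite in_fset1 => /eqP ->; exact/mem_set.
by rewrite set_fset1 bigcap_set1.
Qed.

Lemma idele_norm_same (x y : idele Fc) : same_valuation x y -> idele_norm R x = idele_norm R y.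
Proof. by move=> xy; rewrite /idele_norm; apply: eq_fsbigr => nu _; rewrite xy. Qed.

Lemma idele_norm_ge0 (x : idele Fc) : 0 <= idele_norm R x.
Proof.
rewrite /idele_norm; elim/big_ind: _ => // [a b|nu _]; first exact: mulr_ge0.
by rewrite exprz_ge0.
Qed.

Local Notation is_theta := (@is_theta R L lam V M F Fc W).

(** Empty preimage of [h]: then the class consists of the [h'] with empty preimage. *)
Definition valuation_class (h : adelic_torus W) : set (adelic_torus W) :=
  [set h' | forall s', is_theta s' h' ->
    exists2 s, is_theta s h & forall i, same_valuation (s' i) (s i)].

(** Since [theta_valuation] makes the valuations of a preimage unique, the preimage of the class
    under theta is a union of finite intersections of open conditions on the coordinates. *)
Lemma open_valuation_class h : open (valuation_class h).
Proof.
have op : torus_open (valuation_class h).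
  rewrite /torus_open /=.
  have -> : [set s : {ptws 'I_(rank L).+1 -> idele Fc} |
        exists2 h', valuation_class h h' & is_theta s h'] =
      \bigcup_(t in [set t | is_theta t h]) [set s | forall i, same_valuation (s i) (t i)].
    apply/seteqP; split=> s /=.
      by move=> [h' hh' /hh'[t th st]]; exists t.
    move=> [t th st]; have [h' sh'] := theta_exists lam_dom W s.
    exists h' => // s' s'h'; exists t => // i nu; rewrite -(st i nu).
    exact: (theta_valuation lam_dom lam_neq0 (etrans (esym s'h') sh')).
  apply: bigcup_open => t _; rewrite openE => s st.
  pose X := {ptws 'I_(rank L).+1 -> idele Fc}.
  apply: (@filter_forall X _ (fun i u => same_valuation (u i) (t i)) (nbhs (s : X)) (nbhs_filter (s : X))) => i.
  have nb : nbhs (s i) [set x | same_valuation x (t i)].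
    by apply: open_nbhs_nbhs; split; [exact: open_same_valuation|exact: st].
  exact: (@proj_continuous _ (fun=> idele Fc) i s _ nb).
exists [set valuation_class h]; last by rewrite bigcup_set1.
move=> _ ->; exists [fset valuation_class h]%fset.
  by move=> A; rewrite in_fset1 => /eqP ->; exact/mem_set.
by rewrite set_fset1 bigcap_set1.
Qed.

Lemma torus1_K : finite_set [set nu | ~ @Kgroup _ _ _ _ M _ _ W nu id].
Proof. by apply: (sub_finite_set _ (finite_set0 _)) => nu; apply; exact: generated_id. Qed.

Definition torus1 := AdelicTorus (fun nu => generated_id _) torus1_K.
HB.instance Definition _ := isPointed.Build (adelic_torus W) torus1.

(** The idelic norm sees only valuations, hence is constant on each class of a finite subcover. The
    logarithm is bounded because the exponents may have either sign. *)
Lemma compact_norm_bound (C : set (adelic_torus W)) : compact C ->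
  exists2 b : R, 0 <= b & forall h, C h -> forall s, is_theta s h ->
    forall i, `|ln (idele_norm R (s i))| <= b.
Proof.
rewrite compact_cover => /(_ _ [set: adelic_torus W] valuation_class).
case=> [h _|h _|A _ AC]; first exact: open_valuation_class.
  exists h => // s sh; exists s => // i nu //.
have /choice[y yE] : forall h : adelic_torus W, exists y : 'I_(rank L).+1 -> R,
    forall s, is_theta s h -> forall i, idele_norm R (s i) = y i.
  move=> h; have [[s sh]|nh] := pselect (exists s, is_theta s h); last first.
    by exists (fun=> 0) => s sh; case: nh; exists s.
  exists (fun i => idele_norm R (s i)) => t th i; apply: idele_norm_same => nu.
  exact: (theta_valuation lam_dom lam_neq0 (etrans (esym th) sh)).
exists (\sum_(h <- A) \sum_i `|ln (y h i)|) => [|h].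
  by rewrite sumr_ge0// => h _; rewrite sumr_ge0.
move=> /AC[h' /= h'A hh'] s sh i.
have [t th' st] := hh' _ sh; rewrite (idele_norm_same (st i)) (yE _ _ th').
rewrite (big_rem h')//= (bigD1 i)//= -addrA lerDl.
by rewrite addr_ge0 ?sumr_ge0// => k _; rewrite sumr_ge0.
Qed.

End TorusTopology.

Section TorusCharacter.
Variables (R : realType) (L : chevalleyAlgebra R) (lam : dual_hext L).
Variables (V : hwModule lam) (M : chevalleyForm V).
Variables (F : fieldType) (Fc : forall nu : place F, completion nu).
Variable W : forall nu : place F, base_change M (Fc nu).

Lemma torus_char_bound (m : place F -> int) (mu : dual_hext L) (h : adelic_torus W) (b : R) :
  finite_set [set nu | m nu != 0] ->
  (forall s, is_theta s h -> forall i, `|ln (idele_norm R (s i))| <= b) ->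
  `|torus_char m mu h| <= expR (b * (\sum_i `|mu (aff_simplecoroot L i)|)
      - mu (hext_D L) * \sum_(nu \in [set: place F]) ln ((residue_card nu)%:R : R) * (m nu)%:~R).
Proof.
move=> mf hb; rewrite /torus_char; case: xgetP => [x _ [s sh ->]|_]; last first.
  by rewrite normr0 expR_ge0.
have /andP[p0 p1] := place_prod_bound (mu (hext_D L)) mf.
have q0 : 0 <= \prod_i idele_norm R (s i) `^ mu (aff_simplecoroot L i).
  by rewrite prodr_ge0// => i _; exact: powR_ge0.
rewrite ger0_norm ?mulr_ge0// expRD; apply: ler_pM => //.
rewrite mulr_sumr (big_morph _ (@expRD R) (@expR0 R)).
apply: ler_prod => i _; rewrite powR_ge0 /=.
by apply: powR_bound; [exact: idele_norm_ge0|exact: hb].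
Qed.

End TorusCharacter.

(** * Bound on a single term, and conclusion *)

Section Term.
Variables (R : realType) (L : chevalleyAlgebra R).
Variables (k : finFieldType) (F : fieldExtType {fraction {poly k}}) (g : nat).
Variables (chi rho : dual_hhat L).
Hypothesis rhoP : forall i, rho (hhat_simplecoroot L i) = 1.
Hypothesis chiP : forall i, chi (hhat_simplecoroot L i) < -2.

Lemma center_lt0 : (chi + rho) (0, 1) < 0.
Proof.
have [p p0 E] := center_coroots L.
have -> : ((0, 1) : hhat L) = \sum_i p i *: hhat_simplecoroot L i.
  rewrite (_ : (0, 1) = ((0, 1, 0) : hext L).1)// E.
  by elim/big_rec2: _ => // i x y _ <-.
rewrite linear_sum /= big_ord_recr /=.
have neg i : (chi + rho) (p i *: hhat_simplecoroot L i) < 0.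
  rewrite linearZ /= scaleoE add_lfunE rhoP pmulr_rlt0//.
  by have := chiP i; lra.
rewrite -oppr_gt0 opprD addrC ltr_wpDr ?oppr_gt0//.
by rewrite -sumrN sumr_ge0// => i _; rewrite oppr_ge0 ltW.
Qed.

(** The weight pairs linearly in the size of the translation part [dcomp t] with the simple
    coroots and quadratically with [D]. *)
Lemma term_bound (b Q r : R) : 0 <= b -> 0 < Q -> 0 < r -> r <= 1 ->
  exists2 K, 0 <= K & forall t mu, reduced_word t ->
  mu = weyl_act (weyl_word t) (ext_hhat (chi + rho)) - ext_hhat rho ->
  expR (b * (\sum_i `|mu (aff_simplecoroot L i)|) - mu (hext_D L) * Q)
  * `|c_coef F g chi rho (weyl_word t)| <= K * r ^+ size t.
Proof.
move=> b0 Q0 r0 r1.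
have [C1 C10 C1P] := coroot_orbit_bound (chi + rho).
have [c [C2 [c0 C20 C2P]]] := D_orbit_bound center_lt0.
have [M M1 MP] := c_coef_bound F g center_lt0.
pose l : R := (rank L).+1%:R; pose N : R := (size (Delta L))%:R.
have N0 : 0 <= N by exact: ler0n.
have l0 : 0 <= l by exact: ler0n.
have M0 : 0 < M by exact: lt_le_trans ltr01 M1.
have lM : 0 <= ln M by exact: ln_ge0.
have lr : 0 <= - ln r by rewrite oppr_ge0 ln_le0.
(* [A] and [B] collect the constants and the coefficients of [S] in the exponent: from the simple
   coroots, from D, from the two powers of [M], and from r^(-l(w)), inserted so that r^l(w) can be
   split off. *)
pose A := b * l * (C1 + 1) + (2 * ln M - ln r) * N.
pose B := b * l * C1 + Q * C2 + 2 * ln M - ln r.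
exists (expR (A + N * (B ^+ 2 / (4 * (Q * c))))); first exact: expR_ge0.
move=> t mu red muD.
set S := rootsum (dcomp t); have S0 : 0 <= S by exact: rootsum_ge0.
have muE x : mu x = (chi + rho) (weyl_word (rev t) x).1 - rho x.1.
  rewrite muD -/(wact t _) add_lfunE opp_lfunE wactE.
  by rewrite /ext_hhat !linfun_of_linear// => a u v; rewrite linearP.
have h1 : \sum_i `|mu (aff_simplecoroot L i)| <= l * (C1 * (1 + S) + 1).
  rewrite /l -[(rank L).+1 in leRHS]card_ord mulr_natl -sumr_const.
  apply: ler_sum => i _; rewrite muE rhoP; apply: le_trans (ler_normB _ _) _.
  by rewrite normr1 lerD2r C1P.
have h2 : Q * (c * rootsq (dcomp t) - C2 * S) <= Q * mu (hext_D L).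
  by rewrite ler_pM2l// muE /= linear0 subr0; exact: C2P.
have h3 := reduced_size_dcomp red.
have h4 := size_invlist (dcomp t).
have h5 := quadratic_bound B (dcomp t) (mulr_gt0 Q0 c0).
have Mx n : M ^+ n = expR (ln M * n%:R) by rewrite mulrC expRM_natl lnK.
have rx n : r ^+ n = expR (ln r * n%:R).
  by rewrite mulrC expRM_natl lnK.
apply: le_trans (_ : _ * (M ^+ size t * M ^+ size (invlist (dcomp t))) <= _).
  by apply: ler_wpM2l; [exact: expR_ge0|exact: MP].
rewrite !Mx rx -!expRD ler_expR.
have b1 := ler_wpM2l b0 h1.
have b3 : ln M * (size t)%:R <= ln M * (N + S) by rewrite ler_wpM2l.
have b4 : ln M * (size (invlist (dcomp t)))%:R <= ln M * (N + S) by rewrite ler_wpM2l.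
have b5 : - ln r * (size t)%:R <= - ln r * (N + S) by rewrite ler_wpM2l.
move: b1 h2 b3 b4 b5 h5; rewrite /A /B -/N -/S; lra.
Qed.

End Term.

Theorem theorem5p32
  (R : realType) (L : chevalleyAlgebra R)
  (k : finFieldType) (F : fieldExtType {fraction {poly k}})
  (constF : is_constant_field F) (g : nat) (genusF : is_genus F g)
  (Fc : forall nu : place F, completion nu)
  (lam : dual_hext L)
  (lam_dom : forall i, exists n : nat, lam (aff_simplecoroot L i) = n%:R)
  (lam_neq0 : exists i, lam (aff_simplecoroot L i) != 0)
  (V : hwModule lam) (M : chevalleyForm V)
  (W : forall nu : place F, base_change M (Fc nu))
  (rho : dual_hhat L) (rhoP : forall i, rho (hhat_simplecoroot L i) = 1)
  (chi : dual_hhat L) (chiP : forall i, chi (hhat_simplecoroot L i) < -2)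
  (m : place F -> int) (m_fin : finite_set [set nu | m nu != 0])
  (m_pos : 0 < \sum_(nu \in [set: place F])
                 ln ((residue_card nu)%:R : R) * (m nu)%:~R) :
  let term (w : set_type (affW L)) (h : adelic_torus W) : R :=
    torus_char m (weyl_act (val w) (ext_hhat (chi + rho)) - ext_hhat rho) h
    * c_coef F g chi rho (val w) in
  forall C : set (adelic_torus W), compact C ->
    (forall h, C h ->
       summable [set: set_type (affW L)] (fun w => (term w h)%:E)) /\
    exists S : adelic_torus W -> R,
      {uniform C, (fun (A : {fset set_type (affW L)}) h =>
                     \sum_(w <- A) term w h) @ summability.totally --> S}.
Proof.
move=> term C cC.
have [b b0 bC] := compact_norm_bound lam_dom lam_neq0 cC.
(* With l + 1 letters this gives ratio 1/2 in the sum over words. *)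
pose r : R := (2 * (rank L).+1%:R)^-1.
have r0 : 0 < r by rewrite invr_gt0 mulr_gt0.
have r1 : r <= 1.
  rewrite invf_le1 ?mulr_gt0//; apply: (@le_trans _ _ (2 * 1)); first by lra.
  by rewrite ler_pM2l// ler1n.
have [K K0 KP] := term_bound F g rhoP chiP b0 m_pos r0 r1.
(* One reduced word is chosen per element; distinct elements have distinct words, so sums over the
   group become sums over distinct words. *)
have /choice[t tP] : forall w : set_type (affW L), exists t, weyl_word t = val w /\ reduced_word t.
  move=> w; have [t [tw red _]] := weyl_length_reduced (set_valP w).
  by exists t.
have fa w h : C h -> `|term w h| <= K * r ^+ size (t w).
  move=> Ch; have [tw red] := tP w; apply: le_trans (KP _ _ red erefl).
  rewrite /term -tw normrM; apply: ler_wpM2r => //.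
  exact: torus_char_bound m_fin (bC h Ch).
have aM (A : {fset set_type (affW L)}) : \sum_(w <- A) K * r ^+ size (t w) <= K * 2.
  rewrite -mulr_sumr ler_wpM2l//.
  have := @words_sum_bound R 'I_(rank L).+1 r (map t A).
  rewrite big_map; apply.
  - rewrite map_inj_uniq ?fset_uniq// => w w' ww'; apply: val_inj.
    by rewrite -(proj1 (tP w)) -(proj1 (tP w')) ww'.
  - exact: ltW.
  - by rewrite card_ord /r invfM mulrCA divff ?mulr1 ?pnatr_eq0.
split; first by move=> h; exact: mtest_summable fa aM h.
by apply: mtest_uniform fa aM _ => w; rewrite mulr_ge0// exprn_ge0// ltW.
Qed.
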